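(* Let $\Gamma\in C_b^1(\mathbb{R})$ be $2\pi$-periodic, let $H\in C_b^1(\mathbb{R}^2)$ be $2\pi$-periodic in each argument, and let $\omega\in L^\infty([0,1])$. Then for every $\varepsilon>0$ and every $(\theta_0,a_0)\in X$, the continuum system $$\partial_t\theta=\mathcal F_\omega(\theta,a),\qquad \varepsilon\,\partial_t a=\mathcal G(\theta,a),\qquad (\theta,a)|_{t=0}=(\theta_0,a_0)$$ has a unique global strong solution. Moreover, for every $T>0$, every $R>0$ and every $\varepsilon_0>0$, the finite-time solution maps $(\theta_0,a_0,\omega)\mapsto(\theta,a)$ corresponding to $\varepsilon\in(0,\varepsilon_0]$ are Lipschitz on the ball $$\{(\theta_0,a_0,\omega):\ \|\theta_0\|_\infty+\|a_0\|_\infty+\|\omega\|_\infty\le R\}$$ as maps into $C([0,T];X)$, with a Lipschitz constant independent of $\varepsilon\in(0,\varepsilon_0]$.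
   Context: $X_\theta=L^\infty([0,1])$, $X_a=L^\infty([0,1]^2)$ (real-valued), $X=X_\theta\times X_a$ with norm $\|(\theta,a)\|_X=\|\theta\|_\infty+\|a\|_\infty$, where $\|\cdot\|_\infty$ is the essential supremum norm on the respective space. $C_b^k(\mathbb{R}^m)$ denotes $C^k$ functions bounded together with all partial derivatives up to order $k$. For $\omega\in X_\theta$ the operators $\mathcal F_\omega:X\to X_\theta$ and $\mathcal G:X\to X_a$ are $$\mathcal F_\omega(\theta,a)(x)=\omega(x)+\int_0^1 a(x,y)\,\Gamma(\theta(y)-\theta(x))\,dy,\qquad \mathcal G(\theta,a)(x,y)=-a(x,y)+H(\theta(x),\theta(y)).$$ A strong solution on $[0,T]$ is a pair $(\theta,a)\in W^{1,\infty}([0,T];X)$ (Bochner–Sobolev space of functions in $L^\infty([0,T];X)$ with one weak time derivative in $L^\infty([0,T];X)$) satisfying the initial condition and satisfying the equations for almost every $t\in[0,T]$; a global strong solution is one on $[0,\infty)$ that is a strong solution on $[0,T]$ for every $T>0$. *)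

(* Defs.v *)
From HB Require Import structures.
From mathcomp Require Import all_boot all_order all_algebra ring_quotient.
From mathcomp Require Import all_classical all_reals all_analysis ess_sup_inf.

Set Implicit Arguments.
Unset Strict Implicit.
Unset Printing Implicit Defensive.

Import Order.TTheory GRing.Theory Num.Theory.
Import numFieldNormedType.Exports.

Local Open Scope ring_scope.
Local Open Scope classical_set_scope.

(* L^oo(mu) as a normed module: the functions of finite essential supremum
   norm, modulo equality mu-almost everywhere. *)
Section Linf.
Context d (T : measurableType d) (R : realType).
Variable mu : {measure set T -> \bar R}.

Let Lf := LfunType mu (leey 1 : (1 <= +oo :> \bar R)%E).

Definition Linf_null : {pred Lf} := fun f => `[< \forall x \ae mu, f x = 0 >].

Lemma Linf_null_zmod_closed : zmod_closed Linf_null.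
Proof.
split=> [|f g]; first by apply/asboolP; exact: nearW.
move=> /asboolP f0 /asboolP g0; apply/asboolP.
apply: filterS2 f0 g0 => x fx gx.
by rewrite -[LHS]/(f x - g x) fx gx subrr.
Qed.

HB.instance Definition _ :=
  GRing.isZmodClosed.Build Lf Linf_null Linf_null_zmod_closed.

Definition Linf : Type := Quotient.quot Linf_null.

HB.instance Definition _ := GRing.Zmodule.on Linf.
HB.instance Definition _ := EqQuotient.on Linf.

Definition Linf_fun (u : Linf) : T -> R := (repr u : Lf).

Let Linf_pi (f : Lf) : Linf := \pi_Linf%qT f.

Let Linf_piP f g : Linf_pi f = Linf_pi g <-> \forall x \ae mu, f x = g x.
Proof.
have -> : (Linf_pi f = Linf_pi g) <-> f - g \in Linf_null.
  by rewrite Quotient.idealrBE; split => /eqP.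
split=> [/asboolP|] fg.
  by apply: filterS fg => x fgx; apply/eqP; rewrite -subr_eq0; exact/eqP.
apply/asboolP; apply: filterS fg => x fgx.
by rewrite -[LHS]/(f x - g x) fgx subrr.
Qed.

Let Linf_fun_pi f : \forall x \ae mu, Linf_fun (Linf_pi f) x = f x.
Proof. by apply/Linf_piP; rewrite /Linf_pi reprK. Qed.

Let Linf_piD f g : Linf_pi (f + g) = Linf_pi f + Linf_pi g.
Proof. exact: Quotient.pi_add. Qed.

Let Linf_reprK (u : Linf) : Linf_pi (repr u) = u.
Proof. exact: reprK. Qed.

Let scale (a : R) (u : Linf) : Linf := Linf_pi (a *: (repr u : Lf)).

Let scale_pi a f : scale a (Linf_pi f) = Linf_pi (a *: f).
Proof.
apply/Linf_piP; apply: filterS (Linf_fun_pi f) => x fx.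
by rewrite -[RHS]/(a * f x) -fx.
Qed.

Let scaleA a b v : scale a (scale b v) = scale (a * b) v.
Proof. by rewrite -[v]Linf_reprK !scale_pi scalerA. Qed.

Let scale1 : left_id 1 scale.
Proof. by move=> v; rewrite -[v]Linf_reprK scale_pi scale1r. Qed.

Let scaleDr : right_distributive scale +%R.
Proof.
move=> a u v; rewrite -[u]Linf_reprK -[v]Linf_reprK -Linf_piD.
by rewrite !scale_pi scalerDr Linf_piD.
Qed.

Let scaleDl v : {morph scale^~ v : a b / a + b}.
Proof.
by move=> a b; rewrite -[v]Linf_reprK !scale_pi scalerDl Linf_piD.
Qed.

HB.instance Definition _ :=
  GRing.Zmodule_isLmodule.Build R Linf scaleA scale1 scaleDr scaleDl.

Let norm (u : Linf) : R := fine ('N[mu]_+oo[EFin \o Linf_fun u])%E.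

Let norm_pi f : norm (Linf_pi f) = fine ('N[mu]_+oo[EFin \o f])%E.
Proof.
rewrite /norm !unlock; case: ifPn => // _; congr fine; apply: eq_ess_sup.
by apply: filterS (Linf_fun_pi f) => x fx; rewrite /= fx.
Qed.

Let ler_normD u v : norm (u + v) <= norm u + norm v.
Proof.
rewrite -[u]Linf_reprK -[v]Linf_reprK -Linf_piD !norm_pi.
exact: ler_LnormD.
Qed.

Let normrZ a u : norm (a *: u) = `|a| * norm u.
Proof.
rewrite -[u]Linf_reprK /GRing.scale/= scale_pi !norm_pi.
have -> : EFin \o (a *: (repr u : Lf)) = EFin \o (a \*: (repr u : Lf)) by [].
by rewrite LnormZ fineM// -finite_norm_fine.
Qed.

Let normr0_eq0 u : norm u = 0 -> u = 0.
Proof.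
rewrite -[u]Linf_reprK norm_pi => /fine_Lnormr_eq0 u0.
have -> : 0 = Linf_pi 0 :> Linf.
  by rewrite -[RHS](addrK (Linf_pi 0)) -Linf_piD addr0 subrr.
by apply/Linf_piP; apply: filterS u0 => x /(_ I).
Qed.

HB.instance Definition _ :=
  Lmodule_isNormed.Build R Linf ler_normD normrZ normr0_eq0.

End Linf.

Coercion Linf_fun : Linf >-> Funclass.

(* The library norms U * V by the maximum; this is U * V with the sum of the
   two norms. *)
Definition sum_prod (R : realType) (U V : normedModType R) : Type :=
  (U * V)%type.

Section sum_prod.
Context (R : realType) (U V : normedModType R).

HB.instance Definition _ :=
  GRing.Lmodule.copy (sum_prod U V) (U * V)%type.

Let norm (w : sum_prod U V) : R := `|w.1| + `|w.2|.

Let ler_normD w z : norm (w + z) <= norm w + norm z.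
Proof. by rewrite /norm addrACA lerD// ler_normD. Qed.

Let normrZ a w : norm (a *: w) = `|a| * norm w.
Proof. by rewrite /norm/= !normrZ mulrDr. Qed.

Let normr0_eq0 w : norm w = 0 -> w = 0.
Proof.
case: w => u v /eqP; rewrite paddr_eq0// !normr_eq0 => /andP[/eqP/= -> /eqP->].
by [].
Qed.

HB.instance Definition _ :=
  Lmodule_isNormed.Build R (sum_prod U V) ler_normD normrZ normr0_eq0.

End sum_prod.

(* Lebesgue measure on [a, b], as a finite Borel measure on R. *)
Section leb_itv.
Context (R : realType) (a b : R).

Definition leb_itv : set (measurableTypeR R) -> \bar R :=
  mrestr (@lebesgue_measure R) (measurable_itv `[a, b]%R).

HB.instance Definition _ := Measure.on leb_itv.

Let leb_itv_fin : fin_num_fun leb_itv.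
Proof.
move=> A mA; rewrite ge0_fin_numE// /leb_itv/= /mrestr.
apply: (@le_lt_trans _ _ (lebesgue_measure `[a, b]%classic)).
  by apply: le_measure; rewrite ?inE//; exact: measurableI.
by rewrite lebesgue_measure_itv/=; case: ifP => //; rewrite ltry.
Qed.

HB.instance Definition _ :=
  Measure_isFinite.Build _ _ _ leb_itv leb_itv_fin.

End leb_itv.

Section Bochner.
Context d (T : measurableType d) (R : realType).
Variables (mu : {finite_measure set T -> \bar R}) (V : normedModType R).
Implicit Types (s f : T -> V).

Definition bochner_simple s : Prop :=
  finite_set (range s) /\ forall v, measurable (s @^-1` [set v]).

Definition bochner_simple_integral s : V :=
  \sum_(v \in range s) fine (mu (s @^-1` [set v])) *: v.

Definition strongly_measurable f : Prop :=
  exists s_ : nat -> T -> V, (forall n, bochner_simple (s_ n)) /\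
    \forall x \ae mu, s_ n x @[n --> \oo] --> f x.

(* f is only equal almost everywhere to a Borel function, but the integral of a
   nonnegative function is a supremum over measurable simple functions below it,
   which is not affected by null sets. *)
Definition is_bochner_integral f (I : V) : Prop :=
  exists s_ : nat -> T -> V,
    [/\ forall n, bochner_simple (s_ n),
        \forall x \ae mu, s_ n x @[n --> \oo] --> f x,
        (\int[mu]_x `|s_ n x - f x|%:E @[n --> \oo] --> 0)%E &
        bochner_simple_integral (s_ n) @[n --> \oo] --> I].

Definition bochner_Linf f : Prop :=
  strongly_measurable f /\ (ess_sup mu (fun x => `|f x|%:E) < +oo)%E.

End Bochner.

Section Sobolev.
Context (R : realType) (V : normedModType R).
Implicit Types (T : R) (u v : R -> V).

Definition test_function T (phi : R -> R) : Prop :=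
  (forall n x, derivable phi^`(n) x 1) /\
  exists a b, [/\ 0 < a, b < T & forall x, ~~ (a <= x <= b) -> phi x = 0].

Definition is_weak_derivative T u v : Prop :=
  forall phi, test_function T phi -> exists I : V,
    is_bochner_integral (leb_itv 0 T) (fun t => derive1 phi t *: u t) I /\
    is_bochner_integral (leb_itv 0 T) (fun t => phi t *: v t) (- I).

(* u is in W^{1,oo}([0, T]; V), with weak derivative v. *)
Definition in_W1inf T u v : Prop :=
  [/\ bochner_Linf (leb_itv 0 T) u, bochner_Linf (leb_itv 0 T) v &
      is_weak_derivative T u v].

(* An element of W^{1,oo}([0, T]; V) is only defined up to a null set of times:
   its value at 0 is that of its continuous representative. *)
Definition initial_value T u (u0 : V) : Prop :=
  exists w : R -> V, [/\ {within `[0, T], continuous w},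
    \forall t \ae leb_itv 0 T, w t = u t & w 0 = u0].

End Sobolev.

Section C1b.
Context (R : realType).

Definition C1b (f : R -> R) : Prop :=
  [/\ forall x, derivable f x 1, continuous f^`(),
      bounded_fun f & bounded_fun f^`()].

Definition C1b2 (f : R * R -> R) : Prop :=
  bounded_fun f /\
  forall e : R * R, e = (1, 0) \/ e = (0, 1) ->
    [/\ forall p, derivable f p e, continuous ('D_e f) & bounded_fun ('D_e f)].

End C1b.

Section unit_measures.
Context (R : realType).

Definition mu1 : {finite_measure set (measurableTypeR R) -> \bar R} :=
  leb_itv 0 1.

Definition mu2 :
    {measure set (measurableTypeR R * measurableTypeR R) -> \bar R} :=
  (mu1 \x mu1)%E.

End unit_measures.

Notation Xtheta R := (Linf (mu1 R)).
Notation Xa R := (Linf (mu2 R)).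
Notation Xspace R := (sum_prod (Xtheta R) (Xa R)).

Section continuum_system.
Context (R : realType).
Context (Gamma : R -> R) (H : R * R -> R).

(* Up to a null set, the values of Fop and Gop do not depend on the
   representatives of omega, theta and a. *)
Definition Fop (omega theta : Xtheta R) (a : Xa R) (x : R) : R :=
  omega x + \int[mu1 R]_y (a (x, y) * Gamma (theta y - theta x)).

Definition Gop (theta : Xtheta R) (a : Xa R) (xy : R * R) : R :=
  - a xy + H (theta xy.1, theta xy.2).

Definition strong_solution (eps : R) (omega : Xtheta R) (w0 : Xspace R) (T : R)
    (w : R -> Xspace R) : Prop :=
  exists w' : R -> Xspace R,
    [/\ in_W1inf T w w', initial_value T w w0 &
        \forall t \ae leb_itv 0 T,
          ((w' t).1 : Xtheta R) = Fop omega (w t).1 (w t).2 %[ae mu1 R] /\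
          (eps *: (w' t).2 : Xa R) = Gop (w t).1 (w t).2 %[ae mu2 R]].

Definition global_strong_solution (eps : R) (omega : Xtheta R) (w0 : Xspace R)
    (w : R -> Xspace R) : Prop :=
  forall T, 0 < T -> strong_solution eps omega w0 T w.

End continuum_system.

(* Main.v *)
Require Import Defs.
From mathcomp Require Import all_boot all_order all_algebra finmap.
From mathcomp Require Import all_classical all_reals all_analysis.
From mathcomp Require Import ess_sup_inf measurable_realfun.
From mathcomp Require Import ring lra.

Set Implicit Arguments.
Unset Strict Implicit.
Unset Printing Implicit Defensive.

Import Order.TTheory GRing.Theory Num.Theory.
Import numFieldNormedType.Exports.

Local Open Scope ring_scope.
Local Open Scope classical_set_scope.

(** The slow variable has a bounded right-hand side as soon as [a] is bounded,
    and [a] relaxes toward a target [H(theta, theta)] that never exceeds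
    [H0 = sup |H|]. Everything follows from these two facts.

    Existence. With [a] replaced by its truncation at a level [A] in the two
    equations, the right-hand side becomes a bounded and globally Lipschitz
    field on [X], and Euler polygons converge to a [C^1] solution on the whole
    half-line ([bounded_lipschitz_ode]). If [A] is larger than [|a_0|] and than
    [H0], the norm of [a] cannot reach [A]: at the first time of contact the
    relaxation would point strictly inward ([truncated_barrier]). So the
    truncation is never felt, and the solution is one of the system
    ([global_solution_exists]); its classical derivative is a weak one by
    integration by parts ([in_W1inf_C1]).

    From weak to classical. For a strong solution, the weak derivative agrees at
    almost every time with the field along the continuous representative, which
    is a continuous function of time. By the lemma of du Bois-Reymond the
    continuous representative then has the field as its left derivative.
    Bochner integrals are reduced to real ones by linear functionals of norm at
    most one: on [L^oo], the averages over sets of positive measure are enough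
    of them to recover the norm, and they stand for the functionals of the
    Hahn-Banach theorem ([weak_derivative_strong], [strong_solution_classical]).

    Stability, with a constant that does not depend on [eps]. Let [D] exceed the
    distance [D0] between the data of two solutions. The differences of the
    [theta]'s and of the [a]'s start below the barriers [D * exp (lambda * t)]
    and [(2 * LH + 1) * D * exp (lambda * t)], where [LH] is a Lipschitz
    constant of [H]. At a first contact with the first barrier, the slow
    equation moves the difference more slowly than the barrier rises, if
    [lambda] is large, and [eps] does not occur in that equation. At a first
    contact with the second one, the targets differ by at most
    [2 * LH * D * exp (lambda * t)], which is less than the barrier, so that
    the relaxation points inward, whatever its rate [1 / eps]. Hence no contact
    occurs, and [D] may tend to [D0] ([classical_stability]). Uniqueness is the
    case of equal data.

    All comparisons are made through left derivatives at a time of first contact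
    ([first_contact], [no_contact]), in place of integral inequalities. *)

(** * Left derivatives and barriers *)

Section barrier.
Context (R : realType).
Implicit Types (t s h : R).

(** The infimum of the times at which [g] is nonnegative would be a first zero. *)
Lemma first_contact (T : R) (g : R -> R) :
  continuous g -> g 0 < 0 ->
  (forall t, 0 < t <= T -> (forall s, 0 <= s < t -> g s < 0) -> g t <> 0) ->
  forall t, 0 <= t <= T -> g t < 0.
Proof.
move=> gc g0 contact t1 /andP[t1_ge0 t1T]; rewrite ltNge; apply/negP => gt1.
pose E := [set t | 0 <= t /\ 0 <= g t].
have hiE : has_inf E by split; [exists t1 | exists 0 => x []].
have lt_inf s : 0 <= s < inf E -> g s < 0.
  move=> /andP[s0 sE]; rewrite ltNge; apply/negP => gs.
  by move: sE; rewrite ltNge; apply/negP/negPn; apply: ge_inf => //; case: hiE.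
have inf_ge0 : 0 <= inf E by apply: lb_le_inf; [case: hiE | move=> x []].
have inf_le : inf E <= t1 by apply: ge_inf => //; case: hiE.
have g_inf_ge0 : 0 <= g (inf E).
  rewrite leNgt; apply/negP => gE.
  have /nbhs_ballP[e /= e0 Be] : \forall x \near inf E, g x < 0.
    exact: (gc (inf E)) (lt_nbhsl _).
  have [x [x0 gx] xE] := inf_adherent e0 hiE.
  have : g x < 0.
    apply: Be; rewrite /ball/= ltr0_norm ?opprB; last first.
      rewrite subr_lt0 lt_neqAle ge_inf ?andbT//; last by case: hiE.
      by apply/eqP => xE'; move: gE; rewrite xE' ltNge gx.
    by rewrite ltrBlDr addrC.
  by rewrite ltNge gx.
have inf_gt0 : 0 < inf E.
  rewrite lt_neqAle inf_ge0 andbT; apply/eqP => E0.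
  by move: g_inf_ge0; rewrite -E0 leNgt g0.
apply: (contact (inf E)) => //; first by rewrite inf_gt0 (le_trans inf_le).
apply/eqP; rewrite eq_le g_inf_ge0 andbT.
rewrite leNgt; apply/negP => gE.
have /nbhs_ballP[e /= e0 Be] : \forall x \near inf E, 0 < g x.
  exact: (gc (inf E)) (lt_nbhsr _).
pose s := Num.max 0 (inf E - e / 2).
have sE : s < inf E by rewrite /s gt_max inf_gt0 /= ltrBlDr ltrDl divr_gt0.
have : g s < 0 by apply: lt_inf; rewrite sE andbT /s le_max lexx.
rewrite ltNge => /negP; apply; apply/ltW/Be.
rewrite /ball/= ger0_norm ?subr_ge0 ?(ltW sE)//.
rewrite ltrBlDr -ltrBlDl /s lt_max; apply/orP; right.
by rewrite ltrD2l ltrN2; lra.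
Qed.

(** At a first contact with a barrier only the earlier times are controlled,
    and a polygon has a left derivative at its corners too: derivatives from
    the left are what both uses have in common. *)
Definition left_diff (V : normedModType R) (u : R -> V) t (d : V) :=
  forall e, 0 < e ->
    \forall h \near 0^'+, `|u t - u (t - h) - h *: d| <= e * h.

(** To first order, [u (t - h)] is [u t - h *: d], whose norm is at least [b t
    - h * k], whereas the barrier was at [b t - h * b']. If [k < b'], the norm
    of [u] was above the barrier just before touching it. *)
Lemma no_contact (V : normedModType R) (u : R -> V) d (b : R -> R) (b' k t : R) :
  left_diff u t d -> left_diff (b : R -> R^o) t b' ->
  `|u t| = b t ->
  (\forall h \near 0^'+, b t - h * k <= `|u t - h *: d|) ->
  k < b' ->
  ~ (\forall h \near 0^'+, `|u (t - h)| <= b (t - h)).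
Proof.
move=> ud bd utbt lower kb' below.
(* The two errors, e * h each, must not fill the gap h * (b' - k). *)
pose e := (b' - k) / 4.
have e0 : 0 < e by rewrite divr_gt0 // subr_gt0.
have := ud _ e0; have := bd _ e0 => bde ude.
near (0 : R)^'+ => h.
have h0 : 0 < h by near: h; exact: nbhs_right_gt.
have H1 : b t - h * k <= `|u t - h *: d| by near: h.
have H2 : `|u (t - h)| <= b (t - h) by near: h.
have H3 : `|u t - u (t - h) - h *: d| <= e * h by near: h.
have H4 : `|b t - b (t - h) - h * b'| <= e * h by near: h.
have H5 : `|u t - h *: d| <= `|u (t - h)| + e * h.
  rewrite -[u t - _](subrK (u (t - h))) addrC.
  rewrite (le_trans (ler_normD _ _))// lerD2l.
  by rewrite addrAC.
move: H4; rewrite ler_norml => /andP[H4 _].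
have E : h * b' - h * k = 4 * (e * h) by rewrite /e; field.
have : 0 < e * h by rewrite mulr_gt0.
have H6 : b t - h * k <= b (t - h) + e * h.
  by rewrite (le_trans H1)// (le_trans H5)// lerD2r.
lra.
Unshelve. all: by end_near. Qed.

End barrier.
Section left_calculus.
Context (R : realType) (V : normedModType R).
Implicit Types (t s h T : R) (u : R -> V) (d : V).

Lemma near0_right (P : R -> Prop) (e : R) :
  0 < e -> (forall h, 0 < h < e -> P h) -> \forall h \near 0^'+, P h.
Proof.
move=> e0 eP; near=> h; apply: eP; apply/andP; split; near: h.
  exact: nbhs_right_gt.
exact: nbhs_right_lt.
Unshelve. all: by end_near. Qed.

Lemma left_diff_taylor u t d C :
  (forall s, `|u t - u s - (t - s) *: d| <= C * (t - s) ^+ 2) -> left_diff u t d.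
Proof.
move=> H e e0; apply: (@near0_right _ (e / (`|C| + 1))).
  by rewrite divr_gt0// ltr_pwDr.
move=> h /andP[h0 he].
have := H (t - h); rewrite subKr => /le_trans; apply.
rewrite expr2 mulrA ler_wpM2r ?(ltW h0)//.
rewrite (le_trans (ler_wpM2r (ltW h0) (ler_norm C)))//.
move: he; rewrite ltr_pdivlMr ?ltr_pwDr// => /ltW; apply: le_trans.
by rewrite mulrC ler_wpM2l ?(ltW h0)// lerDl.
Qed.

Lemma left_diff_is_derive u t d : is_derive t (1 : R) u d -> left_diff u t d.
Proof.
move=> [du <-] e e0.
have /cvgrPdist_le/(_ e e0) : (h^-1 *: (u (h *: 1 + t) - u t)) @[h --> 0^'] --> 'D_1 u t.
  exact: du.
move=> /nbhs_ballP[r /= r0 Hr]; apply: (@near0_right _ r) => // h /andP[h0 hr].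
have := Hr (- h); rewrite /ball/= sub0r opprK gtr0_norm// => /(_ hr).
rewrite oppr_eq0 gt_eqF// => /(_ isT).
have hN0 : - h != 0 by rewrite oppr_eq0 gt_eqF.
have -> : - h *: (1 : R) + t = t - h by rewrite /GRing.scale/= mulr1 addrC.
move=> E.
have -> : u t - u (t - h) - h *: 'D_1 u t =
    - h *: ('D_1 u t - (- h)^-1 *: (u (t - h) - u t)).
  by rewrite scalerBr scalerA mulfV// scale1r opprB scaleNr addrC.
by rewrite normrZ normrN (gtr0_norm h0) mulrC ler_wpM2r// ltW.
Qed.

Lemma left_diffB u u' t d d' :
  left_diff u t d -> left_diff u' t d' -> left_diff (u \- u') t (d - d').
Proof.
move=> ud ud' e e0; have e20 : 0 < e / 2 by rewrite divr_gt0.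
have := ud _ e20; have := ud' _ e20; apply: filterS2 => h H' H.
have -> : (u \- u') t - (u \- u') (t - h) - h *: (d - d') =
    (u t - u (t - h) - h *: d) - (u' t - u' (t - h) - h *: d').
  rewrite /= scalerBr !opprD !opprK.
  by rewrite -!addrA; congr (_ + _); rewrite addrCA; congr (_ + _);
     rewrite [RHS]addrCA; congr (_ + _); rewrite [RHS]addrCA; congr (_ + _).
rewrite (le_trans (ler_normB _ _))//.
by rewrite [e]splitr mulrDl lerD.
Qed.

Lemma left_diff_affine (v d : V) t : left_diff (fun s => v + s *: d) t d.
Proof.
move=> e e0; near=> h.
rewrite opprD addrACA subrr add0r -scalerBl subKr subrr normr0.
by rewrite mulr_ge0// ltW.
Unshelve. all: by end_near. Qed.

Lemma left_diff_shift u t s d :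
  left_diff u (s + t) d -> left_diff (fun r => u (s + r)) t d.
Proof.
move=> H e /H; apply: filterS => h; by rewrite addrA.
Qed.

Lemma left_diff_near u u' t d r : 0 < r ->
  (forall s, t - r < s <= t -> u s = u' s) -> left_diff u t d -> left_diff u' t d.
Proof.
move=> r0 E ud e /ud H; near=> h.
have h0 : 0 < h by near: h; exact: nbhs_right_gt.
have hr : h < r by near: h; exact: nbhs_right_lt.
rewrite -!E; first by near: h.
  by rewrite ltrD2l ltrN2 hr lerBlDr lerDl ltW.
by rewrite lexx andbT ltrBlDr ltrDl.
Unshelve. all: by end_near. Qed.

End left_calculus.

Section growth.
Context (R : realType) (V : normedModType R).
Implicit Types (t s h T : R) (u : R -> V) (d : V).

Lemma nonneg_of_right (P : R -> Prop) t : 0 < t ->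
  (forall s, 0 <= s < t -> P s) -> \forall h \near 0^'+, P (t - h).
Proof.
move=> t0 H; apply: (@near0_right _ _ t) => // h /andP[h0 ht]; apply: H.
by rewrite subr_ge0 (ltW ht) ltrBlDr ltrDl h0.
Qed.

(** What is left to do at a contact is to bound from below the norm of the
    first-order past value [u t - h *: d]: with [near_lower] in general, and
    with [relaxation_lower] when [d] is a relaxation term. *)
Lemma barrier_norm T u (b b' : R -> R) :
  continuous u -> continuous b -> `|u 0| < b 0 ->
  (forall t, 0 < t <= T -> left_diff (b : R -> R^o) t (b' t)) ->
  (forall t, 0 < t <= T -> `|u t| = b t -> (forall s, 0 <= s < t -> `|u s| < b s) ->
     exists d k, [/\ left_diff u t d,
       \forall h \near 0^'+, b t - h * k <= `|u t - h *: d| & k < b' t]) ->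
  forall t, 0 <= t <= T -> `|u t| < b t.
Proof.
move=> uc bc u0 bd contact t tT; rewrite -subr_lt0.
move: t tT; apply: (@first_contact _ T (fun t => `|u t| - b t)).
- by move=> t; apply: cvgB; [apply: cvg_norm; exact: uc | exact: bc].
- by rewrite subr_lt0.
move=> t tT lt0 /eqP; rewrite subr_eq0 => /eqP utb.
have lt0' s : 0 <= s < t -> `|u s| < b s by move=> /lt0; rewrite subr_lt0.
have [d [k [ud lower kb']]] := contact _ tT utb lt0'.
apply: (no_contact ud (bd _ tT) utb lower kb').
case/andP: tT => t0 _.
by apply: (@nonneg_of_right (fun s => `|u s| <= b s)) => // s /lt0'/ltW.
Qed.

Lemma near_lower (v d : V) (b k : R) : `|v| = b -> `|d| <= k ->
  \forall h \near 0^'+, b - h * k <= `|v - h *: d|.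
Proof.
move=> <- dk; near=> h.
have h0 : 0 < h by near: h; exact: nbhs_right_gt.
rewrite lerBlDr -[X in `|X| <= _](subrK (h *: d)) (le_trans (ler_normD _ _))//.
by rewrite lerD2l normrZ gtr0_norm// ler_wpM2l// ltW.
Unshelve. all: by end_near. Qed.

(** The barrier is a line of slope slightly more than [K] that starts slightly
    above [0]. *)
Lemma left_mean_value s T K u (d : R -> V) :
  continuous u -> (forall t, s < t -> left_diff u t (d t)) ->
  (forall t, s < t <= T -> `|d t| <= K) ->
  forall t, s <= t <= T -> `|u t - u s| <= K * (t - s).
Proof.
move=> uc ud dK t /andP[st tT]; apply/ler_addgt0Pr => e e0.
pose f r := u (s + r) - u s.
(* The excess c + c * (t - s) of the barrier over K * (t - s) is e. *)
pose c := e / (t - s + 1).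
have c0 : 0 < c by rewrite divr_gt0// ltr_wpDl// subr_ge0.
have H : `|f (t - s)| < c + (t - s) * (K + c).
  apply: (@barrier_norm (T - s) f (fun r => c + r * (K + c)) (fun=> K + c)).
  - move=> r; apply: (@cvgB _ _ _ _ _ (fun r => u (s + r)) (cst (u s)));
      last exact: cvg_cst.
    apply: (@continuous_comp _ _ _ (fun r => s + r) u); [|exact: uc].
    by apply: cvgD; [exact: cvg_cst | exact: cvg_id].
  - move=> r; apply: cvgD; first exact: cvg_cst.
    by apply: cvgMl; exact: cvg_id.
  - by rewrite /f addr0 subrr normr0 mul0r addr0.
  - by move=> r _; exact: (@left_diff_affine _ R^o).
  - move=> r /andP[r0 rT] fr _; exists (d (s + r)), K.
    have sr : s < s + r by rewrite ltrDl.
    split; last by rewrite ltrDl.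
    + have := left_diffB (left_diff_shift (ud _ sr)) (left_diff_affine (u s) 0 r).
      rewrite subr0; apply: left_diff_near ltr01 _ => x _ /=.
      by rewrite scaler0 addr0.
    + apply: near_lower => //; apply: dK; rewrite sr/=.
      by rewrite -lerBrDl.
  - by rewrite subr_ge0 st lerD2r.
move: H; rewrite /f addrCA subrr addr0 => /ltW/le_trans; apply.
have -> : c + (t - s) * (K + c) = K * (t - s) + c * (t - s + 1) by ring.
rewrite lerD2l /c mulfVK//; apply: lt0r_neq0.
by rewrite ltr_wpDl// subr_ge0.
Qed.

Lemma continuous_expR_scale (c l : R) : continuous (fun t => c * expR (l * t)).
Proof.
move=> t; apply: cvgMr; apply: (@continuous_comp _ _ _ (fun t => l * t) expR).
  by apply: cvgMr; exact: cvg_id.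
exact: continuous_expR.
Qed.

Lemma left_diff_expR (c l t : R) :
  left_diff (fun t => c * expR (l * t) : R^o) t (l * (c * expR (l * t))).
Proof.
apply: left_diff_is_derive.
have H : is_derive t (1 : R) (fun t => expR (l * t)) (l * expR (l * t)).
  have K : is_derive t (1 : R) (fun t => l * t) l.
    by apply: is_derive_eq; rewrite /GRing.scale/= mulr1.
  by have := is_derive1_comp (is_derive_expR (l * t)) K; rewrite /GRing.scale/= mulrC.
by apply: is_derive_eq; rewrite /GRing.scale/=; ring.
Qed.

(** The barrier is [c * exp ((L + 1) * t)] with [c] slightly more than [delta]:
    at a contact [L * |u| + delta] is less than [(L + 1) * |u|], the slope of
    the barrier. *)
Lemma left_gronwall T L delta u (d : R -> V) :
  continuous u -> 0 <= L -> 0 <= delta -> u 0 = 0 ->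
  (forall t, 0 < t <= T -> left_diff u t (d t)) ->
  (forall t, 0 < t <= T -> `|d t| <= L * `|u t| + delta) ->
  forall t, 0 <= t <= T -> `|u t| <= delta * expR ((L + 1) * t).
Proof.
move=> uc L0 delta0 u0 ud dL t tT; apply/ler_addgt0Pr => e e0.
pose c := delta + e / expR ((L + 1) * t).
have dc : delta < c by rewrite ltrDl divr_gt0// expR_gt0.
have c0 : 0 < c by exact: le_lt_trans dc.
suff : `|u t| < c * expR ((L + 1) * t).
  by rewrite /c mulrDl divfK ?gt_eqF ?expR_gt0// => /ltW.
apply: (@barrier_norm T u (fun t => c * expR ((L + 1) * t))
  (fun t => (L + 1) * (c * expR ((L + 1) * t)))) => //.
- exact: continuous_expR_scale.
- by rewrite u0 normr0 mulr_gt0// expR_gt0.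
- by move=> s _; exact: left_diff_expR.
move=> s sT us _; exists (d s), (L * `|u s| + delta); split.
- exact: ud.
- by apply: near_lower us _; exact: dL.
rewrite us [ltRHS]mulrDl mul1r ltrD2l (lt_le_trans dc)// ler_peMr ?(ltW c0)//.
rewrite -expR0 ler_expR mulr_ge0 ?addr_ge0//.
by case/andP: sT => /ltW.
Qed.

End growth.

(** * Bounded Lipschitz differential equations *)

(** Completeness is taken as a property, to be proved for each factor of a
    product separately. *)
Definition cauchy_complete (R : realType) (V : normedModType R) : Prop :=
  forall u : nat -> V,
    (forall e, 0 < e -> exists N, forall m n, (N <= m)%N -> (N <= n)%N ->
       `|u m - u n| <= e) ->
    exists l : V, u n @[n --> \oo] --> l.

Lemma max0_lip (R : realDomainType) (r s : R) :
  `|Num.max 0 r - Num.max 0 s| <= `|r - s|.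
Proof.
have h1 : r - s <= `|r - s| := ler_norm _.
have h2 : s - r <= `|r - s| by rewrite distrC ler_norm.
have h3 : 0 <= `|r - s| by [].
move: `|r - s| h1 h2 h3 => d h1 h2 h3; rewrite ler_norml.
by case: (leP 0 r); case: (leP 0 s) => *; apply/andP; split; lra.
Qed.

Section euler.
Context (R : realType) (V : normedModType R).
Variables (F : V -> V) (L M : R) (u0 : V).
Hypothesis F_lip : forall u v, `|F u - F v| <= L * `|u - v|.
Hypothesis F_bnd : forall u, `|F u| <= M.
Implicit Types (t s : R) (n k : nat).

Hypothesis L_ge0 : 0 <= L.

Let M_ge0 : 0 <= M. Proof. exact: le_trans (normr_ge0 _) (F_bnd 0). Qed.

Definition mesh n : R := n.+1%:R^-1.

Let mesh_gt0 n : 0 < mesh n. Proof. by rewrite invr_gt0. Qed.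

Definition euler_node n k : V := iter k (fun v => v + mesh n *: F v) u0.

(** The cells are open on the left, so that at every time, corners included,
    the left derivative of the polygon is the slope on the cell of that time.
    Nonpositive times are put in cell [0], which prolongs the polygon affinely
    into the past. *)
Definition cell n t : nat :=
  if Num.ceil (t * n.+1%:R) is Posz m then m.-1 else 0%N.

Definition euler n t : V :=
  euler_node n (cell n t) + (t - (cell n t)%:R * mesh n) *: F (euler_node n (cell n t)).

Lemma cell_le0 n t : t <= 0 -> cell n t = 0%N.
Proof.
move=> t0; rewrite /cell; have : Num.ceil (t * n.+1%:R) <= 0.
  by rewrite ceil_le0 mulr_le0_ge0.
by case: Num.ceil => // -[].
Qed.

Lemma cell_unique n k t : k%:R * mesh n < t <= k.+1%:R * mesh n -> cell n t = k.
Proof.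
move=> /andP[kt tk]; rewrite /cell; have -> : Num.ceil (t * n.+1%:R) = k.+1%:Z.
  apply: ceil_def; rewrite intS addrC addKr.
  by rewrite -ltr_pdivrMr// -ler_pdivlMr// kt/= -intS.
by [].
Qed.

Lemma cell_gt0 n t : 0 < t ->
  (cell n t)%:R * mesh n < t <= (cell n t).+1%:R * mesh n.
Proof.
move=> t0; have := ceil_itv (t * n.+1%:R); rewrite /cell.
have : 0 < Num.ceil (t * n.+1%:R) by rewrite ceil_gt0 mulr_gt0.
case: Num.ceil => // -[//|m] _.
rewrite intS addrC addKr -ltr_pdivrMr// -ler_pdivlMr//.
Qed.

Lemma euler_segment n k t : k%:R * mesh n <= t <= k.+1%:R * mesh n ->
  euler n t = euler_node n k + (t - k%:R * mesh n) *: F (euler_node n k).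
Proof.
move=> /andP[]; rewrite le_eqVlt => /orP[/eqP <- _|kt tk]; last first.
  by rewrite /euler (@cell_unique n k)// kt tk.
rewrite subrr scale0r addr0; case: k => [|k].
  by rewrite mul0r /euler cell_le0// mul0r subrr scale0r addr0.
rewrite /euler (@cell_unique n k); last first.
  by rewrite lexx andbT ltr_pM2r// ltr_nat.
by rewrite -mulrBl -natrB// subSnn mul1r.
Qed.

Lemma euler_le0 n t : t <= 0 -> euler n t = u0 + t *: F u0.
Proof. by move=> t0; rewrite /euler cell_le0// mul0r subr0. Qed.

Lemma euler0 n : euler n 0 = u0.
Proof. by rewrite euler_le0// scale0r addr0. Qed.

Lemma euler_lip n s t : s <= t -> `|euler n t - euler n s| <= M * (t - s).
Proof.
suff H k : forall s t, s <= t <= k%:R * mesh n ->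
    `|euler n t - euler n s| <= M * (t - s).
  move=> st; apply: (H (Num.truncn `|t * n.+1%:R|).+1); rewrite st/=.
  rewrite ler_pdivlMr// (le_trans (ler_norm _))//.
  by apply/ltW; apply: truncnS_gt.
have affine v w (a b : R) : a <= b -> `|(v + b *: F w) - (v + a *: F w)| <= M * (b - a).
  move=> ab; rewrite opprD addrACA subrr add0r -scalerBl normrZ mulrC.
  by rewrite ger0_norm ?subr_ge0// ler_wpM2r ?subr_ge0.
elim: k => [|k IH] {}s {}t /andP[st].
  rewrite mul0r => t0; rewrite !euler_le0//; last exact: le_trans st t0.
  exact: affine.
move=> tk; have [tk'|kt] := leP t (k%:R * mesh n); first by apply: IH; rewrite st.
have seg r : k%:R * mesh n <= r -> r <= t ->
    `|euler n t - euler n r| <= M * (t - r).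
  move=> kr rt; rewrite !(@euler_segment n k).
  - by rewrite (le_trans (affine _ _ _ _ _))// ?lerD2r// opprB addrA subrK.
  - by rewrite kr (le_trans rt).
  - by rewrite (ltW kt).
have [ks|sk] := leP (k%:R * mesh n) s; first exact: seg.
rewrite -(subrK (euler n (k%:R * mesh n)) (euler n t)) -addrA.
rewrite (le_trans (ler_normD _ _))//.
have -> : M * (t - s) = M * (t - k%:R * mesh n) + M * (k%:R * mesh n - s) by ring.
by rewrite lerD// ?seg ?IH ?(ltW sk)//= ltW.
Qed.

Lemma euler_lip_norm n s t : `|euler n t - euler n s| <= M * `|t - s|.
Proof.
have [st|/ltW ts] := leP s t.
  by rewrite (ger0_norm (_ : 0 <= t - s)) ?subr_ge0// euler_lip.
by rewrite distrC (distrC t) (ger0_norm (_ : 0 <= s - t)) ?subr_ge0// euler_lip.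
Qed.

Lemma euler_segment_start n k : euler n (k%:R * mesh n) = euler_node n k.
Proof.
rewrite (@euler_segment n k) ?subrr ?scale0r ?addr0// lexx/=.
by rewrite ler_pM2r// ler_nat.
Qed.

Lemma euler_continuous n : continuous (euler n).
Proof.
move=> t; apply/cvgrPdist_le => e e0.
have : 0 < e / (M + 1) by rewrite divr_gt0// ltr_wpDl.
move=> /(nbhsx_ballx t); apply: filterS => s; rewrite /ball/= => ts.
rewrite (le_trans (euler_lip_norm _ _ _))//.
rewrite (@le_trans _ _ ((M + 1) * `|t - s|))// ?ler_wpM2r ?lerDl//.
by rewrite mulrC -ler_pdivlMr ?ltr_wpDl// ltW.
Qed.

Let slope n t : V := F (euler_node n (cell n t)).

Lemma euler_left_diff n t : left_diff (euler n) t (slope n t).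
Proof.
pose a := euler_node n (cell n t); pose c : R := (cell n t)%:R * mesh n.
have ad : left_diff (fun s => (a - c *: F a) + s *: F a) t (F a).
  exact: left_diff_affine.
have E s : a + (s - c) *: F a = (a - c *: F a) + s *: F a.
  by rewrite scalerBl addrA addrAC.
have [t0|t0] := leP t 0.
  apply: left_diff_near ltr01 _ ad => s /andP[_ st].
  rewrite -E euler_le0 ?(le_trans st)// /a /c (cell_le0 n t0) mul0r subr0.
  by [].
have /andP[ct tc] := cell_gt0 n t0.
have ct0 : 0 < t - c by rewrite subr_gt0.
apply: left_diff_near ct0 _ ad => s; rewrite subKr => /andP[cs st].
by rewrite -E (@euler_segment n (cell n t))// (ltW cs) (le_trans st).
Qed.

(** The left derivative of the polygon at a time [t >= 0] is [F] at a node this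
    close to the polygon: the polygon solves the equation up to an error [L * M
    * mesh n]. The maximum with [0] accounts for the slope [F u0] at negative
    times. *)
Lemma euler_slope_node n t :
  `|euler_node n (cell n t) - euler n (Num.max 0 t)| <= M * mesh n.
Proof.
have [t0|t0] := leP t 0.
  by rewrite cell_le0// euler0 subrr normr0 mulr_ge0// ltW.
have /andP[ct tc] := cell_gt0 n t0.
rewrite -(@euler_segment_start n (cell n t)).
rewrite (le_trans (euler_lip_norm _ _ _))// ler_wpM2l//.
rewrite ltr0_norm ?subr_lt0// opprB lerBlDr (le_trans tc)//.
by rewrite -natr1 mulrDl mul1r addrC.
Qed.

(** Two polygons solve the equation up to small errors; [left_gronwall]
    compares them. *)
Lemma euler_dist m n t T : 0 <= t <= T ->
  `|euler m t - euler n t| <=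
    L * (M * mesh m + M * mesh n) * expR ((L + 1) * T).
Proof.
move=> /andP[t0 tT].
apply: (@le_trans _ _ (L * (M * mesh m + M * mesh n) * expR ((L + 1) * t))).
  apply: (@left_gronwall _ _ T L _ (euler m \- euler n)
    (fun t => slope m t - slope n t)) => //.
  - move=> r; apply: cvgB; exact: euler_continuous.
  - by rewrite mulr_ge0// addr_ge0// mulr_ge0// ltW.
  - by rewrite /= !euler0 subrr.
  - by move=> r _; apply: left_diffB; exact: euler_left_diff.
  - move=> r /andP[r0 _]; rewrite (le_trans (F_lip _ _))// -mulrDr ler_wpM2l//.
    have := euler_slope_node m r; have := euler_slope_node n r.
    rewrite (max_idPr (ltW r0)).
    set a := euler_node m _; set b := euler_node n _ => Hb Ha.
    have -> : a - b = (euler m r - euler n r) + (a - euler m r) - (b - euler n r).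
      by rewrite opprB (addrC (euler m r - _)) !subrKA.
    rewrite (le_trans (ler_normB _ _))// [leRHS]addrA lerD//.
    by rewrite (le_trans (ler_normD _ _))// lerD.
  - by rewrite t0.
rewrite ler_wpM2l ?ler_expR ?ler_wpM2l ?addr_ge0//.
by rewrite mulr_ge0// addr_ge0// mulr_ge0// ltW.
Qed.

Hypothesis V_complete : cauchy_complete V.

Lemma mesh_small e : 0 < e -> exists N, forall n, (N <= n)%N -> mesh n <= e.
Proof.
move=> e0; exists (Num.truncn e^-1) => n Nn.
rewrite /mesh -[leRHS]invrK lef_pV2 ?posrE ?invr_gt0//.
by apply/ltW/(lt_le_trans (truncnS_gt _)); rewrite ler_nat.
Qed.

Lemma euler_cauchy t e : 0 < e -> exists N, forall m n, (N <= m)%N -> (N <= n)%N ->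
  `|euler m t - euler n t| <= e.
Proof.
move=> e0; have [t0|/ltW t0] := leP t 0.
  by exists 0%N => m n _ _; rewrite !euler_le0// subrr normr0 ltW.
pose K := (L + 1) * (M + 1) * expR ((L + 1) * t).
have K0 : 0 < K by rewrite !mulr_gt0 ?expR_gt0// ltr_wpDl.
have [N HN] := mesh_small (divr_gt0 e0 (mulr_gt0 (ltr0n R 2) K0)).
exists N => m n /HN Hm /HN Hn.
have tt : 0 <= t <= t by rewrite t0 lexx.
rewrite (le_trans (euler_dist m n tt))//.
have -> : e = (L + 1) * ((M + 1) * (e / (2 * K)) + (M + 1) * (e / (2 * K)))
    * expR ((L + 1) * t).
  rewrite -/K; rewrite -mulrDr mulrA -mulrAC -/K -[_ + _]mulr2n -mulr_natl.
  by field; rewrite gt_eqF.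
have h a : 0 <= mesh a by exact: ltW.
have e2 : 0 <= e / (2 * K) by rewrite divr_ge0// ltW// mulr_gt0.
rewrite ler_wpM2r ?expR_ge0// ler_pM ?lerDl//; first by rewrite addr_ge0// mulr_ge0.
by rewrite lerD// ler_pM// lerDl.
Qed.

(** The polygons converge by [euler_dist]. The equation is obtained for their
    limit as a first-order expansion with a quadratic remainder, which gives at
    once that [u] is differentiable and what its derivative is. The equation is
    [u' = F (u 0)] at negative times, so that [u] is defined on the line and
    differentiable at [0]. *)
Theorem bounded_lipschitz_ode : exists u : R -> V, u 0 = u0 /\
  forall s t, `|u t - u s - (t - s) *: F (u (Num.max 0 s))| <= L * M * (t - s) ^+ 2.
Proof.
have /choice[u uE] t : exists l : V, euler n t @[n --> \oo] --> l.
  exact: V_complete (@euler_cauchy t).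
exists u; split.
  apply: (@cvg_unique _ _ _ _ _ _ (uE 0)) => //.
  have -> : euler^~ 0 = cst u0 by apply/funext => n; rewrite euler0.
  exact: cvg_cst.
move=> s t; pose c := F (u (Num.max 0 s)).
pose kappa n := `|euler n (Num.max 0 s) - u (Num.max 0 s)|.
(* The mean value estimate for the polygon minus its tangent at s; kappa n
   and mesh n tend to 0. *)
have approx n : `|euler n t - euler n s - (t - s) *: c| <=
    L * (M * mesh n + M * `|t - s| + kappa n) * `|t - s|.
  pose f r := euler n r - (0 + r *: c).
  have -> : euler n t - euler n s - (t - s) *: c = f t - f s.
    rewrite /f !add0r scalerBl !opprB.
    by rewrite (addrC (s *: c) (- euler n s)) [RHS]addrACA (addrC (- (t *: c))).
  have fc : continuous f.
    move=> r; apply: cvgB; first exact: euler_continuous.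
    by apply: cvgD; [exact: cvg_cst | apply: cvgZl; exact: cvg_id].
  have fd a r : a < r -> left_diff f r (slope n r - c).
    move=> _; have := left_diffB (@euler_left_diff n r) (left_diff_affine 0 c r).
    exact.
  have bound r : `|r - s| <= `|t - s| ->
      `|slope n r - c| <= L * (M * mesh n + M * `|t - s| + kappa n).
    move=> rs; rewrite (le_trans (F_lip _ _))// ler_wpM2l//.
    rewrite -(subrKA (euler n (Num.max 0 r))).
    rewrite -[X in `|_ + X|](subrKA (euler n (Num.max 0 s))).
    rewrite (le_trans (ler_normD _ _))// -[leRHS]addrA lerD ?euler_slope_node//.
    rewrite (le_trans (ler_normD _ _))// lerD//.
    rewrite (le_trans (euler_lip_norm _ _ _))// ler_wpM2l//.
    exact: le_trans (max0_lip _ _) rs.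
  have [st|/ltW ts] := leP s t.
    rewrite (ger0_norm (_ : 0 <= t - s)) ?subr_ge0//.
    rewrite (ger0_norm (_ : 0 <= t - s)) ?subr_ge0// in bound.
    apply: (left_mean_value fc (@fd s) (T := t)); last by rewrite st lexx.
    move=> r /andP[sr rt]; apply: bound.
    by rewrite ger0_norm ?subr_ge0 ?(ltW sr)// lerD2r.
  rewrite distrC; rewrite (distrC t) (ger0_norm (_ : 0 <= s - t)) ?subr_ge0//.
  rewrite (distrC t) (ger0_norm (_ : 0 <= s - t)) ?subr_ge0// in bound.
  apply: (left_mean_value fc (@fd t) (T := s)); last by rewrite ts lexx.
  move=> r /andP[tr rs]; apply: bound.
  by rewrite distrC ger0_norm ?subr_ge0// lerD2l lerN2 ltW.
have lhs : `|euler n t - euler n s - (t - s) *: c| @[n --> \oo] -->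
    `|u t - u s - (t - s) *: c|.
  by apply: cvg_norm; apply: cvgB; [apply: cvgB; exact: uE | exact: cvg_cst].
have rhs : L * (M * mesh n + M * `|t - s| + kappa n) * `|t - s| @[n --> \oo] -->
    L * (M * 0 + M * `|t - s| + 0) * `|t - s|.
  apply: cvgMl; apply: cvgMr; apply: cvgD.
    by apply: cvgD; [apply: cvgMr; exact: cvg_harmonic | exact: cvg_cst].
  rewrite -(normr0 V) -(subrr (u (Num.max 0 s))).
  by apply: cvg_norm; apply: cvgB; [exact: uE | exact: cvg_cst].
have := ler_cvg_to lhs rhs (nearW _ approx).
rewrite -[(t - s) ^+ 2]real_normK ?num_real//.
have -> : L * (M * 0 + M * `|t - s| + 0) * `|t - s| = L * M * `|t - s| ^+ 2 by ring.
by apply; exact: _.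
Qed.

End euler.

(** * The spaces of essentially bounded functions *)

Section Linf_theory.
Context d (T : measurableType d) (R : realType) (mu : {measure set T -> \bar R}).
Implicit Types u v : Linf mu.

Local Notation Lf := (LfunType mu (leey 1 : (1 <= +oo :> \bar R)%E)).
Local Notation pi f := (\pi_(Linf mu)%qT (f : Lf)).

Lemma Linf_piP (f g : Lf) : pi f = pi g -> \forall x \ae mu, f x = g x.
Proof.
move/eqP; rewrite -Quotient.idealrBE => /asboolP; apply: filterS => x fgx.
by apply/eqP; rewrite -subr_eq0; exact/eqP.
Qed.

Lemma Linf_fun_pi (f : Lf) : \forall x \ae mu, (pi f : Linf mu) x = f x.
Proof. by apply: Linf_piP; rewrite reprK. Qed.

Lemma Linf_ae_eq u v : (\forall x \ae mu, u x = v x) -> u = v.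
Proof.
move=> uv; rewrite -[u]reprK -[v]reprK; apply/eqP.
rewrite -Quotient.idealrBE; apply/asboolP; apply: filterS uv => x uvx.
by rewrite -[LHS]/(u x - v x) uvx subrr.
Qed.

Lemma Linf_aeD u v : \forall x \ae mu, (u + v : Linf mu) x = u x + v x.
Proof.
have -> : u + v = pi (repr u + repr v).
  by rewrite [RHS]Quotient.pi_add !reprK.
exact: Linf_fun_pi.
Qed.

Lemma Linf_aeZ (c : R) u : \forall x \ae mu, (c *: u : Linf mu) x = c * u x.
Proof. exact: Linf_fun_pi. Qed.

Lemma Linf_aeN u : \forall x \ae mu, (- u : Linf mu) x = - u x.
Proof. by rewrite -scaleN1r; apply: filterS (Linf_aeZ (-1) u) => x ->; rewrite mulN1r. Qed.

Lemma Linf_aeB u v : \forall x \ae mu, (u - v : Linf mu) x = u x - v x.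
Proof. by apply: filterS2 (Linf_aeD u (- v)) (Linf_aeN v) => x -> ->. Qed.

Lemma Linf_measurable u : measurable_fun [set: T] (u : T -> R).
Proof. exact: measurable_funPT. Qed.

(** Over a null space the essential supremum is [-oo], and not the norm. *)
Lemma Linf_normE u : (0 < mu [set: T])%E ->
  (`|u|%:E = ess_sup mu (fun x => `|u x|%:E))%E.
Proof.
move=> mu0; rewrite /Num.norm/= fineK; last first.
  by rewrite ge0_fin_numE ?Lnorm_ge0//; exact: Lfunction_finite.
by rewrite unlock mu0.
Qed.

Lemma Linf_ae_le u : \forall x \ae mu, `|u x| <= `|u|.
Proof.
have [mu0|mu0] := ltP 0%E (mu [set: T]); last first.
  by exists setT; split => //; apply/eqP; rewrite eq_le mu0 measure_ge0.
have := ess_sup_ge mu (fun x => `|u x|%:E); by rewrite -Linf_normE.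
Qed.

Lemma Linf_norm_le u (C : R) : 0 <= C -> (\forall x \ae mu, `|u x| <= C) -> `|u| <= C.
Proof.
move=> C0 uC; have [mu0|mu0] := ltP 0%E (mu [set: T]).
  rewrite -lee_fin Linf_normE//; apply/ess_supP; apply: filterS uC => x.
  by rewrite lee_fin.
suff -> : u = 0 by rewrite normr0.
apply: Linf_ae_eq; exists setT; split => //.
by apply/eqP; rewrite eq_le mu0 measure_ge0.
Qed.

Lemma Linf_ae_lt u (C : R) : 0 <= C -> C < `|u| ->
  ~ (\forall x \ae mu, `|u x| <= C).
Proof. by move=> C0 Cu /(Linf_norm_le C0); rewrite leNgt Cu. Qed.

(** The operators of the system become maps into [L^oo] through this statement. *)
Lemma Linf_build (f : T -> R) (C : R) : measurable_fun [set: T] f ->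
  (\forall x \ae mu, `|f x| <= C) -> exists u : Linf mu, \forall x \ae mu, u x = f x.
Proof.
move=> mf fC.
have fm : f \in @mfun _ _ T R by rewrite inE.
have ff : f \in Lfun mu +oo%E.
  apply/andP; split; first by rewrite inE.
  rewrite inE/= /finite_norm unlock; case: ifPn => // _.
  apply: (@le_lt_trans _ _ C%:E); last exact: ltry.
  by apply/ess_supP; apply: filterS fC => x; rewrite /= lee_fin.
pose F : Lf := Lfun_Sub (leey 1 : (1 <= +oo :> \bar R)%E) ff.
by exists (pi F); apply: filterS (Linf_fun_pi F) => x ->.
Qed.

End Linf_theory.

Section finite_integral.
Context d (T : measurableType d) (R : realType) (mu : {measure set T -> \bar R}).
Variables (D : set T) (mD : measurable D) (muD : (mu D < +oo)%E).
Implicit Types (f g : T -> R) (C : R).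

Lemma ae_bounded_integrable f C : measurable_fun D f ->
  (\forall x \ae mu, D x -> `|f x| <= C) -> mu.-integrable D (EFin \o f).
Proof.
move=> mf fC; apply/integrableP; split; first exact/measurable_EFinP.
apply: (@le_lt_trans _ _ (`|C|%:E * mu D)%E).
  apply: integral_le_bound => //; first exact/measurable_EFinP.
  apply: filterS fC => x fx Dx; rewrite /= lee_fin (le_trans (fx Dx))//.
  exact: ler_norm.
by rewrite lte_mul_pinfty.
Qed.

Lemma norm_Rintegral_le f C : measurable_fun D f -> 0 <= C ->
  (\forall x \ae mu, D x -> `|f x| <= C) ->
  `|\int[mu]_(x in D) f x| <= C * fine (mu D).
Proof.
move=> mf C0 fC; have fi := ae_bounded_integrable mf fC.
rewrite (le_trans (le_normr_Rintegral mD fi))//.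
rewrite -lee_fin fineK; last first.
  rewrite ge0_fin_numE; last exact: integral_ge0.
  by have /integrableP[_] := fi.
rewrite EFinM fineK ?ge0_fin_numE//.
apply: (@integral_le_bound _ _ _ mu D (EFin \o f) C%:E) => //; first exact/measurable_EFinP.
Qed.

Lemma ae_eq_Rintegral f g : measurable_fun D f -> measurable_fun D g ->
  (\forall x \ae mu, D x -> f x = g x) ->
  \int[mu]_(x in D) f x = \int[mu]_(x in D) g x.
Proof.
move=> mf mg fg; congr fine; apply: ae_eq_integral => //.
- exact/measurable_EFinP.
- exact/measurable_EFinP.
- by apply: filterS fg => x fgx /fgx /= ->.
Qed.

End finite_integral.

Section Linf_complete.
Context d (T : measurableType d) (R : realType) (mu : {measure set T -> \bar R}).

(** Outside one null set [N], the union of those of all pairs of indices, the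
    representatives form a uniform Cauchy sequence; set to [0] on [N], they
    converge uniformly to a measurable function. *)
Lemma Linf_cauchy_complete : cauchy_complete (Linf mu).
Proof.
move=> u0; pose u n : Linf mu := u0 n; rewrite -[u0]/u => uC.
have /ae_foralln[N [mN muN good]] : forall m, \forall x \ae mu, forall n,
    `|u m x - u n x| <= `|u m - u n|.
  move=> m; apply: ae_foralln => n.
  by apply: filterS2 (Linf_ae_le (u m - u n)) (Linf_aeB (u m) (u n)) => x + <-.
have goodN x : ~ N x -> forall m n, `|u m x - u n x| <= `|u m - u n|.
  by move=> Nx; apply: contrapT => H; apply: Nx; apply: good.
pose g n := (fun x => if x \in N then 0 else u n x).
have mg n : measurable_fun setT (g n).
  apply: measurable_fun_ifT; [|exact: measurable_cst|exact: Linf_measurable].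
  apply: (measurable_fun_bool true); rewrite setTI.
  rewrite [X in measurable X](_ : _ = N)//.
  by apply/seteqP; split=> x /=; [exact: set_mem | exact: mem_set].
have gC m n x : `|g m x - g n x| <= `|u m - u n|.
  rewrite /g; have [Nx|/negP Nx] := boolP (x \in N); first by rewrite subrr normr0.
  by apply: goodN => /mem_set.
have /choice[f fE] x : exists l : R, g n x @[n --> \oo] --> l.
  apply/cvg_ex/cauchy_cvgP/cauchyP => e e0.
  have [N1 HN1] := uC _ (divr_gt0 e0 (ltr0n R 2)).
  exists (g N1 x); exists N1 => // n /= Nn; rewrite /ball/=.
  rewrite (le_lt_trans (gC _ _ _))// (le_lt_trans (HN1 _ _ _ _))//.
  by rewrite ltr_pdivrMr// ltr_pMr// ltr1n.
have mf : measurable_fun setT f by apply: measurable_fun_cvg mg _.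
have gf n e : (forall m, (n <= m)%N -> `|u n - u m| <= e) -> forall x, `|g n x - f x| <= e.
  move=> une x; have : `|g n x - g m x| @[m --> \oo] --> `|g n x - f x|.
    by apply: cvg_norm; apply: cvgB; [exact: cvg_cst | exact: fE].
  move=> H; apply: (ler_cvg_to H (cvg_cst e)).
  near=> m; rewrite (le_trans (gC _ _ _))//; apply: une.
  by near: m; exists n.
have gu n : \forall x \ae mu, g n x = u n x.
  exists N; split=> // x /=; rewrite /g; by case: ifPn => [/set_mem//|_ []].
have [N0 HN0] := uC 1 ltr01.
have [v vf] : exists v : Linf mu, \forall x \ae mu, v x = f x.
  apply: (@Linf_build _ _ _ _ f (1 + `|u N0|)) => //.
  apply: filterS2 (gu N0) (Linf_ae_le (u N0)) => x gx ux.
  rewrite -(subrK (g N0 x) (f x)) (le_trans (ler_normD _ _))// lerD//.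
    by rewrite distrC; apply: gf => m Nm; exact: HN0.
  by rewrite gx.
exists v; apply/cvgrPdist_le => e e0; have [N1 HN1] := uC e e0.
near=> n; have Nn : (N1 <= n)%N by near: n; exists N1.
rewrite distrC; apply: Linf_norm_le; first exact: ltW.
have gfn := gf n e (fun m nm => HN1 n m Nn (leq_trans Nn nm)).
apply: filterS3 (Linf_aeB (u n) v) vf (gu n) => x -> -> <-; exact: gfn.
Unshelve. all: by end_near. Qed.

End Linf_complete.

(** * Norming functionals *)

Definition norming_functional (R : realType) (V : normedModType R) (l : V -> R) :=
  (forall (c : R) v w, l (c *: v + w) = c * l v + l w) /\ (forall v, `|l v| <= `|v|).

(** Enough functionals to recover the norm, so that equalities and estimates
    between vectors can be tested on real numbers. On the spaces at hand they
    are explicit: averages, and sums of averages. *)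
Definition norming (R : realType) (V : normedModType R) : Prop :=
  forall (v : V) c, c < `|v| -> exists2 l : V -> R, norming_functional l & c <= l v.

Section Linf_norming.
Context d (T : measurableType d) (R : realType) (mu : {measure set T -> \bar R}).
Hypothesis mu_fin : (mu [set: T] < +oo)%E.

Let average (A : set T) (v : Linf mu) : R := (fine (mu A))^-1 * \int[mu]_(x in A) v x.

Lemma average_functional (A : set T) : measurable A -> (0 < mu A)%E ->
  norming_functional (average A).
Proof.
move=> mA A0.
have Afin : (mu A < +oo)%E.
  by rewrite (le_lt_trans _ mu_fin)// le_measure ?inE//; exact: subsetT.
have fA0 : 0 < fine (mu A) by rewrite fine_gt0// A0.
have mL (v : Linf mu) : measurable_fun A (v : T -> R).
  by apply: measurable_funTS; exact: Linf_measurable.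
have iL (v : Linf mu) : mu.-integrable A (EFin \o v).
  apply: (ae_bounded_integrable mA Afin (C := `|v|)) => //.
  by apply: filterS (Linf_ae_le v).
have lin (c : R) (v w : Linf mu) : average A (c *: v + w) = c * average A v + average A w.
  rewrite /average mulrCA -mulrDr; congr (_ * _).
  have icv : mu.-integrable A (EFin \o (fun x => c * v x)).
    exact: (integrableZl mA c (iL v)).
  rewrite -RintegralZl// -RintegralD//; apply: ae_eq_Rintegral => //.
    by apply: measurable_funD => //; exact: measurable_funM.
  apply: filterS2 (Linf_aeD (c *: v) w) (Linf_aeZ c v) => x E1 E2 _.
  by rewrite E1 E2.
split=> // v.
rewrite normrM normfV (gtr0_norm fA0) mulrC ler_pdivrMr//.
apply: norm_Rintegral_le => //.
by apply: filterS (Linf_ae_le v).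
Qed.

(** The average is the one over the set where [v] exceeds [c]. *)
Lemma average_ge (v : Linf mu) (c : R) : 0 <= c ->
  ~ (\forall x \ae mu, v x <= c) ->
  exists2 l : Linf mu -> R, norming_functional l & c <= l v.
Proof.
move=> c0 nvc; pose A := [set x | c < v x].
have mA : measurable A.
  have := Linf_measurable v measurableT (measurable_itv (Interval (BRight c) +oo%O)).
  rewrite setTI; congr measurable; apply/seteqP; split=> x /=; rewrite in_itv/= andbT//.
have A0 : (0 < mu A)%E.
  rewrite lt0e measure_ge0 andbT; apply/eqP => muA; apply: nvc.
  by exists A; split => // x /= /negP; rewrite -ltNge.
have Afin : (mu A < +oo)%E.
  by rewrite (le_lt_trans _ mu_fin)// le_measure ?inE//; exact: subsetT.
exists (average A); first exact: average_functional.
rewrite /average mulrC ler_pdivlMr ?fine_gt0 ?A0//.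
rewrite -Rintegral_cst//; apply: le_Rintegral => //.
- apply: (ae_bounded_integrable mA Afin (C := `|c|)) => //.
  exact: nearW.
- apply: (ae_bounded_integrable mA Afin (C := `|v|)).
    by apply: measurable_funTS; exact: Linf_measurable.
  by apply: filterS (Linf_ae_le v).
- by move=> x /ltW.
Qed.

(** If [c < |u|], then [u] or [- u] exceeds [c] on a set of positive measure. *)
Lemma Linf_norming : norming (Linf mu).
Proof.
move=> u0 c cu; pose u : Linf mu := u0; rewrite -[u0]/u in cu *.
have [c0|c0] := ltP c 0.
  exists (fun=> 0); last exact: ltW.
  by split=> [*|v]; rewrite ?mulr0 ?addr0 ?normr0.
have [uc|/(average_ge c0)//] := pselect (\forall x \ae mu, u x <= c).
have [Nuc|/(average_ge c0)[l [lin ll] cl]] :=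
  pselect (\forall x \ae mu, (- u : Linf mu) x <= c).
  exfalso; apply: (Linf_ae_lt c0 cu).
  apply: filterS3 uc Nuc (Linf_aeN u) => x ux + E; rewrite E => Nux.
  by rewrite ler_norml ux lerNl Nux.
exists (fun v => l (- v)) => //; split=> [a v w|v]; last by rewrite -(normrN v).
by rewrite opprD -scalerN lin.
Qed.

End Linf_norming.

Section sum_prod_theory.
Context (R : realType) (U V : normedModType R).

Lemma sum_prod_normE (w : sum_prod U V) : `|w| = `|w.1| + `|w.2|.
Proof. by []. Qed.

Lemma sum_prod_norm1 (w : sum_prod U V) : `|w.1| <= `|w|.
Proof. by rewrite sum_prod_normE lerDl. Qed.

Lemma sum_prod_norm2 (w : sum_prod U V) : `|w.2| <= `|w|.
Proof. by rewrite sum_prod_normE lerDr. Qed.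

Lemma sum_prod_cauchy_complete :
  cauchy_complete U -> cauchy_complete V -> cauchy_complete (sum_prod U V).
Proof.
move=> UC VC w wC.
have [u uE] : exists u : U, (w n).1 @[n --> \oo] --> u.
  apply: UC => e /wC[N HN]; exists N => m n Nm Nn.
  exact: le_trans (sum_prod_norm1 (w m - w n)) (HN _ _ Nm Nn).
have [v vE] : exists v : V, (w n).2 @[n --> \oo] --> v.
  apply: VC => e /wC[N HN]; exists N => m n Nm Nn.
  exact: le_trans (sum_prod_norm2 (w m - w n)) (HN _ _ Nm Nn).
exists ((u, v) : sum_prod U V); apply/cvgrPdist_le => e e0.
have e20 : 0 < e / 2 by rewrite divr_gt0.
have /cvgrPdist_le/(_ _ e20) uE' := uE; have /cvgrPdist_le/(_ _ e20) vE' := vE.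
near=> n; rewrite sum_prod_normE [e]splitr lerD//; by near: n.
Unshelve. all: by end_near. Qed.

Lemma sum_prod_norming : norming U -> norming V -> norming (sum_prod U V).
Proof.
move=> NU NV w c; rewrite sum_prod_normE => cw.
pose e := (`|w.1| + `|w.2| - c) / 2.
have e0 : 0 < e by rewrite divr_gt0// subr_gt0.
have [l [lin lb] lw] := NU w.1 (`|w.1| - e) ltac:(by rewrite ltrBlDr ltrDl).
have [k [kin kb] kw] := NV w.2 (`|w.2| - e) ltac:(by rewrite ltrBlDr ltrDl).
exists (fun z => l z.1 + k z.2); first split.
- by move=> a x y; rewrite /= lin kin mulrDr addrACA.
- by move=> x; rewrite (le_trans (ler_normD _ _))// lerD.
- have -> : c = (`|w.1| - e) + (`|w.2| - e) by rewrite /e; field.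
  exact: lerD.
Qed.

End sum_prod_theory.

(** * Smooth bumps and windows *)

(** The form in which [bounded_lipschitz_ode] yields derivatives. *)
Lemma is_derive_taylor (R : realType) (V : normedModType R) (f : R -> V) t d C :
  (forall s, `|f s - f t - (s - t) *: d| <= C * (s - t) ^+ 2) ->
  is_derive t (1 : R) f d.
Proof.
move=> H; have lim : h^-1 *: (f (h *: 1 + t) - f t) @[h --> 0^'] --> d.
  apply/cvgrPdist_le => e e0.
  have C1 : 0 < `|C| + 1 by rewrite ltr_pwDr.
  exists (e / (`|C| + 1)); first by rewrite /= divr_gt0.
  move=> h /=; rewrite sub0r normrN => he h0.
  have -> : h *: 1 + t = t + h :> R by rewrite /GRing.scale/= mulr1 addrC.
  have := H (t + h).
  rewrite (_ : t + h - t = h) => [Hh|]; last by rewrite addrAC subrr add0r.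
  have -> : d - h^-1 *: (f (t + h) - f t) = - h^-1 *: (f (t + h) - f t - h *: d).
    by rewrite [RHS]scaleNr [in RHS]scalerBr scalerA mulVf// scale1r opprB.
  rewrite normrZ normrN normfV ler_pdivrMl ?normr_gt0//.
  rewrite (le_trans Hh)// -[h ^+ 2]real_normK ?num_real// expr2 mulrCA.
  rewrite ler_wpM2l// (le_trans (ler_wpM2r (normr_ge0 h) (ler_norm C)))//.
  move: he; rewrite ltr_pdivlMr// => /ltW; apply: le_trans.
  by rewrite mulrC ler_wpM2l// lerDl.
by split; [apply/cvg_ex; exists d | exact: cvg_lim].
Qed.

Section real_derivatives.
Context (R : realType).
Implicit Types (f g : R -> R) (x a b : R).

Lemma is_derive_mul f g x a b : is_derive x (1 : R) f a -> is_derive x (1 : R) g b ->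
  is_derive x (1 : R) (fun y => f y * g y) (a * g x + f x * b).
Proof.
move=> Hf Hg; have -> : a * g x + f x * b = f x *: b + g x *: a.
  by rewrite /GRing.scale/=; ring.
exact: is_deriveM Hf Hg.
Qed.

Lemma is_derive_add f g x a b : is_derive x (1 : R) f a -> is_derive x (1 : R) g b ->
  is_derive x (1 : R) (fun y => f y + g y) (a + b).
Proof. by move=> Hf Hg; exact: is_deriveD Hf Hg. Qed.

Lemma is_derive_scale f x c a : is_derive x (1 : R) f a ->
  is_derive x (1 : R) (fun y => c * f y) (c * a).
Proof.
move=> Hf; have := is_derive_mul (is_derive_cst c x 1) Hf.
by rewrite mul0r add0r.
Qed.

Lemma is_derive_affine f x a b c : is_derive (a * x + b) (1 : R) f c ->
  is_derive x (1 : R) (fun y => f (a * y + b)) (a * c).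
Proof.
move=> Hf; have Ha : is_derive x (1 : R) (fun y => a * y + b) a.
  have := is_derive_add (is_derive_scale a (is_derive_id x 1)) (is_derive_cst b x 1).
  by rewrite mulr1 addr0.
have := @is_derive1_comp R f (fun y => a * y + b) x c a Hf Ha.
by rewrite mulrC.
Qed.

End real_derivatives.

Section flat_functions.
Context (R : realType).
Implicit Types (x a b c : R) (k n : nat) (f g : R -> R).

(** The powers of [x] make the family stable under differentiation. *)
Definition psi k x : R := if 0 < x then x ^- k * expR (- x^-1) else 0.

Lemma psi_le0 k x : x <= 0 -> psi k x = 0.
Proof. by rewrite /psi ltNge => ->. Qed.

Lemma psi_gt0 k x : 0 < x -> 0 < psi k x.
Proof. by move=> x0; rewrite /psi x0 mulr_gt0 ?expR_gt0// invr_gt0 exprn_gt0. Qed.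

Lemma psi_ge0 k x : 0 <= psi k x.
Proof. by have [/psi_le0->//|/(psi_gt0 k)/ltW] := leP x 0. Qed.

(** The term of degree [k + 2] of the exponential series at [1 / x]. A square
    on the right is what makes the derivative at [0] vanish. *)
Lemma psi_le_sqr k x : psi k x <= (k.+2)`!%:R * x ^+ 2.
Proof.
have [x0|x0] := leP x 0; first by rewrite psi_le0// mulr_ge0// sqr_ge0.
rewrite /psi x0 expRN ler_pdivrMr ?expR_gt0//.
have : x^-1 ^+ k.+2 / (k.+2)`!%:R <= expR x^-1.
  apply: le_trans (@expR_ge1Dxn R x^-1 k.+1 _); first by rewrite lerDr.
  by rewrite invr_ge0 ltW.
have C0 : 0 <= (k.+2)`!%:R * x ^+ 2 by rewrite mulr_ge0// sqr_ge0.
move=> /(ler_wpM2l C0); apply: le_trans; rewrite le_eqVlt; apply/orP; left.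
apply/eqP; rewrite exprVn !exprS; field.
by rewrite pnatr_eq0 -lt0n fact_gt0 !gt_eqF ?exprn_gt0.
Qed.

Lemma is_derive_psi k x :
  is_derive x (1 : R) (psi k) (psi k.+2 x - k%:R * psi k.+1 x).
Proof.
have [x0|x0|<-] := ltgtP 0 x.
- have H : is_derive x (1 : R) (fun y => (y^-1) ^+ k * expR (- y^-1))
      (psi k.+2 x - k%:R * psi k.+1 x).
    have Hi : is_derive x (1 : R) (fun y : R => y^-1) (- x ^- 2).
      have H0 : is_derive x (1 : R) (@id R) 1 := is_derive_id x 1.
      apply: is_derive_eq; first exact: (@is_deriveV R id x 1 1 (lt0r_neq0 x0) H0).
      by rewrite /GRing.scale/= mulr1.
    have He :
      is_derive x (1 : R) (fun y : R => expR (- y^-1)) (x ^- 2 * expR (- x^-1)).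
      have Hn : is_derive x (1 : R) (fun y : R => - y^-1) (x ^- 2).
        by apply: is_derive_eq; rewrite opprK.
      have := @is_derive1_comp R expR (fun y => - y^-1) x _ _ (is_derive_expR _) Hn.
      by rewrite mulrC.
    have x0' : x != 0 by rewrite gt_eqF.
    have HX n : is_derive x (1 : R) (fun y : R => y^-1 ^+ n) (- n%:R * x^-1 ^+ n.+1).
      elim: n => [|n IH].
        rewrite oppr0 mul0r (_ : (fun _ => _) = cst 1); first exact: is_derive_cst.
        by apply/funext => y; rewrite expr0.
      rewrite (_ : (fun _ => _) = (fun y => y^-1 * y^-1 ^+ n)); last first.
        by apply/funext => y; rewrite exprS.
      have := is_derive_mul Hi IH; congr is_derive.
      by rewrite -natr1 !exprS; field.
    have := is_derive_mul (HX k) He; congr is_derive.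
    by rewrite /psi x0 -!exprVn !exprS; ring.
  apply: near_eq_is_derive H; near=> y.
  have y0 : 0 < y by near: y; exact: lt_nbhsr.
  by rewrite /psi y0 exprVn.
- rewrite !psi_le0 ?(ltW x0)// mulr0 subr0.
  apply: near_eq_is_derive (is_derive_cst 0 x 1); near=> y.
  by rewrite psi_le0// ltW//; near: y; exact: lt_nbhsl.
(* At 0, the bound of psi by a square is a quadratic remainder. *)
rewrite !psi_le0// mulr0 subr0.
apply: (@is_derive_taylor _ R^o _ _ _ (k.+2)`!%:R) => s.
rewrite (psi_le0 k (lexx 0)) scaler0 !subr0 ger0_norm ?psi_ge0//.
exact: psi_le_sqr.
Unshelve. all: by end_near. Qed.

End flat_functions.

Section bump.
Context (R : realType).
Implicit Types (x a b c : R) (f g : R -> R).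
Local Notation mu := (@lebesgue_measure R).

Lemma is_derive_continuous f df : (forall x, is_derive x (1 : R) f (df x)) -> continuous f.
Proof.
move=> H x; apply/differentiable_continuous/derivable1_diffP.
by have [] := H x.
Qed.

Lemma continuous_Rintegrable f a b : continuous f -> mu.-integrable `[a, b] (EFin \o f).
Proof.
move=> cf; apply: continuous_compact_integrable; first exact: segment_compact.
exact: continuous_subspaceT.
Qed.

Definition smooth_bump x : R := psi 0 x * psi 0 (1 - x).

Lemma smooth_bump_ge0 x : 0 <= smooth_bump x. Proof. by rewrite mulr_ge0// psi_ge0. Qed.

Lemma smooth_bump_le0 x : x <= 0 -> smooth_bump x = 0.
Proof. by move=> x0; rewrite /smooth_bump psi_le0// mul0r. Qed.

Lemma smooth_bump_ge1 x : 1 <= x -> smooth_bump x = 0.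
Proof. by move=> x1; rewrite /smooth_bump [psi 0 (1 - x)]psi_le0 ?mulr0// subr_le0. Qed.

Lemma smooth_bump_gt0 x : 0 < x < 1 -> 0 < smooth_bump x.
Proof. by move=> /andP[x0 x1]; rewrite mulr_gt0// psi_gt0// subr_gt0. Qed.

Lemma smooth_bump_continuous : continuous smooth_bump.
Proof.
have H x := is_derive_mul (is_derive_psi 0 x)
  (is_derive_affine (is_derive_psi 0 (-1 * x + 1))).
have -> : smooth_bump = (fun x => psi 0 x * psi 0 (-1 * x + 1)).
  by apply/funext => x; rewrite /smooth_bump mulN1r addrC.
exact: is_derive_continuous H.
Qed.

(** With the lower end [-1], every [x >= 0] is interior to the interval of
    integration on which the fundamental theorem of calculus is applied. *)
Definition bump_prim x : R := \int[mu]_(t in `[-1, x]) smooth_bump t.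

Lemma bump_prim_le0 x : x <= 0 -> bump_prim x = 0.
Proof.
move=> x0; rewrite /bump_prim (_ : 0 = \int[mu]_(t in `[-1, x]) 0).
  apply: eq_Rintegral => y; rewrite inE/= in_itv/= => /andP[_ yx].
  by rewrite smooth_bump_le0// (le_trans yx).
by rewrite /Rintegral integral0.
Qed.

Lemma is_derive_bump_prim x : is_derive x (1 : R) bump_prim (smooth_bump x).
Proof.
have [x0|x0] := ltP x 0.
  rewrite smooth_bump_le0 ?(ltW x0)//.
  apply: near_eq_is_derive (is_derive_cst 0 x 1); near=> y.
  by rewrite bump_prim_le0// ltW//; near: y; exact: lt_nbhsl.
have xx1 : x < x + 1 by rewrite ltrDl.
have [] := continuous_FTC1_closed xx1
  (@continuous_Rintegrable smooth_bump (-1) (x + 1) smooth_bump_continuous)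
  (lt_le_trans _ x0) (@smooth_bump_continuous x); first by rewrite ltrN10.
move=> dB B'; rewrite -B'; apply: DeriveDef; first exact: dB.
by rewrite derive1E.
Unshelve. all: by end_near. Qed.

Lemma bump_prim_continuous : continuous bump_prim.
Proof. exact: is_derive_continuous is_derive_bump_prim. Qed.

Lemma bump_prim_ge1 x : 1 <= x -> bump_prim x = bump_prim 1.
Proof.
move=> x1; have dB y (_ : y \in `]1, x[%R) := is_derive_bump_prim y.
have cB : {within `[1, x], continuous bump_prim}.
  by apply: continuous_subspaceT; exact: bump_prim_continuous.
have [c] := MVT_segment x1 dB cB; rewrite in_itv/= => /andP[c1 _].
by rewrite smooth_bump_ge1// mul0r => /eqP; rewrite subr_eq0 => /eqP.
Qed.

Lemma bump_prim1_gt0 : 0 < bump_prim 1.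
Proof.
have dB y (_ : y \in `]0, 1[%R) := is_derive_bump_prim y.
have cB : {within `[0, 1], continuous bump_prim}.
  by apply: continuous_subspaceT; exact: bump_prim_continuous.
have [c] := MVT ltr01 dB cB; rewrite in_itv/= => c01.
by rewrite (bump_prim_le0 (lexx 0)) !subr0 mulr1 => ->; exact: smooth_bump_gt0.
Qed.

(** A class of functions closed under differentiation: this settles the
    smoothness of its members at all orders at once. *)
Inductive flat : (R -> R) -> Prop :=
| flat_psi k a b : flat (fun x => psi k (a * x + b))
| flat_prim a b : flat (fun x => bump_prim (a * x + b))
| flat_scale c f : flat f -> flat (fun x => c * f x)
| flat_add f g : flat f -> flat g -> flat (fun x => f x + g x)
| flat_mul f g : flat f -> flat g -> flat (fun x => f x * g x).

Lemma flat_derive f : flat f ->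
  exists2 f', flat f' & forall x, is_derive x (1 : R) f (f' x).
Proof.
elim=> [k a b|a b|c {}f _ [f' Ff' ff']|{}f g Ff [f' Ff' ff'] Fg [g' Fg' gg']
  |{}f g Ff [f' Ff' ff'] Fg [g' Fg' gg']].
- exists (fun x => a * (psi k.+2 (a * x + b) + (- k%:R) * psi k.+1 (a * x + b))).
    by do ?constructor.
  by move=> x; rewrite mulNr; apply: is_derive_affine; exact: is_derive_psi.
- exists (fun x => a * (psi 0 (a * x + b) * psi 0 ((- a) * x + (1 - b)))).
    by do ?constructor.
  move=> x; have := is_derive_affine (is_derive_bump_prim (a * x + b)).
  by rewrite /smooth_bump opprD addrCA mulNr.
- exists (fun x => c * f' x); first by constructor.
  by move=> x; exact: is_derive_scale.
- exists (fun x => f' x + g' x); first by constructor.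
  by move=> x; exact: is_derive_add.
- exists (fun x => f' x * g x + f x * g' x); first by do ?constructor.
  by move=> x; exact: is_derive_mul.
Qed.

Lemma flat_smooth f n : flat f -> flat f^`(n).
Proof.
move=> Ff; elim: n => [//|n IH]; rewrite derive1nS.
have [f' Ff' ff'] := flat_derive IH; suff -> : f^`(n)^`() = f' by [].
by apply/funext => x; rewrite derive1E; exact: derive_val.
Qed.

Lemma flat_derivable f x n : flat f -> derivable f^`(n) x 1.
Proof. by move=> /(flat_smooth n)/flat_derive[f' _ /(_ x)[]]. Qed.

Lemma is_derive_scaled_bump d r x : d != 0 ->
  is_derive x (1 : R) (fun y => d * bump_prim ((y - r) / d)) (smooth_bump ((x - r) / d)).
Proof.
move=> d0; have E y : (y - r) / d = d^-1 * y + - (d^-1 * r) by ring.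
have := is_derive_scale d
  (is_derive_affine (is_derive_bump_prim (d^-1 * x + - (d^-1 * r)))).
rewrite mulrA divff// mul1r -E; congr is_derive.
by apply/funext => y; rewrite E.
Qed.

Lemma scaled_bump_continuous d r : continuous (fun x => smooth_bump ((x - r) / d)).
Proof.
move=> x; apply: (@continuous_comp _ _ _ (fun x => (x - r) / d) smooth_bump).
  by apply: cvgMl; apply: cvgB; [exact: cvg_id | exact: cvg_cst].
exact: smooth_bump_continuous.
Qed.

Section window.
Variables (T s t d : R).
Hypotheses (d0 : 0 < d) (s0 : 0 < s) (st : s <= t) (tT : t + d < T).

(** Up to the factor [d * bump_prim 1], a smooth approximation of the indicator
    function of the interval from [s] to [t]. Its derivative is the difference
    of two bumps of width [d], one after [s] and one after [t]. *)
Definition window x : R := d * (bump_prim ((x - s) / d) - bump_prim ((x - t) / d)).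

Lemma is_derive_window x :
  is_derive x (1 : R) window (smooth_bump ((x - s) / d) - smooth_bump ((x - t) / d)).
Proof.
have H r := is_derive_scaled_bump r x (lt0r_neq0 d0).
have := is_derive_add (H s) (is_derive_scale (-1) (H t)); rewrite mulN1r.
by congr is_derive; apply/funext => y; rewrite /window mulN1r mulrBr.
Qed.

Lemma window_test : test_function T window.
Proof.
split.
  have E : window = (fun x => d * (bump_prim (d^-1 * x + (- s / d))
      + (-1) * bump_prim (d^-1 * x + (- t / d)))).
    by apply/funext => x; rewrite /window mulN1r !mulNr !mulrBl !(mulrC x).
  by move=> n x; apply: flat_derivable; rewrite E; do ?constructor.
exists s, (t + d); split => // x; rewrite negb_and -!ltNge => /orP[xs|tx].
  rewrite /window !bump_prim_le0 ?subrr ?mulr0// pmulr_lle0 ?invr_gt0// subr_le0.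
    exact: le_trans (ltW xs) st.
  exact: ltW.
rewrite /window bump_prim_ge1; last first.
  rewrite ler_pdivlMr// mul1r lerBrDl (le_trans _ (ltW tx))// lerD2r//.
rewrite bump_prim_ge1 ?subrr ?mulr0// ler_pdivlMr// mul1r lerBrDl.
exact: ltW.
Qed.

End window.

End bump.

(** * Weak derivatives of real functions *)

Section du_bois_reymond.
Context (R : realType).
Implicit Types (T s t d e r : R) (f F D : R -> R).
Local Notation mu := (@lebesgue_measure R).

Lemma Rintegral_derivative F f a b : a <= b -> (forall x, is_derive x (1 : R) F (f x)) ->
  continuous f -> \int[mu]_(x in `[a, b]) f x = F b - F a.
Proof.
rewrite le_eqVlt => /predU1P[<- _ _|ab Ff cf].
  by rewrite subrr set_itv1 Rintegral_set1.
have cF := is_derive_continuous Ff.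
rewrite /Rintegral (@continuous_FTC2 _ f F)//.
- exact: continuous_subspaceT.
- split; first by move=> x _; have [] := Ff x.
  + by apply: cvg_at_right_filter; exact: cF.
  + by apply: cvg_at_left_filter; exact: cF.
- by move=> x _; rewrite derive1E; exact: derive_val.
Qed.

Section window_average.
Variables (T s d : R).
Hypotheses (d0 : 0 < d) (s0 : 0 < s) (sT : s + d < T).

Let beta r := smooth_bump ((r - s) / d).

Let beta_prim r : is_derive r (1 : R) (fun r => d * bump_prim ((r - s) / d)) (beta r).
Proof. exact: is_derive_scaled_bump (lt0r_neq0 d0). Qed.

Let beta_continuous : continuous beta. Proof. exact: scaled_bump_continuous. Qed.

Let T0 : 0 <= T.
Proof. by rewrite (le_trans _ (ltW sT))// addr_ge0// ltW. Qed.

Lemma window_mass : \int[mu]_(r in `[0, T]) beta r = d * bump_prim 1.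
Proof.
rewrite (Rintegral_derivative T0 beta_prim beta_continuous).
rewrite bump_prim_ge1; last first.
  by rewrite ler_pdivlMr// mul1r lerBrDl ltW.
rewrite [bump_prim ((0 - s) / d)]bump_prim_le0 ?mulr0 ?subr0//.
by rewrite pmulr_lle0 ?invr_gt0// sub0r oppr_le0 ltW.
Qed.

(** The bump has mass [d * bump_prim 1] and lives between [s] and [s + d],
    where [D] hardly varies. *)
Lemma window_average D e : continuous D -> 0 <= e ->
  (forall r, s <= r <= s + d -> `|D r - D s| <= e) ->
  `|\int[mu]_(r in `[0, T]) (beta r * D r) - d * bump_prim 1 * D s| <= d * bump_prim 1 * e.
Proof.
move=> cD e0 De; have cb := beta_continuous.
have cM f : continuous f -> continuous (fun r => beta r * f r).
  by move=> cf r; apply: cvgM; [exact: cb | exact: cf].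
have cc c : continuous (fun _ : R => c : R) by move=> r; exact: cvg_cst.
have cDs : continuous (fun r => D r - D s).
  by move=> r; apply: cvgB; [exact: cD | exact: cvg_cst].
have IM c : \int[mu]_(r in `[0, T]) (beta r * c) = d * bump_prim 1 * c.
  by rewrite RintegralZr// ?window_mass//; exact: continuous_Rintegrable.
rewrite -!IM -RintegralB//; try exact/continuous_Rintegrable/cM.
have E : \int[mu]_(r in `[0, T]) (beta r * D r - beta r * D s) =
    \int[mu]_(r in `[0, T]) (beta r * (D r - D s)).
  by apply: eq_Rintegral => r _; rewrite mulrBr.
rewrite E.
have iD : mu.-integrable `[0, T] (EFin \o (fun r => beta r * (D r - D s))).
  exact/continuous_Rintegrable/cM.
rewrite (le_trans (le_normr_Rintegral _ iD))//; apply: le_Rintegral => //.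
- apply: continuous_Rintegrable => r; apply: cvg_norm; exact: (cM _ cDs).
- exact/continuous_Rintegrable/cM.
move=> r _; rewrite normrM ger0_norm ?smooth_bump_ge0//.
have [rs|sr] := ltP r s.
  rewrite /beta smooth_bump_le0 ?mul0r// pmulr_lle0 ?invr_gt0// subr_le0; exact: ltW.
have [rd|dr] := leP r (s + d).
  by rewrite ler_wpM2l ?smooth_bump_ge0// De// sr.
by rewrite /beta smooth_bump_ge1 ?mul0r// ler_pdivlMr// mul1r lerBrDl ltW.
Qed.

End window_average.

(** With a window as the test function, the weighted averages of [D] just after
    [s] and just after [t] agree; let the width tend to [0]. The end points of
    the interval are reached by continuity. *)
Lemma du_bois_reymond T D : continuous D ->
  (forall phi, test_function T phi ->
     \int[mu]_(t in `[0, T]) (derive1 phi t * D t) = 0) ->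
  forall s t, 0 <= s <= T -> 0 <= t <= T -> D s = D t.
Proof.
move=> cD HD.
have near_D s e : 0 < e -> exists2 d, 0 < d & forall r, `|s - r| < d -> `|D r - D s| <= e.
  move=> e0; have /cvgrPdist_le/(_ e e0)/nbhs_ballP[d /= d0 Hd] := cD s.
  by exists d => // r; move=> /Hd; rewrite distrC.
have inner s t : 0 < s -> s <= t -> t < T -> D s = D t.
  move=> s0 st tT; apply/eqP; rewrite -subr_eq0 -normr_le0.
  apply/ler_addgt0Pr => e e0; rewrite add0r.
  have e20 : 0 < e / 2 by rewrite divr_gt0.
  have [d1 d10 H1] := near_D s _ e20; have [d2 d20 H2] := near_D t _ e20.
  pose d := Num.min (Num.min d1 d2) (T - t) / 2.
  have m0 : 0 < Num.min (Num.min d1 d2) (T - t) by rewrite !lt_min d10 d20 subr_gt0.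
  have d0 : 0 < d by rewrite divr_gt0.
  have dm : d < Num.min (Num.min d1 d2) (T - t) by rewrite ltr_pdivrMr// ltr_pMr// ltr1n.
  move: dm; rewrite !lt_min => /andP[/andP[dd1 dd2] dT].
  have tdT : t + d < T by rewrite addrC -ltrBrDr.
  have sdT : s + d < T by rewrite (le_lt_trans _ tdT)// lerD2r.
  have As := window_average d0 s0 sdT cD (ltW e20).
  have At := window_average d0 (lt_le_trans s0 st) tdT cD (ltW e20).
  have {}As : `|\int[mu]_(r in `[0, T]) (smooth_bump ((r - s) / d) * D r)
      - d * bump_prim 1 * D s| <= d * bump_prim 1 * (e / 2).
    apply: As => r /andP[sr rsd]; apply: H1.
    by rewrite distrC ger0_norm ?subr_ge0// (le_lt_trans _ dd1)// lerBlDl.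
  have {}At : `|\int[mu]_(r in `[0, T]) (smooth_bump ((r - t) / d) * D r)
      - d * bump_prim 1 * D t| <= d * bump_prim 1 * (e / 2).
    apply: At => r /andP[sr rsd]; apply: H2.
    by rewrite distrC ger0_norm ?subr_ge0// (le_lt_trans _ dd2)// lerBlDl.
  have := HD _ (window_test d0 s0 st tdT).
  have -> : (fun r => derive1 (window s t d) r * D r) =
      (fun r => smooth_bump ((r - s) / d) * D r - smooth_bump ((r - t) / d) * D r).
    apply/funext => r; rewrite derive1E.
    have -> : 'D_1 (window s t d) r = smooth_bump ((r - s) / d) - smooth_bump ((r - t) / d).
      by have [_ ->] := is_derive_window s t d0 r.
    by rewrite mulrBl.
  have iw a : mu.-integrable `[0, T] (EFin \o (fun r => smooth_bump ((r - a) / d) * D r)).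
    apply: continuous_Rintegrable => r; apply: cvgM; last exact: cD.
    exact: scaled_bump_continuous.
  rewrite RintegralB// => /eqP; rewrite subr_eq0 => /eqP Est.
  rewrite -Est in At.
  have M0 : 0 < d * bump_prim 1 by rewrite mulr_gt0// bump_prim1_gt0.
  rewrite -(ler_pM2l M0) -{1}(gtr0_norm M0) -normrM mulrBr [e in leRHS]splitr mulrDr.
  rewrite -(subrKA (\int[mu]_(r in `[0, T]) (smooth_bump ((r - s) / d) * D r))).
  rewrite (le_trans (ler_normD _ _))// lerD//.
    by rewrite distrC; exact: As.
have inner' s t : 0 < s < T -> 0 < t < T -> D s = D t.
  move=> /andP[s0 sT] /andP[t0 tT]; have [st|/ltW ts] := leP s t; first exact: inner.
  exact/esym/inner.
have [T0|T0] := leP T 0.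
  move=> s t /andP[s0 sT] /andP[t0 tT]; congr D; apply/eqP.
  by rewrite eq_le (le_trans sT) ?(le_trans T0)//= (le_trans tT)// (le_trans T0).
suff mid : forall s, 0 <= s <= T -> D s = D (T / 2).
  by move=> s' t' /mid-> /mid->.
move=> s /andP[s0 sT]; apply/eqP; rewrite -subr_eq0 -normr_le0.
apply/ler_addgt0Pr => e e0; rewrite add0r.
have [d d0 Hd] := near_D s _ e0.
have T20 : 0 < T / 2 < T by rewrite divr_gt0//= ltr_pdivrMr// ltr_pMr// ltr1n.
(* The point r is interior, between s and T / 2, at a distance less than d
   from s. *)
pose c := Num.min (d / (2 * T)) (1 / 2).
have c0 : 0 < c by rewrite lt_min !divr_gt0// mulr_gt0.
have c1 : c < 1 by rewrite gt_min; apply/orP; right; rewrite ltr_pdivrMr// mul1r ltr1n.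
pose r := s + c * (T / 2 - s).
have c10 : 0 < 1 - c by rewrite subr_gt0.
have rin : 0 < r < T.
  apply/andP; split.
    rewrite (_ : r = (1 - c) * s + c * T / 2); last by rewrite /r; field.
    by rewrite ltr_wpDl ?divr_gt0 ?mulr_gt0 ?mulr_ge0// ltW.
  rewrite -subr_gt0 (_ : T - r = (1 - c) * (T - s) + c * T / 2); last by rewrite /r; field.
  by rewrite ltr_wpDl ?divr_gt0 ?mulr_gt0 ?mulr_ge0 ?subr_ge0// ltW.
rewrite -(inner' r (T / 2))// distrC; apply: Hd.
rewrite /r opprD addrA subrr sub0r normrN normrM gtr0_norm//.
have sT2 : `|T / 2 - s| <= T by rewrite ler_norml; apply/andP; split; lra.
rewrite (le_lt_trans (ler_wpM2l (ltW c0) sT2))//.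
rewrite (@le_lt_trans _ _ (d / (2 * T) * T))//.
  by rewrite ler_wpM2r ?(ltW T0)// ge_min lexx.
rewrite (_ : d / (2 * T) * T = d / 2); last by field; rewrite gt_eqF.
by rewrite ltr_pdivrMr// ltr_pMr// ltr1n.
Qed.

End du_bois_reymond.

Section weak_derivative_real.
Context (R : realType).
Implicit Types (T s t d e r x : R) (f F D U V : R -> R).
Local Notation mu := (@lebesgue_measure R).

(** The integral from [-1] is a primitive only after [-1]. It is affine up to
    [0], as [f] is constant there, and it can be replaced from [- 1 / 2]
    downward by that affine function. *)
Lemma primitive_of_clamped f : continuous f -> (forall x, x <= 0 -> f x = f 0) ->
  exists F, forall x, is_derive x (1 : R) F (f x).
Proof.
move=> cf f0; pose I x := \int[mu]_(t in `[-1, x]) f t.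
have IE x : -1 <= x <= 0 -> I x = f 0 * (x + 1).
  move=> /andP[x1 x0]; rewrite /I (_ : \int[mu]_(t in `[-1, x]) f t =
    \int[mu]_(t in `[-1, x]) f 0).
    rewrite Rintegral_cst//= lebesgue_measure_itv/= lte_fin.
    case: ltP => [_|x1']; first by rewrite opprK.
    by rewrite mulr0 (_ : x = -1) ?addNr ?mulr0//; apply/eqP; rewrite eq_le x1 x1'.
  apply: eq_Rintegral => y; rewrite inE/= in_itv/= => /andP[_ yx].
  by rewrite f0// (le_trans yx).
exists (fun x => if x < - 2^-1 then f 0 * x else I x - f 0) => x.
have lin y : is_derive y (1 : R) (fun y => f 0 * y) (f 0).
  by have := is_derive_scale (f 0) (is_derive_id y 1); rewrite mulr1.
have [x0|x0] := ltP x 0.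
  rewrite f0 ?(ltW x0)//; apply: near_eq_is_derive (lin x); near=> y.
  case: ifPn => //; rewrite -leNgt => y2.
  have y0 : y < 0 by near: y; exact: lt_nbhsl.
  rewrite IE; first by rewrite mulrDr mulr1 addrK.
  by rewrite (ltW y0) andbT (le_trans _ y2)// lerN2 invf_le1// ler1n.
have xx1 : x < x + 1 by rewrite ltrDl.
have [] := continuous_FTC1_closed xx1 (@continuous_Rintegrable _ f (-1) (x + 1) cf)
  (lt_le_trans _ x0) (cf x); first by rewrite ltrN10.
move=> dI I'; have HI : is_derive x (1 : R) I (f x).
  rewrite -I'; apply: DeriveDef; first exact: dI.
  by rewrite derive1E.
have := is_derive_add HI (is_derive_cst (- f 0) x 1); rewrite addr0.
apply: near_eq_is_derive; near=> y; rewrite ifF//; apply/negbTE; rewrite -leNgt ltW//.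
near: y; apply: lt_nbhsr; rewrite (lt_le_trans _ x0)// oppr_lt0 invr_gt0 ltr0n//.
Unshelve. all: by end_near. Qed.

Lemma test_function_derive T phi n x : test_function T phi ->
  is_derive x (1 : R) (phi^`(n)) (phi^`(n.+1) x).
Proof.
by move=> [dphi _]; apply: DeriveDef; [exact: dphi | rewrite derive1nS derive1E].
Qed.

Lemma test_function_continuous T phi n : test_function T phi -> continuous (phi^`(n)).
Proof.
by move=> /test_function_derive H; exact: (is_derive_continuous (H n)).
Qed.

Lemma test_function_endpoints T phi : test_function T phi -> phi 0 = 0 /\ phi T = 0.
Proof.
move=> [_ [a [b [a0 bT phi0]]]]; split; apply: phi0; rewrite negb_and -!ltNge ?a0//.
by rewrite bT orbT.
Qed.

Lemma test_function_by_parts T phi F f : 0 <= T -> test_function T phi ->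
  (forall x, is_derive x (1 : R) F (f x)) -> continuous f ->
  \int[mu]_(t in `[0, T]) (derive1 phi t * F t) +
  \int[mu]_(t in `[0, T]) (phi t * f t) = 0.
Proof.
move=> T0 tphi Ff cf; have cF := is_derive_continuous Ff.
have c0 : continuous phi := test_function_continuous (n := 0) tphi.
have c1 : continuous (derive1 phi) := test_function_continuous (n := 1) tphi.
have c1F : continuous (fun t => derive1 phi t * F t).
  by move=> t; apply: cvgM; [exact: c1 | exact: cF].
have c0f : continuous (fun t => phi t * f t).
  by move=> t; apply: cvgM; [exact: c0 | exact: cf].
rewrite -RintegralD//; try exact: continuous_Rintegrable.
have dH x : is_derive x (1 : R) (fun t => phi t * F t) (derive1 phi x * F x + phi x * f x).
  by apply: is_derive_mul (Ff x); exact: (test_function_derive 0 x tphi).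
rewrite (Rintegral_derivative T0 dH).
  by have [-> ->] := test_function_endpoints tphi; rewrite !mul0r subrr.
by move=> t; apply: cvgD; [exact: c1F | exact: c0f].
Qed.

(** If [W] is a primitive of [V], then [U - W] is constant by
    [du_bois_reymond]; the estimate is the mean value theorem for [W]. *)
Lemma weak_derivative_real T U V : 0 <= T -> continuous U -> continuous V ->
  (forall x, x <= 0 -> V x = V 0) ->
  (forall phi, test_function T phi ->
    \int[mu]_(t in `[0, T]) (derive1 phi t * U t) +
    \int[mu]_(t in `[0, T]) (phi t * V t) = 0) ->
  forall s t K, 0 <= s <= t -> t <= T ->
    (forall r, s <= r <= t -> `|V r - V t| <= K) ->
    `|U t - U s - (t - s) * V t| <= K * (t - s).
Proof.
move=> T0 cU cV V0 HUV s t K /andP[s0 st] tT HK.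
have [W VW] := primitive_of_clamped cV V0; have cW := is_derive_continuous VW.
have UW : U s - W s = U t - W t.
  apply: (@du_bois_reymond _ T (fun r => U r - W r)).
  - by move=> r; apply: cvgB; [exact: cU | exact: cW].
  - move=> phi tphi.
    have c1 : continuous (derive1 phi) := test_function_continuous (n := 1) tphi.
    have E : \int[mu]_(t in `[0, T]) (derive1 phi t * U t) =
        \int[mu]_(t in `[0, T]) (derive1 phi t * W t).
      apply: (addIr (\int[mu]_(t in `[0, T]) (phi t * V t))).
      by rewrite HUV// (test_function_by_parts T0 tphi VW cV).
    have -> : (fun r => derive1 phi r * (U r - W r)) =
      (fun r => derive1 phi r * U r - derive1 phi r * W r).
      by apply/funext => r; rewrite mulrBr.
    rewrite RintegralB// ?E ?subrr//; apply: continuous_Rintegrable => r; apply: cvgM;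
      [exact: c1 | exact: cU | exact: c1 | exact: cW].
  - by rewrite s0 (le_trans st).
  - by rewrite tT (le_trans s0).
have -> : U t - U s - (t - s) * V t = (W t - t * V t) - (W s - s * V t) by lra.
have dG r (_ : r \in `]s, t[%R) : is_derive r (1 : R) (fun r => W r - r * V t) (V r - V t).
  have -> : (fun r => W r - r * V t) = (fun r => W r + (- V t) * r).
    by apply/funext => x; rewrite mulNr mulrC.
  have := is_derive_add (VW r) (is_derive_scale (- V t) (is_derive_id r 1)).
  by rewrite mulr1.
have cG : {within `[s, t], continuous (fun r => W r - r * V t)}.
  apply: continuous_subspaceT => r; apply: cvgB; first exact: cW.
  by apply: cvgMl; exact: cvg_id.
have [c] := MVT_segment st dG cG; rewrite in_itv/= => cst ->.
by rewrite normrM (ger0_norm (_ : 0 <= t - s)) ?subr_ge0// ler_wpM2r ?subr_ge0// HK.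
Qed.

End weak_derivative_real.

(** * Bochner integrals *)

Section bochner_theory.
Import HBNNSimple.
Context d (T : measurableType d) (R : realType).
Variables (mu : {finite_measure set T -> \bar R}) (V : normedModType R).
Implicit Types (s f : T -> V) (l : V -> R).

(** The functions may fail to be measurable: the integral of a nonnegative
    function is the supremum of those of the simple functions below it, and
    these can be set to [0] on a measurable null set. *)
Lemma le_integral_ae (h k : T -> \bar R) :
  (forall x, (0 <= h x)%E) -> (forall x, (0 <= k x)%E) ->
  (\forall x \ae mu, (h x <= k x)%E) -> (\int[mu]_x h x <= \int[mu]_x k x)%E.
Proof.
move=> h0 k0 [N [mN muN hkN]]; rewrite !ge0_integralTE//.
apply: ge_ereal_sup => _ [g /= gh <-].
have mg : measurable_fun [set: T] (EFin \o g).
  by apply/measurable_EFinP; exact: measurable_funPT.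
have g0 x : [set: T] x -> (0 <= (EFin \o g) x)%E by rewrite /= lee_fin.
rewrite -integralT_nnsfun (ge0_negligible_integral mN measurableT mg g0 muN) setTD.
have mNc : measurable (~` N) by exact: measurableC.
rewrite integral_nnsfun//; apply: ereal_sup_ubound => /=.
have E := mrestrict g mNc; exists (proj_nnsfun g mNc); last by rewrite E.
move=> x; rewrite -[X in X%:E]/((proj_nnsfun g mNc : T -> R) x) -E /patch.
case: ifPn => [|_]; last exact: k0.
rewrite inE /= => Nx; apply: le_trans (gh x) _.
by apply: contrapT => /hkN.
Qed.

Lemma norming_functional0 l : norming_functional l -> l 0 = 0.
Proof.
move=> [lin _]; have := lin 1 0 0; rewrite scale1r addr0 mul1r.
by move=> /(congr1 (fun z => z - l 0)); rewrite subrr addrK.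
Qed.

Lemma norming_functionalD l v w : norming_functional l -> l (v + w) = l v + l w.
Proof. by move=> [lin _]; have := lin 1 v w; rewrite scale1r mul1r. Qed.

Lemma norming_functionalZ l c v : norming_functional l -> l (c *: v) = c * l v.
Proof.
move=> nl; have [lin _] := nl; have := lin c v 0.
by rewrite addr0 (norming_functional0 nl) addr0.
Qed.

Lemma norming_functionalB l v w : norming_functional l -> l (v - w) = l v - l w.
Proof.
move=> nl; rewrite norming_functionalD// -scaleN1r norming_functionalZ//.
by rewrite mulN1r.
Qed.

Lemma norming_functional_sum l (I : Type) (r : seq I) (F : I -> V) :
  norming_functional l -> l (\sum_(i <- r) F i) = \sum_(i <- r) l (F i).
Proof.
move=> nl; elim: r => [|i r IH]; first by rewrite !big_nil norming_functional0.
by rewrite !big_cons norming_functionalD// IH.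
Qed.

Lemma bochner_simple_preimage s (A : set V) : bochner_simple s -> measurable (s @^-1` A).
Proof.
move=> [fs ms]; have -> : s @^-1` A = \bigcup_(v in A `&` range s) (s @^-1` [set v]).
  apply/seteqP; split=> [x Ax|x [v [Av _] /= sx]] /=; last by rewrite sx.
  by exists (s x) => //; split=> //; exists x.
apply: fin_bigcup_measurable => [|v _]; last exact: ms.
exact: finite_setIr.
Qed.

Lemma bochner_simple_comp s (g : V -> R) : bochner_simple s ->
  measurable_fun [set: T] (g \o s).
Proof.
by move=> ss _ B mB; rewrite setTI comp_preimage; exact: bochner_simple_preimage.
Qed.

Lemma bochner_simple_bounded s (g : V -> R) : bochner_simple s ->
  exists C, forall x, `|g (s x)| <= C.
Proof.
move=> [fs _]; pose r := fset_set (range s).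
exists (\sum_(v <- r) `|g v|) => x.
have sr : s x \in r by rewrite in_fset_set// inE; exists x.
rewrite (big_fsetD1 (s x))//= lerDl sumr_ge0//.
Qed.

Lemma bochner_simple_integrable s (g : V -> R) : bochner_simple s ->
  mu.-integrable [set: T] (EFin \o (g \o s)).
Proof.
move=> ss; have [C HC] := bochner_simple_bounded g ss.
apply: (ae_bounded_integrable measurableT _ (C := C)).
- by rewrite -ge0_fin_numE// fin_num_measure.
- exact: bochner_simple_comp.
- by apply: nearW => x _; exact: HC.
Qed.

Lemma Rintegral_big_sum (I : Type) (r : seq I) (F : I -> T -> R) :
  (forall i, mu.-integrable [set: T] (EFin \o F i)) ->
  mu.-integrable [set: T] (EFin \o (fun x => \sum_(i <- r) F i x)) /\
  \int[mu]_x (\sum_(i <- r) F i x) = \sum_(i <- r) \int[mu]_x F i x.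
Proof.
move=> iF; elim: r => [|i r [ir IH]].
  have -> : (fun x => \sum_(i <- [::]) F i x) = cst 0 by apply/funext => x; rewrite big_nil.
  rewrite big_nil /Rintegral integral0; split=> //.
  exact: integrable0.
have -> : (fun x => \sum_(j <- i :: r) F j x) = (fun x => F i x + \sum_(j <- r) F j x).
  by apply/funext => x; rewrite big_cons.
rewrite big_cons RintegralD// IH; split=> //.
exact: (integrableD measurableT (iF i) ir).
Qed.

Lemma bochner_simple_integral_functional s l : bochner_simple s -> norming_functional l ->
  l (bochner_simple_integral mu s) = \int[mu]_x l (s x).
Proof.
move=> ss nl; have [fs ms] := ss; rewrite /bochner_simple_integral.
rewrite fsbig_finite//= norming_functional_sum//.
have i1 v : mu.-integrable [set: T] (EFin \o (\1_(s @^-1` [set v]) : T -> R)).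
  apply: (ae_bounded_integrable measurableT _ (C := 1)).
  - by rewrite -ge0_fin_numE// fin_num_measure.
  - exact: measurable_indic.
  - by apply: nearW => x _; rewrite indicE; case: (_ \in _); rewrite ?normr1 ?normr0.
have term v : l (fine (mu (s @^-1` [set v])) *: v) =
    \int[mu]_x (l v * \1_(s @^-1` [set v]) x).
  rewrite norming_functionalZ// RintegralZl// mulrC; congr (_ * _).
  by rewrite /Rintegral integral_indic// setIT.
under eq_bigr do rewrite term.
have [_ <-] := Rintegral_big_sum (fset_set (range s))
  (fun v => integrableZl measurableT (l v) (i1 v)).
congr fine; apply: eq_integral => x _; congr EFin.
have sr : s x \in fset_set (range s) by rewrite in_fset_set// inE; exists x.
rewrite (big_fsetD1 (s x))//= indicE mem_set// mulr1 big1_fset ?addr0// => v.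
rewrite !in_fsetD1 => /andP[vs _] _; rewrite indicE memNset ?mulr0//= => sv.
by move: vs; rewrite sv eqxx.
Qed.

(** Almost everywhere [|l (s_ n x) - h x| <= |s_ n x - f x|], and the integral
    of the right-hand side tends to [0]. This is how equalities between Bochner
    integrals are turned into equalities between real integrals. *)
Lemma bochner_integral_functional f I l (h : T -> R) :
  is_bochner_integral mu f I -> norming_functional l ->
  mu.-integrable [set: T] (EFin \o h) -> (\forall x \ae mu, l (f x) = h x) ->
  l I = \int[mu]_x h x.
Proof.
move=> [s_ [ss sf intsf SI]] nl ih lfh; apply/eqP; rewrite -subr_eq0 -normr_le0.
apply/ler_addgt0Pr => e e0; rewrite add0r.
have e20 : 0 < e / 2 by rewrite divr_gt0.
have /cvgrPdist_le/(_ _ e20) SI' := SI.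
have /fine_cvgP[fin_int /cvgrPdist_le/(_ _ e20) int_small] := intsf.
near \oo => n.
have H1 : `|I - bochner_simple_integral mu (s_ n)| <= e / 2 by near: n.
have H2 : (\int[mu]_x `|s_ n x - f x|%:E)%E \is a fin_num by near: n.
have H3 : `|0 - fine (\int[mu]_x `|s_ n x - f x|%:E)%E| <= e / 2 by near: n.
have il := bochner_simple_integrable l (ss n).
rewrite -(subrKA (l (bochner_simple_integral mu (s_ n)))) [e]splitr.
rewrite (le_trans (ler_normD _ _))// lerD//.
  by rewrite -norming_functionalB// (le_trans (nl.2 _)).
rewrite bochner_simple_integral_functional// -RintegralB//.
have id : mu.-integrable [set: T] (EFin \o (fun x => l (s_ n x) - h x)).
  exact: (integrableB measurableT il ih).
rewrite (le_trans (le_normr_Rintegral _ id))//.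
move: H3; rewrite sub0r normrN; apply: le_trans.
rewrite ger0_norm ?fine_ge0 ?integral_ge0//; apply: fine_le => //.
  by have /integrable_fin_num := integrable_norm id; exact.
apply: le_integral_ae.
- by move=> x; rewrite lee_fin.
- by move=> x; rewrite lee_fin.
- apply: filterS lfh => x <-; rewrite lee_fin -norming_functionalB//.
  exact: nl.2.
Unshelve. all: by end_near. Qed.

(** Tested on a norming functional, this is an estimate of real integrals,
    which takes the place of a common refinement of the two simple functions. *)
Lemma bochner_simple_integral_dist s s' (A : set T) e : norming V ->
  bochner_simple s -> bochner_simple s' -> 0 <= e ->
  (\forall x \ae mu, A x) -> (forall x, A x -> `|s x - s' x| <= e) ->
  `|bochner_simple_integral mu s - bochner_simple_integral mu s'| <=
    e * fine (mu [set: T]).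
Proof.
move=> NV ss ss' e0 aeA sA; rewrite leNgt; apply/negP => lt.
have /NV[l nl] : (e * fine (mu [set: T]) + `|bochner_simple_integral mu s -
  bochner_simple_integral mu s'|) / 2 <
  `|bochner_simple_integral mu s - bochner_simple_integral mu s'| by lra.
apply/negP; rewrite -ltNge; apply: (@le_lt_trans _ _ (e * fine (mu [set: T]))); last by lra.
rewrite norming_functionalB// !bochner_simple_integral_functional//.
have il := bochner_simple_integrable l ss; have il' := bochner_simple_integrable l ss'.
rewrite -RintegralB// (le_trans (ler_norm _))//; apply: norm_Rintegral_le => //.
- by rewrite -ge0_fin_numE// fin_num_measure.
- apply: measurable_funB; exact: bochner_simple_comp.
- apply: filterS aeA => x Ax _; rewrite -norming_functionalB//.
  exact: le_trans (nl.2 _) (sA _ Ax).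
Qed.

Lemma bochner_integral_exists f (s_ : nat -> T -> V) (A : set T) :
  norming V -> cauchy_complete V -> (forall n, bochner_simple (s_ n)) ->
  (\forall x \ae mu, A x) ->
  (forall e, 0 < e -> exists N, forall n, (N <= n)%N ->
     forall x, A x -> `|s_ n x - f x| <= e) ->
  exists I, is_bochner_integral mu f I.
Proof.
move=> NV CV ss aeA unif; pose m := fine (mu [set: T]).
have m0 : 0 <= m by exact: fine_ge0.
have scale e : 0 < e -> exists2 e', 0 < e' & e' * m <= e.
  move=> e0; exists (e / (m + 1)); first by rewrite divr_gt0// ltr_wpDl.
  by rewrite mulrAC ler_pdivrMr ?ltr_wpDl// ler_wpM2l ?lerDl// ltW.
have [|I SI] := CV (fun n => bochner_simple_integral mu (s_ n)).
  move=> e /scale[e' e'0 em]; have e'20 : 0 < e' / 2 by rewrite divr_gt0.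
  have [N HN] := unif _ e'20; exists N => p q Np Nq.
  rewrite (le_trans _ em)//; apply: (bochner_simple_integral_dist NV (A := A)) => //.
    exact: ltW.
  move=> x Ax; rewrite -(subrKA (f x)) (le_trans (ler_normD _ _))//.
  by rewrite [e']splitr lerD ?HN// distrC HN.
exists I, s_; split => //.
  apply: filterS aeA => x Ax; apply/cvgrPdist_le => e /unif[N HN].
  by exists N => // n /= Nn; rewrite distrC HN.
have small e : 0 < e -> exists N, forall n, (N <= n)%N ->
    (\int[mu]_x `|s_ n x - f x|%:E <= e%:E)%E.
  move=> /scale[e' e'0 em]; have [N HN] := unif _ e'0; exists N => n Nn.
  apply: (@le_trans _ _ (\int[mu]_x (cst e'%:E) x)%E).
    apply: le_integral_ae.
    - by move=> x; rewrite lee_fin.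
    - by move=> x; rewrite lee_fin ltW.
    - by apply: filterS aeA => x Ax; rewrite lee_fin HN.
  rewrite integral_cst// -[X in (_ * X)%E]fineK ?fin_num_measure//.
have ge0 n : (0 <= \int[mu]_x `|s_ n x - f x|%:E)%E.
  by apply: integral_ge0 => x _; rewrite lee_fin.
have fin_int : \forall n \near \oo, (\int[mu]_x `|s_ n x - f x|%:E)%E \is a fin_num.
  have [N HN] := small 1 ltr01; exists N => // n /= /HN H.
  by rewrite ge0_fin_numE// (le_lt_trans H)// ltry.
apply/fine_cvgP; split => //; apply/cvgrPdist_le => e /small[N HN].
near=> n; rewrite sub0r normrN ger0_norm ?fine_ge0//.
rewrite -lee_fin fineK; last by near: n.
by apply: HN; near: n; exists N.
Unshelve. all: by end_near. Qed.

End bochner_theory.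

Section leb_itv_theory.
Context (R : realType).
Implicit Types (a b x T : R).
Local Notation mu := (@lebesgue_measure R).

Lemma ae_leb_itv a b (P : R -> Prop) : (forall x, a <= x <= b -> P x) ->
  \forall x \ae leb_itv a b, P x.
Proof.
move=> HP; exists (~` `[a, b]); split.
- by apply: measurableC; exact: measurable_itv.
- by rewrite -[LHS]/(mu (~` `[a, b] `&` `[a, b])) setICl measure0.
- by move=> x /= nPx; rewrite in_itv/= => /HP.
Qed.

Lemma ae_lebesgue_of_leb_itv a b (P : R -> Prop) : (\forall x \ae leb_itv a b, P x) ->
  \forall x \ae mu, a <= x <= b -> P x.
Proof.
move=> [N [mN muN PN]]; exists (N `&` `[a, b]); split.
- by apply: measurableI => //; exact: measurable_itv.
- exact: muN.
- move=> x /= /not_implyP[xab nPx]; split; last by rewrite /= in_itv.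
  exact: PN.
Qed.

Lemma continuous_itv_bounded (V : normedModType R) (f : R -> V) a b : continuous f ->
  exists2 C, 0 <= C & forall x, a <= x <= b -> `|f x| <= C.
Proof.
move=> cf; have [ab|ba] := leP a b; last first.
  by exists 0 => // x /andP[ax xb]; have := le_lt_trans (le_trans ax xb) ba; rewrite ltxx.
have cn : {within `[a, b], continuous (fun x => `|f x|)}.
  by apply: continuous_subspaceT => x; apply: cvg_norm; exact: cf.
have [c _ Hc] := EVT_max ab cn; exists `|f c|.
  by [].
by move=> x xab; apply: Hc; rewrite in_itv.
Qed.

Lemma leb_itv_setT_fin a b : (leb_itv a b [set: R] < +oo)%E.
Proof. by rewrite -ge0_fin_numE// fin_num_measure. Qed.

Lemma leb_itv_integrable (f : R -> R) a b : continuous f ->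
  (leb_itv a b).-integrable [set: R] (EFin \o f).
Proof.
move=> cf; have [C C0 HC] := continuous_itv_bounded a b cf.
apply: (ae_bounded_integrable measurableT (leb_itv_setT_fin a b) (C := C)).
  exact: continuous_measurable_fun.
by apply: ae_leb_itv => x /HC.
Qed.

Lemma leb_itv_Rintegral (f : R -> R) a b : continuous f ->
  \int[leb_itv a b]_x f x = \int[mu]_(x in `[a, b]) f x.
Proof.
move=> cf; have mI : measurable (`[a, b] : set R) by exact: measurable_itv.
congr fine.
rewrite (@negligible_integral _ _ _ (leb_itv a b) setT (~` `[a, b]))//.
- by rewrite setDE setCK setTI; apply: eq_measure_integral => A mA Aab;
    rewrite -[LHS]/(mu (A `&` `[a, b])) setIidl.
- exact: measurableC.
- exact: leb_itv_integrable.
- by rewrite -[LHS]/(mu (~` `[a, b] `&` `[a, b])) setICl measure0.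
Qed.

#[global] Instance ae_leb_itv_filter a b : Filter (almost_everywhere (leb_itv a b)).
Proof. exact: (@ae_filter_ringOfSetsType _ (measurableTypeR R) R (leb_itv a b)). Qed.

End leb_itv_theory.

Section step_approximation.
Context (R : realType) (V : normedModType R).
Variables (T : R) (f : R -> V).
Hypothesis cf : continuous f.
Implicit Types (x y e : R) (n k : nat).

Lemma itv_uniformly_continuous e : 0 < e -> exists2 d, 0 < d &
  forall x y, 0 <= x <= T -> `|x - y| < d -> `|f x - f y| <= e.
Proof.
move=> e0; pose P (d x : R) := forall y, `|x - y| < d -> `|f x - f y| <= e.
have H : \forall d \near (0 : R)^'+, `[0, T]%classic `<=` P d.
  have /compact_near_coveringP := @segment_compact R 0 T; apply.
  move=> x _; have e20 : 0 < e / 2 by rewrite divr_gt0.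
  have /cvgrPdist_le/(_ _ e20)/nbhs_ballP[r /= r0 Hr] := @cf x.
  have r20 : 0 < r / 2 by rewrite divr_gt0.
  exists (ball x (r / 2), [set d | d < r / 2]) => /=.
    split; first exact: nbhsx_ballx.
    exact: nbhs_right_lt.
  move=> [y d] /= [xy dr] z yz.
  have Hy : `|f x - f y| <= e / 2.
    by apply: Hr; rewrite /ball/= (lt_trans xy)// ltr_pdivrMr// ltr_pMr// ltr1n.
  have Hz : `|f x - f z| <= e / 2.
    apply: Hr; rewrite /ball/= -(subrKA y) (le_lt_trans (ler_normD _ _))//.
    by rewrite [r]splitr ltrD// (lt_trans yz).
  rewrite -(subrKA (f x)) (le_trans (ler_normD _ _))// [e]splitr lerD//.
  by rewrite distrC.
near (0 : R)^'+ => d; exists d; first by near: d; exact: nbhs_right_gt.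
have Hd : `[0, T]%classic `<=` P d by near: d; exact: H.
by move=> x y xT; apply: Hd; rewrite /= in_itv.
Unshelve. all: by end_near. Qed.

(** [0] is the code of the times outside [0, T], and [k.+1] that of the cell
    [[k / n.+1, k.+1 / n.+1[]. *)
Definition grid_index n x : nat :=
  if 0 <= x <= T then (Num.truncn (x * n.+1%:R)).+1 else 0%N.

Definition grid_value n k : V := if k is k'.+1 then f (k'%:R / n.+1%:R) else 0.

Definition grid_step n x : V := grid_value n (grid_index n x).

Lemma grid_step_simple n : bochner_simple (grid_step n : measurableTypeR R -> V).
Proof.
split.
  pose N := (Num.truncn (T * n.+1%:R)).+2.
  apply: (@sub_finite_set _ _ (grid_value n @` `I_N)); last first.
    exact: finite_image (finite_II N).
  move=> v [x _ <-]; exists (grid_index n x) => //=.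
  rewrite /grid_index; case: ifPn => // /andP[x0 xT]; rewrite !ltnS.
  by apply: le_truncn; rewrite ler_wpM2r.
move=> v; rewrite /grid_step.
have -> : (fun x => grid_value n (grid_index n x)) @^-1` [set v] =
    \bigcup_(k in [set k | grid_value n k = v]) (grid_index n @^-1` [set k]).
  apply/seteqP; split=> [x /= xv|x [k /= kv xk]]; last by rewrite xk.
  by exists (grid_index n x).
apply: bigcup_measurable => k _.
have mI : measurable (`[0, T] : set R) by exact: measurable_itv.
case: k => [|k].
  have -> : grid_index n @^-1` [set 0%N] = ~` `[0, T].
    apply/seteqP; split=> x /=; rewrite /grid_index in_itv/=; case: ifPn => //.
  exact: measurableC.
have -> : grid_index n @^-1` [set k.+1] =
    `[0, T] `&` `[k%:R / n.+1%:R, k.+1%:R / n.+1%:R[.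
  apply/seteqP; split=> x /=; rewrite /grid_index !in_itv/=.
    case: ifPn => // /andP[x0 xT] [xk]; split=> //.
    rewrite ler_pdivrMr// ltr_pdivlMr//.
    by have := truncn_itv (mulr_ge0 x0 (ler0n R n.+1)); rewrite xk.
  move=> [xT]; rewrite xT ler_pdivrMr// ltr_pdivlMr// => xk.
  by congr S; exact: truncn_def.
by apply: measurableI => //; exact: measurable_itv.
Qed.

Lemma grid_step_uniform e : 0 < e -> exists N, forall n, (N <= n)%N ->
  forall x, 0 <= x <= T -> `|grid_step n x - f x| <= e.
Proof.
move=> /itv_uniformly_continuous[d d0 Hd].
have d20 : 0 < d / 2 by rewrite divr_gt0.
have [N HN] := mesh_small d20; exists N => n /HN Hn x xT.
rewrite /grid_step /grid_index xT /= distrC; apply: Hd => //.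
have x0 : 0 <= x by case/andP: xT.
have /andP[kx xk] := truncn_itv (mulr_ge0 x0 (ler0n R n.+1)).
have kx' : (Num.truncn (x * n.+1%:R))%:R / n.+1%:R <= x by rewrite ler_pdivrMr.
rewrite ger0_norm ?subr_ge0//; apply: (@le_lt_trans _ _ (mesh R n)).
  by rewrite lerBlDl /mesh -[X in _ + X]mul1r -mulrDl natr1 ler_pdivlMr// ltW.
by rewrite (le_lt_trans Hn)// ltr_pdivrMr// ltr_pMr// ltr1n.
Qed.

End step_approximation.

(** * Weak derivatives of vector-valued functions *)

Section weak_derivative_vector.
Context (R : realType) (V : normedModType R).
Implicit Types (T s t x e : R) (u v w : R -> V) (l : V -> R).
Local Notation mu := (@lebesgue_measure R).

Lemma norming_functional_comp l u : norming_functional l -> continuous u ->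
  continuous (fun t => l (u t)).
Proof.
move=> nl cu t; apply/cvgrPdist_le => e e0.
have /cvgrPdist_le/(_ _ e0) := cu t; apply: filterS => s.
by rewrite -norming_functionalB//; apply: le_trans; exact: nl.2.
Qed.

Lemma norming_eq0 (v : V) : norming V ->
  (forall l, norming_functional l -> l v = 0) -> v = 0.
Proof.
move=> NV lv; apply/eqP; rewrite -normr_eq0 -[_ == 0]negbK; apply/negP.
rewrite -normr_gt0 normr_id => v0.
have /NV[l nl] : `|v| / 2 < `|v| by rewrite ltr_pdivrMr// ltr_pMr// ltr1n.
rewrite (lv _ nl) => H; have := lt_le_trans (divr_gt0 v0 (ltr0n R 2)) H.
by rewrite ltxx.
Qed.

Lemma norming_le (v : V) c : norming V -> 0 <= c ->
  (forall l, norming_functional l -> l v <= c) -> `|v| <= c.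
Proof.
move=> NV c0 lv; rewrite leNgt; apply/negP => cv.
have /NV[l nl] : (c + `|v|) / 2 < `|v| by lra.
by have := lv _ nl; lra.
Qed.

Lemma bochner_Linf_continuous T u : continuous u -> bochner_Linf (leb_itv 0 T) u.
Proof.
move=> cu; split.
  exists (grid_step T u); split; first exact: grid_step_simple.
  apply: ae_leb_itv => x xT; apply/cvgrPdist_le => e e0.
  have [N HN] := grid_step_uniform T cu e0.
  by exists N => // n /= Nn; rewrite distrC HN.
have [C C0 HC] := continuous_itv_bounded 0 T cu.
apply: (@le_lt_trans _ _ C%:E); last exact: ltry.
by apply/ess_supP; apply: ae_leb_itv => x xT; rewrite lee_fin HC.
Qed.

Lemma bochner_integral_continuous T u : norming V -> cauchy_complete V -> continuous u ->
  exists I, is_bochner_integral (leb_itv 0 T) u I.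
Proof.
move=> NV CV cu.
apply: (@bochner_integral_exists _ (measurableTypeR R) R (leb_itv 0 T) V u
  (grid_step T u) [set x | 0 <= x <= T]) => //.
- exact: grid_step_simple.
- exact: ae_leb_itv.
- by move=> e /(grid_step_uniform T cu).
Qed.

Lemma leb_itv_bochner_functional T u I l (h : R -> R) :
  is_bochner_integral (leb_itv 0 T) u I -> norming_functional l -> continuous h ->
  (\forall t \ae leb_itv 0 T, l (u t) = h t) -> l I = \int[mu]_(t in `[0, T]) h t.
Proof.
move=> uI nl ch luh; rewrite -leb_itv_Rintegral//.
apply: (@bochner_integral_functional _ (measurableTypeR R) R (leb_itv 0 T) V u I l h) => //.
exact: leb_itv_integrable.
Qed.

(** Both Bochner integrals exist, their integrands being continuous. That they
    are opposite is integration by parts, once they are tested on norming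
    functionals. *)
Lemma in_W1inf_C1 T u v C : norming V -> cauchy_complete V -> 0 <= T ->
  (forall s t, `|u t - u s - (t - s) *: v s| <= C * (t - s) ^+ 2) -> continuous v ->
  in_W1inf T u v.
Proof.
move=> NV CV T0 uv cv.
have duv t : is_derive t (1 : R) u (v t).
  by apply: (@is_derive_taylor _ _ _ _ _ C) => s; exact: uv.
have cu : continuous u.
  by move=> t; apply/differentiable_continuous/derivable1_diffP; have [] := duv t.
split; [exact: bochner_Linf_continuous | exact: bochner_Linf_continuous |].
move=> phi tphi.
have c0 : continuous phi := test_function_continuous (n := 0) tphi.
have c1 : continuous (derive1 phi) := test_function_continuous (n := 1) tphi.
have cZ (g : R -> R) (h : R -> V) : continuous g -> continuous h ->
    continuous (fun t => g t *: h t).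
  by move=> cg ch t; apply: cvgZ; [exact: cg | exact: ch].
have [I1 HI1] := bochner_integral_continuous T NV CV (cZ _ _ c1 cu).
have [I2 HI2] := bochner_integral_continuous T NV CV (cZ _ _ c0 cv).
exists I1; split => //; suff -> : - I1 = I2 by [].
apply/eqP; rewrite eq_sym -subr_eq0 opprK; apply/eqP; apply: norming_eq0 => // l nl.
have lu := norming_functional_comp nl cu; have lv := norming_functional_comp nl cv.
have cM (g h : R -> R) : continuous g -> continuous h -> continuous (fun t => g t * h t).
  by move=> cg ch t; apply: cvgM; [exact: cg | exact: ch].
rewrite norming_functionalD// addrC.
rewrite (leb_itv_bochner_functional HI1 nl (cM _ _ c1 lu)); last first.
  by apply: nearW => x; rewrite norming_functionalZ.
rewrite (leb_itv_bochner_functional HI2 nl (cM _ _ c0 lv)); last first.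
  by apply: nearW => x; rewrite norming_functionalZ.
apply: (test_function_by_parts T0 tphi (F := fun t => l (u t))) => // x.
apply: (@is_derive_taylor _ R^o _ _ _ C) => s.
have -> : l (u s) - l (u x) - (s - x) *: (l (v x) : R^o) = l (u s - u x - (s - x) *: v x).
  by rewrite !(norming_functionalB _ _ nl) (norming_functionalZ _ _ nl).
exact: le_trans (nl.2 _) (uv _ _).
Qed.

(** Tested on a norming functional, this is [weak_derivative_real]. The
    hypothesis that a continuous [w'] represents the weak derivative is what
    the equations provide. *)
Lemma weak_derivative_strong T u v w w' : norming V -> 0 <= T ->
  is_weak_derivative T u v -> continuous w -> continuous w' ->
  (forall x, x <= 0 -> w' x = w' 0) ->
  (\forall t \ae leb_itv 0 T, w t = u t) -> (\forall t \ae leb_itv 0 T, w' t = v t) ->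
  forall s t K, 0 <= s <= t -> t <= T ->
    (forall r, s <= r <= t -> `|w' r - w' t| <= K) ->
    `|w t - w s - (t - s) *: w' t| <= K * (t - s).
Proof.
move=> NV T0 uv cw cw' w'0 wu w'v s t K st tT HK.
have K0 : 0 <= K by case/andP: st => s0 st; apply: le_trans (HK t _); rewrite // st lexx.
have tsK : 0 <= K * (t - s) by rewrite mulr_ge0// subr_ge0; case/andP: st.
apply: norming_le => // l nl.
rewrite !(norming_functionalB _ _ nl) (norming_functionalZ _ _ nl).
have lw := norming_functional_comp nl cw; have lw' := norming_functional_comp nl cw'.
apply: le_trans (ler_norm _) _.
apply: (weak_derivative_real T0 (U := fun t => l (w t)) (V := fun t => l (w' t)))
  st tT _ => //.
- by move=> x /w'0 ->.
- move=> phi tphi; have [I [HI1 HI2]] := uv phi tphi.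
  have c0 : continuous phi := test_function_continuous (n := 0) tphi.
  have c1 : continuous (derive1 phi) := test_function_continuous (n := 1) tphi.
  have cM (g h : R -> R) : continuous g -> continuous h -> continuous (fun t => g t * h t).
    by move=> cg ch y; apply: cvgM; [exact: cg | exact: ch].
  rewrite -(leb_itv_bochner_functional HI1 nl (cM _ _ c1 lw)); last first.
    by move: wu; apply: filterS => x ->; rewrite norming_functionalZ.
  rewrite -(leb_itv_bochner_functional HI2 nl (cM _ _ c0 lw')); last first.
    by move: w'v; apply: filterS => x ->; rewrite norming_functionalZ.
  by rewrite -norming_functionalD// subrr norming_functional0.
- move=> r /HK; rewrite -norming_functionalB//; apply: le_trans; exact: nl.2.
Qed.

End weak_derivative_vector.

(** * The operators of the system *)

Section clip.
Context (R : realType).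
Implicit Types (A x y : R).

Definition clip A x : R := Num.max (- A) (Num.min x A).

Lemma clip_bound A x : 0 <= A -> `|clip A x| <= A.
Proof.
move=> A0; rewrite ler_norml /clip le_max lexx /= ge_max ge_min lexx orbT andbT.
by rewrite (le_trans _ A0)// oppr_le0.
Qed.

Lemma clip_id A x : `|x| <= A -> clip A x = x.
Proof.
by rewrite ler_norml /clip => /andP[Ax xA]; rewrite (min_idPl xA) (max_idPr Ax).
Qed.

Lemma clip_lip A x y : `|clip A x - clip A y| <= `|x - y|.
Proof.
have h1 : x - y <= `|x - y| := ler_norm _.
have h2 : y - x <= `|x - y| by rewrite distrC ler_norm.
have h3 : 0 <= `|x - y| by [].
move: `|x - y| h1 h2 h3 => d h1 h2 h3; rewrite ler_norml /clip.
case: (leP x A) => xA; case: (leP y A) => yA.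
- by case: (leP (- A) x); case: (leP (- A) y) => *; apply/andP; split; lra.
- by case: (leP (- A) x); case: (leP (- A) A) => *; apply/andP; split; lra.
- by case: (leP (- A) A); case: (leP (- A) y) => *; apply/andP; split; lra.
- by rewrite subrr; apply/andP; split; lra.
Qed.

Lemma lipschitz_continuous (f : R -> R) L : (forall x y, `|f x - f y| <= L * `|x - y|) ->
  continuous f.
Proof.
move=> fL x; apply/cvgrPdist_le => e e0.
have L1 : 0 < `|L| + 1 by rewrite ltr_pwDr.
apply/nbhs_ballP; exists (e / (`|L| + 1)) => [|y]; first by rewrite /= divr_gt0.
rewrite /ball/= ltr_pdivlMr// => /ltW xy.
rewrite (le_trans (fL x y))// (le_trans _ xy)// mulrC ler_wpM2l//.
by rewrite (le_trans (ler_norm L))// lerDl.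
Qed.

Lemma measurable_clip A : measurable_fun [set: R] (clip A).
Proof.
apply: continuous_measurable_fun; apply: (lipschitz_continuous (L := 1)) => x y.
by rewrite mul1r clip_lip.
Qed.

End clip.

Section bounded_data.
Context (R : realType).
Implicit Types (x y : R).

Lemma bounded_fun_bound (T : Type) (f : T -> R) : bounded_fun f ->
  exists2 M, 0 <= M & forall x : T, `|f x| <= M.
Proof.
move=> /pinfty_ex_gt0[M M0 fM]; exists M; first exact: ltW.
by move=> x; exact: fM.
Qed.

Lemma mean_value_lipschitz (f df : R -> R) L :
  (forall x, is_derive x (1 : R) f (df x)) -> (forall x, `|df x| <= L) ->
  forall x y, `|f x - f y| <= L * `|x - y|.
Proof.
move=> fdf dfL x y; wlog yx : x y / y <= x.
  move=> H; have [/H//|/ltW/H] := leP y x.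
  by rewrite distrC (distrC y).
have [|z _ ->] := MVT_segment yx (fun z _ => fdf z).
  by apply: continuous_subspaceT; exact: is_derive_continuous fdf.
by rewrite normrM ler_wpM2r.
Qed.

Lemma C1b_bounded_lipschitz (f : R -> R) : C1b f -> exists M L,
  [/\ 0 <= M, 0 <= L, forall x, `|f x| <= M & forall x y, `|f x - f y| <= L * `|x - y|].
Proof.
move=> [df _ /bounded_fun_bound[M M0 fM] /bounded_fun_bound[L L0 dfL]].
exists M, L; split => //; apply: mean_value_lipschitz dfL => x.
by apply: DeriveDef; [exact: df | rewrite derive1E].
Qed.

(** One coordinate is moved at a time, so that only the bounds on the two
    partial derivatives enter. *)
Lemma C1b2_bounded_lipschitz (H : R * R -> R) : C1b2 H -> exists M L,
  [/\ 0 <= M, 0 <= L, forall p, `|H p| <= M &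
      forall p q, `|H p - H q| <= L * (`|p.1 - q.1| + `|p.2 - q.2|)].
Proof.
move=> [/bounded_fun_bound[M M0 HM] dH].
have [d1 _ /bounded_fun_bound[L1 L10 HL1]] := dH (1, 0) (or_introl erefl).
have [d2 _ /bounded_fun_bound[L2 L20 HL2]] := dH (0, 1) (or_intror erefl).
have lip1 y x x' : `|H (x, y) - H (x', y)| <= L1 * `|x - x'|.
  apply: (@mean_value_lipschitz (fun x => H (x, y)) (fun x => 'D_(1, 0) H (x, y))) => //.
  move=> z; have := d1 (z, y).
  have E : (fun h : R => h^-1 *: (H (h *: (1, 0) + (z, y)) - H (z, y))) =
           (fun h : R => h^-1 *: (H (h *: (1 : R) + z, y) - H (z, y))).
    apply/funext => h; congr (_ *: (H _ - _)).
    by congr pair; rewrite /= /GRing.scale/= mulr0 add0r.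
  rewrite /derivable /derive E => dz.
  by apply: DeriveDef.
have lip2 x y y' : `|H (x, y) - H (x, y')| <= L2 * `|y - y'|.
  apply: (@mean_value_lipschitz (fun y => H (x, y)) (fun y => 'D_(0, 1) H (x, y))) => //.
  move=> z; have := d2 (x, z).
  have E : (fun h : R => h^-1 *: (H (h *: (0, 1) + (x, z)) - H (x, z))) =
           (fun h : R => h^-1 *: (H (x, h *: (1 : R) + z) - H (x, z))).
    apply/funext => h; congr (_ *: (H _ - _)).
    by congr pair; rewrite /= /GRing.scale/= mulr0 add0r.
  rewrite /derivable /derive E => dz.
  by apply: DeriveDef.
exists M, (L1 + L2); split => //; first exact: addr_ge0.
move=> [p1 p2] [q1 q2] /=; rewrite -(subrKA (H (q1, p2))).
rewrite (le_trans (ler_normD _ _))// mulrDr lerD//.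
  by rewrite (le_trans (lip1 _ _ _))// ler_wpM2r// lerDl.
by rewrite (le_trans (lip2 _ _ _))// ler_wpM2r// lerDr.
Qed.

(** Measurability is meant for the product sigma-algebra. With its first
    argument rounded down to a grid, [H] depends on the second argument only on
    each of countably many strips; [H] is the limit of these functions. *)
Lemma lipschitz2_measurable (H : R * R -> R) L :
  (forall p q, `|H p - H q| <= L * (`|p.1 - q.1| + `|p.2 - q.2|)) ->
  measurable_fun [set: measurableTypeR R * measurableTypeR R] H.
Proof.
move=> HL.
pose fl n (x : R) : R := (Num.floor (x * n.+1%:R))%:~R / n.+1%:R.
apply: (@measurable_fun_cvg _ _ _ _ (fun n (p : measurableTypeR R * measurableTypeR R) =>
   H (fl n p.1, p.2))).
  move=> n _ B mB; rewrite setTI.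
  have -> : (fun p : measurableTypeR R * measurableTypeR R => H (fl n p.1, p.2)) @^-1` B =
      \bigcup_(k in [set: int]) (`[k%:~R / n.+1%:R, (k + 1)%:~R / n.+1%:R[ `*`
        ((fun y => H (k%:~R / n.+1%:R, y)) @^-1` B)).
    apply/seteqP; split=> [[x y] /= HB|[x y] [k _] /= []]; rewrite ?in_itv/=.
      exists (Num.floor (x * n.+1%:R)) => //; split => //=.
      by rewrite in_itv/= ler_pdivrMr// ltr_pdivlMr// floor_itv.
    rewrite ler_pdivrMr// ltr_pdivlMr// /fl => /floor_def -> //.
  apply: countable_bigcupT_measurable => [|k]; first exact: countableP.
  apply: measurableX; first exact: measurable_itv.
  have mk : measurable_fun [set: R] (fun y => H (k%:~R / n.+1%:R, y)).
    apply: continuous_measurable_fun; apply: (lipschitz_continuous (L := L)) => x y.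
    by rewrite (le_trans (HL _ _))//= subrr normr0 add0r.
  by rewrite -[X in measurable X]setTI; exact: mk.
move=> [x y] _ /=; apply/cvgrPdist_le => e e0.
have L1 : 0 < `|L| + 1 by rewrite ltr_pwDr.
have [N HN] := mesh_small (divr_gt0 e0 L1).
exists N => // n /= /HN Hn; rewrite (le_trans (HL _ _))//= subrr normr0 addr0.
have Lx : L * `|x - fl n x| <= (`|L| + 1) * `|x - fl n x|.
  by rewrite ler_wpM2r// (le_trans (ler_norm L))// lerDl.
rewrite (le_trans Lx)// mulrC -ler_pdivlMr// (le_trans _ Hn)//.
have /andP[f1 f2] := floor_itv (x * n.+1%:R).
rewrite /fl ger0_norm; last by rewrite subr_ge0 ler_pdivrMr.
rewrite /mesh lerBlDl -[X in _ + X]mul1r -mulrDl ler_pdivlMr// ltW//.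
by move: f2; rewrite intrD.
Qed.

End bounded_data.

Section product_null_sets.
Context d1 d2 (T1 : measurableType d1) (T2 : measurableType d2) (R : realType).
Variables (m1 : {finite_measure set T1 -> \bar R}) (m2 : {finite_measure set T2 -> \bar R}).
Local Notation m := ((m1 \x m2)%E : {measure set (T1 * T2) -> \bar R}).

Lemma ae_product_fst (P : T1 -> Prop) : (\forall x \ae m1, P x) ->
  \forall z \ae m, P z.1.
Proof.
move=> [N [mN N0 PN]]; exists (N `*` setT); split.
- exact: measurableX.
- apply: (eq_trans (product_measure1E m1 m2 mN measurableT)).
  exact: (eq_trans (congr1 (fun z => z * m2 [set: T2])%E N0) (mul0e _)).
- by move=> [x y] /= nP; split => //; exact: PN.
Qed.

Lemma ae_product_snd (P : T2 -> Prop) : (\forall y \ae m2, P y) ->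
  \forall z \ae m, P z.2.
Proof.
move=> [N [mN N0 PN]]; exists (setT `*` N); split.
- exact: measurableX.
- apply: (eq_trans (product_measure1E m1 m2 measurableT mN)).
  exact: (eq_trans (congr1 (fun z => m1 [set: T1] * z)%E N0) (mule0 _)).
- by move=> [x y] /= nP; split => //; exact: PN.
Qed.

(** Tonelli's theorem for null sets. An estimate of [a] almost everywhere on
    the square can then be used inside the integral over [y], for almost every
    [x]. *)
Lemma ae_product_section (P : T1 * T2 -> Prop) : (\forall z \ae m, P z) ->
  \forall x \ae m1, \forall y \ae m2, P (x, y).
Proof.
move=> [N [mN N0 PN]].
have mf : measurable_fun setT (m2 \o xsection N) := measurable_fun_xsection m2 mN.
have : ae_eq m1 setT (m2 \o xsection N) (cst 0%E).
  apply/(ae_eq_integral_abs m1 measurableT mf); rewrite -N0.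
  by apply: eq_integral => x _; rewrite gee0_abs.
apply: filterS => x /(_ I) Nx0; exists (xsection N x); split => //.
- exact: measurable_xsection.
- by move=> y /= nP; rewrite /xsection /= inE; exact: PN.
Qed.

Lemma product_setT_fin : (m [set: T1 * T2] < +oo)%E.
Proof.
by rewrite -setXTT /= product_measure1E// lte_mul_pinfty// ?ge0_fin_numE//
  -ge0_fin_numE// fin_num_measure.
Qed.

Lemma measurable_Rintegral_section (f : T1 * T2 -> R) C :
  measurable_fun [set: T1 * T2] f -> (forall z, `|f z| <= C) ->
  measurable_fun [set: T1] (fun x => \int[m2]_y f (x, y)).
Proof.
move=> mf fC.
have fi : m.-integrable [set: T1 * T2] (EFin \o f).
  apply: (ae_bounded_integrable measurableT product_setT_fin (C := C)) => //.
  by apply: nearW => z _; exact: fC.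
have := measurable_fubini_F fi; rewrite /fubini_F => mF.
by apply: (measurableT_comp (f := fine)).
Qed.

End product_null_sets.

Lemma ae_dist d (T : measurableType d) (R : realType)
    (mu : {measure set T -> \bar R}) (u v : Linf mu) :
  \forall z \ae mu, `|u z - v z| <= `|u - v|.
Proof. by apply: filterS2 (Linf_aeB u v) (Linf_ae_le (u - v)) => z <-. Qed.

Section operators.
Context (R : realType) (Gamma : R -> R) (H : R * R -> R).
Variables (A G0 LG H0 LH : R).
Hypotheses (A_ge0 : 0 <= A) (G0_ge0 : 0 <= G0) (LG_ge0 : 0 <= LG)
  (H0_ge0 : 0 <= H0) (LH_ge0 : 0 <= LH).
Hypothesis Gamma_bnd : forall x, `|Gamma x| <= G0.
Hypothesis Gamma_lip : forall x y, `|Gamma x - Gamma y| <= LG * `|x - y|.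
Hypothesis H_bnd : forall p, `|H p| <= H0.
Hypothesis H_lip : forall p q, `|H p - H q| <= LH * (`|p.1 - q.1| + `|p.2 - q.2|).
Implicit Types (theta : Xtheta R) (a : Xa R) (x y : R).

Local Notation T1 := (measurableTypeR R).
Local Notation T2 := (measurableTypeR R * measurableTypeR R)%type.

Lemma mu1_setT : mu1 R [set: T1] = 1%E.
Proof.
transitivity (@lebesgue_measure R ([set: R] `&` `[0, 1])); first by [].
by rewrite setTI lebesgue_measure_itv/= lte_fin ltr01 oppr0 adde0.
Qed.

Lemma mu1_fin : (mu1 R [set: T1] < +oo)%E. Proof. by rewrite mu1_setT ltry. Qed.

Lemma mu2_fin : (mu2 R [set: T2] < +oo)%E.
Proof. exact: (@product_setT_fin _ _ T1 T1 R (mu1 R) (mu1 R)). Qed.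

Lemma mu1_Rintegral_le (f : R -> R) C : measurable_fun [set: T1] f -> 0 <= C ->
  (\forall y \ae mu1 R, `|f y| <= C) -> `|\int[mu1 R]_y f y| <= C.
Proof.
move=> mf C0 fC; rewrite -[leRHS]mulr1 -(congr1 fine mu1_setT : fine (mu1 R _) = 1).
apply: (@norm_Rintegral_le _ T1 R (mu1 R) setT measurableT mu1_fin) => //.
by apply: filterS fC.
Qed.

Lemma Gamma_measurable : measurable_fun [set: R] Gamma.
Proof. by apply: continuous_measurable_fun; exact: lipschitz_continuous Gamma_lip. Qed.

Lemma theta_fst_measurable theta : measurable_fun [set: T2] (fun z => theta z.1).
Proof. by apply: (measurableT_comp (Linf_measurable theta)); exact: measurable_fst. Qed.

Lemma theta_snd_measurable theta : measurable_fun [set: T2] (fun z => theta z.2).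
Proof. by apply: (measurableT_comp (Linf_measurable theta)); exact: measurable_snd. Qed.

Definition kernel theta a (z : T2) : R :=
  clip A (a z) * Gamma (theta z.2 - theta z.1).

Lemma kernel_measurable theta a : measurable_fun [set: T2] (kernel theta a).
Proof.
apply: measurable_funM.
  exact: (measurableT_comp (@measurable_clip R A) (Linf_measurable a)).
apply: (measurableT_comp Gamma_measurable); apply: measurable_funB.
  exact: theta_snd_measurable.
exact: theta_fst_measurable.
Qed.

Lemma kernel_section_measurable theta a x :
  measurable_fun [set: T1] (fun y => kernel theta a (x, y)).
Proof. exact: (measurableT_comp (kernel_measurable theta a) (pair1_measurable x)). Qed.

Lemma kernel_bound theta a z : `|kernel theta a z| <= A * G0.
Proof. by rewrite normrM ler_pM// clip_bound. Qed.

Lemma drift_exists theta a : exists f : Xtheta R, \forall x \ae mu1 R,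
  f x = \int[mu1 R]_y (kernel theta a (x, y)).
Proof.
apply: (Linf_build (C := A * G0)).
  exact: (@measurable_Rintegral_section _ _ T1 T1 R (mu1 R) (mu1 R) _ (A * G0)
    (kernel_measurable theta a) (kernel_bound theta a)).
apply: nearW => x; apply: mu1_Rintegral_le.
- exact: kernel_section_measurable.
- exact: mulr_ge0.
- by apply: nearW => y; exact: kernel_bound.
Qed.

(** The integral term of the slow equation, with [a] truncated at level [A], as
    a map into [L^oo]. *)
Definition drift theta a : Xtheta R := sval (cid (drift_exists theta a)).

Lemma drift_ae theta a : \forall x \ae mu1 R,
  drift theta a x = \int[mu1 R]_y (kernel theta a (x, y)).
Proof. exact: svalP (cid (drift_exists theta a)). Qed.

Lemma target_exists theta : exists f : Xa R, \forall z \ae mu2 R,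
  f z = H (theta z.1, theta z.2).
Proof.
apply: (Linf_build (C := H0)); last by apply: nearW => z; exact: H_bnd.
apply: (measurableT_comp (lipschitz2_measurable H_lip)).
by apply: measurable_fun_pair; [exact: theta_fst_measurable | exact: theta_snd_measurable].
Qed.

Definition target theta : Xa R := sval (cid (target_exists theta)).

Lemma target_ae theta : \forall z \ae mu2 R, target theta z = H (theta z.1, theta z.2).
Proof. exact: svalP (cid (target_exists theta)). Qed.

Lemma truncation_exists a : exists f : Xa R, \forall z \ae mu2 R, f z = clip A (a z).
Proof.
apply: (Linf_build (C := A)); last by apply: nearW => z; exact: clip_bound.
exact: (measurableT_comp (@measurable_clip R A) (Linf_measurable a)).
Qed.

Definition truncation a : Xa R := sval (cid (truncation_exists a)).

Lemma truncation_ae a : \forall z \ae mu2 R, truncation a z = clip A (a z).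
Proof. exact: svalP (cid (truncation_exists a)). Qed.

Lemma drift_bound theta a : `|drift theta a| <= A * G0.
Proof.
apply: Linf_norm_le; first exact: mulr_ge0.
apply: filterS (drift_ae theta a) => x ->; apply: mu1_Rintegral_le.
- exact: kernel_section_measurable.
- exact: mulr_ge0.
- by apply: nearW => y; exact: kernel_bound.
Qed.

Lemma target_bound theta : `|target theta| <= H0.
Proof.
by apply: Linf_norm_le => //; apply: filterS (target_ae theta) => z ->.
Qed.

Lemma truncation_bound a : `|truncation a| <= A.
Proof.
apply: Linf_norm_le => //; apply: filterS (truncation_ae a) => z ->.
exact: clip_bound.
Qed.

Lemma truncation_lip a b : `|truncation a - truncation b| <= `|a - b|.
Proof.
apply: Linf_norm_le => //.
have E : \forall z \ae mu2 R,
    (truncation a - truncation b : Xa R) z = clip A (a z) - clip A (b z).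
  by apply: filterS3 (Linf_aeB (truncation a) (truncation b)) (truncation_ae a)
    (truncation_ae b) => z -> -> ->.
apply: filterS2 E (ae_dist a b) => z ->.
by apply: le_trans; exact: clip_lip.
Qed.

Lemma truncation_id a : `|a| <= A -> truncation a = a.
Proof.
move=> aA; apply: Linf_ae_eq.
apply: filterS2 (truncation_ae a) (Linf_ae_le a) => z -> az.
by rewrite clip_id// (le_trans az).
Qed.

Lemma target_lip theta theta' :
  `|target theta - target theta'| <= 2 * LH * `|theta - theta'|.
Proof.
apply: Linf_norm_le; first by rewrite !mulr_ge0.
have E1 : \forall z \ae mu2 R, `|theta z.1 - theta' z.1| <= `|theta - theta'| :=
  @ae_product_fst _ _ T1 T1 R (mu1 R) (mu1 R) _ (ae_dist theta theta').
have E2 : \forall z \ae mu2 R, `|theta z.2 - theta' z.2| <= `|theta - theta'| :=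
  @ae_product_snd _ _ T1 T1 R (mu1 R) (mu1 R) _ (ae_dist theta theta').
have E : \forall z \ae mu2 R, (target theta - target theta' : Xa R) z =
    H (theta z.1, theta z.2) - H (theta' z.1, theta' z.2).
  by apply: filterS3 (Linf_aeB (target theta) (target theta')) (target_ae theta)
    (target_ae theta') => z -> -> ->.
apply: filterS3 E E1 E2 => z -> z1 z2.
rewrite (le_trans (H_lip _ _))// -mulrA mulrCA ler_wpM2l//=.
by rewrite mulr_natl mulr2n lerD.
Qed.

(** The truncation bounds the factor of the difference of the values of [Gamma]
    by [A]; without it, the integral term is Lipschitz on bounded sets only. *)
Lemma drift_lip theta theta' a a' :
  `|drift theta a - drift theta' a'| <=
    G0 * `|a - a'| + 2 * A * LG * `|theta - theta'|.
Proof.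
set C := (leRHS); have C0 : 0 <= C by rewrite addr_ge0 ?mulr_ge0.
apply: Linf_norm_le => //.
have S := @ae_product_section _ _ T1 T1 R (mu1 R) (mu1 R) _ (ae_dist a a').
have Q := ae_dist theta theta'.
have E : \forall x \ae mu1 R, (drift theta a - drift theta' a' : Xtheta R) x =
    \int[mu1 R]_y (kernel theta a (x, y)) - \int[mu1 R]_y (kernel theta' a' (x, y)).
  by apply: filterS3 (Linf_aeB (drift theta a) (drift theta' a')) (drift_ae theta a)
    (drift_ae theta' a') => x -> -> ->.
apply: filterS3 E S (Q) => x -> Sx Qx.
have ik th b : (mu1 R).-integrable setT (EFin \o (fun y => kernel th b (x, y))).
  apply: (ae_bounded_integrable measurableT mu1_fin (C := A * G0)).
    exact: kernel_section_measurable.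
  by apply: nearW => y _; exact: kernel_bound.
rewrite -RintegralB//; apply: mu1_Rintegral_le => //.
  by apply: measurable_funB; exact: kernel_section_measurable.
apply: filterS2 Sx Q => y Sxy Qy; rewrite /kernel /=.
set c := clip A (a _); set c' := clip A (a' _).
set g := Gamma _; set g' := Gamma _.
have -> : c * g - c' * g' = g * (c - c') + c' * (g - g') by ring.
rewrite (le_trans (ler_normD _ _))// !normrM lerD//.
  by apply: ler_pM => //; [exact: Gamma_bnd | exact: le_trans (clip_lip _ _ _) Sxy].
rewrite (_ : 2 * A * LG * _ = A * (LG * (2 * `|theta - theta'|))); last by ring.
apply: ler_pM => //; first exact: clip_bound.
apply: le_trans (Gamma_lip _ _) _; rewrite ler_wpM2l//.
rewrite mulr_natl mulr2n.
have -> : theta y - theta x - (theta' y - theta' x) =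
  (theta y - theta' y) - (theta x - theta' x) by ring.
by rewrite (le_trans (ler_normB _ _))// lerD.
Qed.

Lemma Fop_drift (omega theta : Xtheta R) a : `|a| <= A ->
  \forall x \ae mu1 R, Fop Gamma omega theta a x = (omega + drift theta a : Xtheta R) x.
Proof.
move=> aA.
have S := @ae_product_section _ _ T1 T1 R (mu1 R) (mu1 R) _ (Linf_ae_le a).
apply: filterS3 S (drift_ae theta a) (Linf_aeD omega (drift theta a)) => x Sx Dx ->.
rewrite /Fop Dx; congr (_ + _).
apply: (ae_eq_Rintegral (mu := mu1 R)) => //.
- apply: measurable_funM.
    exact: (measurableT_comp (Linf_measurable a) (pair1_measurable x)).
  apply: (measurableT_comp Gamma_measurable); apply: measurable_funB.
    exact: Linf_measurable.
  exact: measurable_cst.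
- exact: kernel_section_measurable.
- by apply: filterS Sx => y axy _; rewrite /kernel clip_id// (le_trans axy).
Qed.

Lemma Gop_target theta a :
  \forall z \ae mu2 R, Gop H theta a z = (target theta - a : Xa R) z.
Proof.
apply: filterS2 (target_ae theta) (Linf_aeB (target theta) a) => z Hz ->.
by rewrite Hz addrC.
Qed.

End operators.

(** * Existence *)

Section relaxation.
Context (R : realType) (V : normedModType R).

(** Since [a - s *: (eps^-1 *: (h - a))] is [(1 + s / eps) *: a - (s / eps) *:
    h], the past of a relaxation toward a shorter vector is longer than the
    present. For [k < b] the coefficient [(k - b) / eps] is negative whatever
    [eps] is, whereas a bound on the norm of the relaxation term would grow
    like [1 / eps]: this is where the uniformity in [eps] comes from. *)
Lemma relaxation_lower (a h : V) (b k eps : R) : 0 < eps -> `|a| = b -> `|h| <= k ->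
  \forall s \near 0^'+, b - s * ((k - b) / eps) <= `|a - s *: (eps^-1 *: (h - a))|.
Proof.
move=> eps0 ab hk; near=> s.
have s0 : 0 < s by near: s; exact: nbhs_right_gt.
have se0 : 0 < s / eps by rewrite divr_gt0.
have -> : a - s *: (eps^-1 *: (h - a)) = (1 + s / eps) *: a - (s / eps) *: h.
  by rewrite scalerA scalerBr opprB scalerDl scale1r addrA.
apply: le_trans (lerB_dist _ _).
have -> : `|(1 + s / eps) *: a| = (1 + s / eps) * b.
  by rewrite normrZ ab gtr0_norm ?addr_gt0.
have -> : `|(s / eps) *: h| = s / eps * `|h| by rewrite normrZ gtr0_norm.
have -> : b - s * ((k - b) / eps) = (1 + s / eps) * b - s / eps * k by ring.
by rewrite lerD2l lerN2 ler_wpM2l// ltW.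
Unshelve. all: by end_near. Qed.

Lemma norm_scaled_difference (c : R) (a b a' b' : V) : 0 <= c ->
  `|c *: (a - b) - c *: (a' - b')| <= c * (`|a - a'| + `|b - b'|).
Proof.
move=> c0; rewrite -scalerBr normrZ ger0_norm// ler_wpM2l//.
by rewrite opprD addrACA -opprD ler_normB.
Qed.

End relaxation.

Section compositions.
Context (R : realType) (V W : normedModType R).

Lemma lipschitz_comp_continuous (F : V -> W) L (w : R -> V) :
  (forall u v, `|F u - F v| <= L * `|u - v|) -> continuous w ->
  continuous (fun t => F (w t)).
Proof.
move=> FL cw t; apply/cvgrPdist_le => e e0.
have L1 : 0 < `|L| + 1 by rewrite ltr_pwDr.
have /cvgrPdist_le/(_ _ (divr_gt0 e0 L1)) := cw t; apply: filterS => s.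
rewrite ler_pdivlMr// => Hs; rewrite (le_trans (FL _ _))// (le_trans _ Hs)//.
by rewrite mulrC ler_wpM2l// (le_trans (ler_norm L))// lerDl.
Qed.

Lemma continuous_comp_real (w : R -> V) (g : R -> R) : continuous w -> continuous g ->
  continuous (fun t => w (g t)).
Proof. by move=> cw cg t; apply: (@continuous_comp _ _ _ g w); [exact: cg | exact: cw]. Qed.

End compositions.

Section sum_prod_calculus.
Context (R : realType) (U V : normedModType R).
Implicit Types (w : R -> sum_prod U V).

Lemma left_diff_fst w t (d : sum_prod U V) : left_diff w t d ->
  left_diff (fun s => (w s).1) t d.1.
Proof.
move=> H e e0; apply: filterS (H e e0) => h; apply: le_trans.
exact: (sum_prod_norm1 (w t - w (t - h) - h *: d)).
Qed.

Lemma left_diff_snd w t (d : sum_prod U V) : left_diff w t d ->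
  left_diff (fun s => (w s).2) t d.2.
Proof.
move=> H e e0; apply: filterS (H e e0) => h; apply: le_trans.
exact: (sum_prod_norm2 (w t - w (t - h) - h *: d)).
Qed.

Lemma continuous_fst w : continuous w -> continuous (fun s => (w s).1).
Proof.
move=> cw t; apply/cvgrPdist_le => e e0.
have /cvgrPdist_le/(_ _ e0) := cw t; apply: filterS => s; apply: le_trans.
exact: (sum_prod_norm1 (w t - w s)).
Qed.

Lemma continuous_snd w : continuous w -> continuous (fun s => (w s).2).
Proof.
move=> cw t; apply/cvgrPdist_le => e e0.
have /cvgrPdist_le/(_ _ e0) := cw t; apply: filterS => s; apply: le_trans.
exact: (sum_prod_norm2 (w t - w s)).
Qed.

End sum_prod_calculus.

Section existence.
Context (R : realType) (Gamma : R -> R) (H : R * R -> R).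
Variables (G0 LG H0 LH : R).
Hypotheses (G0_ge0 : 0 <= G0) (LG_ge0 : 0 <= LG) (H0_ge0 : 0 <= H0) (LH_ge0 : 0 <= LH).
Hypothesis Gamma_bnd : forall x, `|Gamma x| <= G0.
Hypothesis Gamma_lip : forall x y, `|Gamma x - Gamma y| <= LG * `|x - y|.
Hypothesis H_bnd : forall p, `|H p| <= H0.
Hypothesis H_lip : forall p q, `|H p - H q| <= LH * (`|p.1 - q.1| + `|p.2 - q.2|).
Implicit Types (omega theta : Xtheta R) (a : Xa R) (eps : R).

Definition truncated_field A (A0 : 0 <= A) omega eps (w : Xspace R) : Xspace R :=
  (omega + drift A0 G0_ge0 Gamma_bnd Gamma_lip w.1 w.2,
   eps^-1 *: (target H_bnd H_lip w.1 - truncation A0 w.2)).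

Definition field_lip_const A eps := G0 + 2 * A * LG + eps^-1 * (2 * LH + 1).

Lemma field_lip A (A0 : 0 <= A) omega eps (w z : Xspace R) : 0 < eps ->
  `|truncated_field A0 omega eps w - truncated_field A0 omega eps z| <=
    field_lip_const A eps * `|w - z|.
Proof.
move=> eps0; have e0 : 0 <= eps^-1 by rewrite invr_ge0 ltW.
set d1 := `|w.1 - z.1|; set d2 := `|w.2 - z.2|.
have -> : `|w - z| = d1 + d2 by [].
have d10 : 0 <= d1 by exact: normr_ge0.
have d20 : 0 <= d2 by exact: normr_ge0.
have H1 : `|(truncated_field A0 omega eps w - truncated_field A0 omega eps z).1| <=
    G0 * d2 + 2 * A * LG * d1.
  rewrite /= opprD addrACA subrr add0r; exact: drift_lip.
have H2 : `|(truncated_field A0 omega eps w - truncated_field A0 omega eps z).2| <=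
    eps^-1 * (2 * LH * d1 + d2).
  apply: le_trans (norm_scaled_difference (target H_bnd H_lip w.1) (truncation A0 w.2)
    (target H_bnd H_lip z.1) (truncation A0 z.2) e0) _.
  apply: ler_wpM2l e0 _ _ _; apply: lerD; last exact: truncation_lip.
  exact: target_lip.
apply: (le_trans (lerD H1 H2)).
have -> : field_lip_const A eps * (d1 + d2) =
  G0 * d2 + 2 * A * LG * d1 + eps^-1 * (2 * LH * d1 + d2) +
  (G0 * d1 + 2 * A * LG * d2 + eps^-1 * (2 * LH * d2 + d1)).
  by rewrite /field_lip_const; ring.
by rewrite lerDl !addr_ge0 ?mulr_ge0 ?addr_ge0 ?mulr_ge0.
Qed.

Lemma field_bound A (A0 : 0 <= A) omega eps (w : Xspace R) : 0 < eps ->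
  `|truncated_field A0 omega eps w| <= `|omega| + A * G0 + eps^-1 * (H0 + A).
Proof.
move=> eps0; have e0 : 0 <= eps^-1 by rewrite invr_ge0 ltW.
apply: lerD.
  by apply: le_trans (ler_normD _ _) _; apply: lerD (lexx _) (drift_bound _ _ _ _ _ _).
rewrite normrZ (ger0_norm e0); apply: ler_wpM2l e0 _ _ _.
apply: le_trans (ler_normB _ _) _; apply: lerD; first exact: target_bound.
exact: truncation_bound.
Qed.

(** At a contact with [b <= A] the truncation is not active, so that [a]
    relaxes toward a target bounded by [H0 < b]. *)
Lemma truncated_barrier A (A0 : 0 <= A) (T b eps : R) omega (w : R -> Xspace R) :
  0 < eps -> continuous w -> b <= A -> H0 < b -> `|(w 0).2| < b ->
  (forall t, 0 < t <= T -> left_diff w t (truncated_field A0 omega eps (w t))) ->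
  forall t, 0 <= t <= T -> `|(w t).2| < b.
Proof.
move=> eps0 cw bA Hb w0 wd.
apply: (@barrier_norm _ _ T (fun t => (w t).2) (cst b) (cst 0)) => //.
- exact: continuous_snd.
- by move=> t; exact: cvg_cst.
- move=> t _; have := @left_diff_affine R R^o b 0 t; apply: left_diff_near ltr01 _ => s _.
  by rewrite scaler0 addr0.
move=> t tT wtb _.
exists (eps^-1 *: (target H_bnd H_lip (w t).1 - (w t).2)), ((H0 - b) / eps); split.
- have := left_diff_snd (wd _ tT); rewrite /truncated_field /= truncation_id//.
  by rewrite wtb.
- by apply: relaxation_lower => //; exact: target_bound.
- by rewrite /= pmulr_llt0 ?invr_gt0// subr_lt0.
Qed.

(** As long as [a] is bounded by [A], the truncated field is the one of the
    system. *)
Lemma field_strong_solution A (A0 : 0 <= A) eps omega (w0 : Xspace R) T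
    (w : R -> Xspace R) C :
  0 < eps -> 0 <= T ->
  (forall s t, `|w t - w s - (t - s) *: truncated_field A0 omega eps (w (Num.max 0 s))| <=
     C * (t - s) ^+ 2) -> w 0 = w0 -> continuous w ->
  (forall t, 0 <= t <= T -> `|(w t).2| <= A) ->
  strong_solution Gamma H eps omega w0 T w.
Proof.
move=> eps0 T0 wC w00 cw wA.
exists (fun t => truncated_field A0 omega eps (w (Num.max 0 t))); split.
- apply: (in_W1inf_C1 (C := C)) => //.
  + apply: sum_prod_norming; apply: Linf_norming; [exact: mu1_fin | exact: mu2_fin].
  + by apply: sum_prod_cauchy_complete; exact: Linf_cauchy_complete.
  + have L' u v := field_lip A0 omega u v eps0.
    apply: (lipschitz_comp_continuous L').
    apply: (@continuous_comp_real _ _ w (fun t => Num.max 0 t)) => //.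
    by apply: (lipschitz_continuous (L := 1)) => x y; rewrite mul1r; exact: max0_lip.
- by exists w; split => //; [exact: continuous_subspaceT | apply: nearW].
- apply: ae_leb_itv => t tT; have /andP[t0 _] := tT.
  rewrite (max_idPr t0); split.
    have := Fop_drift A0 G0_ge0 Gamma_bnd Gamma_lip omega (w t).1 (wA _ tT).
    by apply: filterS => x E _; rewrite E.
  rewrite /= scalerA divff ?gt_eqF// scale1r truncation_id ?wA//.
  have := Gop_target H_bnd H_lip (w t).1 (w t).2.
  apply: (@filterS _ _ (@ae_filter_ringOfSetsType _
    (measurableTypeR R * measurableTypeR R)%type R (mu2 R))) => x E _.
  by rewrite E.
Qed.

(** The level of truncation exceeds both [|a_0|] and [H0], and is therefore
    never reached. *)
Lemma global_solution_exists omega eps (w0 : Xspace R) : 0 < eps ->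
  exists w : R -> Xspace R, [/\ global_strong_solution Gamma H eps omega w0 w,
    continuous w & w 0 = w0].
Proof.
move=> eps0; pose A := Num.max `|w0.2| H0 + 1.
have A0 : 0 <= A by rewrite addr_ge0// le_max normr_ge0.
have HA : H0 < A by rewrite ltr_pwDr// le_max lexx orbT.
have w0A : `|w0.2| < A by rewrite ltr_pwDr// le_max lexx.
have L0 : 0 <= field_lip_const A eps.
  have e0 : 0 <= eps^-1 by rewrite invr_ge0 ltW.
  rewrite /field_lip_const; apply: addr_ge0; first by rewrite addr_ge0// !mulr_ge0.
  by apply: mulr_ge0 => //; rewrite addr_ge0// mulr_ge0.
have VC : cauchy_complete (Xspace R).
  by apply: sum_prod_cauchy_complete; exact: Linf_cauchy_complete.
pose C := field_lip_const A eps * (`|omega| + A * G0 + eps^-1 * (H0 + A)).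
have [w [w00 wC]] := bounded_lipschitz_ode w0
  (fun u v => field_lip A0 omega u v eps0) (fun u => field_bound A0 omega u eps0) L0 VC.
have cw : continuous w.
  move=> t; apply/differentiable_continuous/derivable1_diffP.
  by have [] := is_derive_taylor (fun s => wC t s).
exists w; split => // T T0.
apply: (@field_strong_solution A A0 eps omega w0 T w C) => //.
  exact: ltW.
move=> t tT; apply/ltW.
apply: (truncated_barrier (T := T) (A0 := A0) (omega := omega) eps0 cw (lexx A) HA) => //.
  by rewrite w00.
move=> s /andP[s0 _]; have := wC s; rewrite (max_idPr (ltW s0)) => Hs.
apply: (left_diff_taylor (C := C)) => r.
have -> : w s - w r - (s - r) *: truncated_field A0 omega eps (w s) =
    - (w r - w s - (r - s) *: truncated_field A0 omega eps (w s)).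
  by rewrite -[s - r]opprB scaleNr opprK !opprB addrC.
by rewrite normrN -[(s - r) ^+ 2]sqrrN opprB.
Qed.

End existence.

(** * Strong solutions are classical *)

Section clamp.
Context (R : realType) (V : normedModType R).
Implicit Types (T t s x : R) (w z : R -> V).

Definition clamp T t : R := Num.max 0 (Num.min t T).

Lemma clamp_itv T t : 0 <= T -> 0 <= clamp T t <= T.
Proof. by move=> T0; rewrite /clamp le_max lexx /= ge_max T0 ge_min lexx orbT. Qed.

Lemma clamp_id T t : 0 <= t <= T -> clamp T t = t.
Proof. by move=> /andP[t0 tT]; rewrite /clamp (min_idPl tT) (max_idPr t0). Qed.

Lemma clamp_le0 T t : 0 <= T -> t <= 0 -> clamp T t = 0.
Proof.
by move=> T0 t0; rewrite /clamp (min_idPl (le_trans t0 T0)) (max_idPl t0).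
Qed.

Lemma clamp_lip T t s : `|clamp T t - clamp T s| <= `|t - s|.
Proof.
apply: le_trans (max0_lip _ _) _.
have h1 : t - s <= `|t - s| := ler_norm _.
have h2 : s - t <= `|t - s| by rewrite distrC ler_norm.
have h3 : 0 <= `|t - s| by [].
move: `|t - s| h1 h2 h3 => d h1 h2 h3; rewrite ler_norml.
by case: (leP t T) => tT; case: (leP s T) => sT; apply/andP; split; lra.
Qed.

(** A function that is continuous on an interval of time becomes one on the
    line, where left derivatives, barriers and weak derivatives are handled. *)
Lemma clamp_continuous T w : 0 <= T -> {within `[0, T], continuous w} ->
  continuous (fun t => w (clamp T t)).
Proof.
move=> T0 /subspace_continuousP cw t; apply/cvgrPdist_le => e e0.
have tT : `[0, T]%classic (clamp T t) by rewrite /= in_itv/= clamp_itv.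
have /cvgrPdist_le/(_ _ e0) := cw _ tT.
move=> /nbhs_ballP[d /= d0 Hd]; apply/nbhs_ballP; exists d => // s; rewrite /ball/= => ts.
apply: Hd; last by rewrite /= in_itv/= clamp_itv.
by rewrite /ball/= (le_lt_trans (clamp_lip _ _ _)).
Qed.

Lemma ae_eq_continuous T w z : 0 < T -> continuous w -> continuous z ->
  (\forall t \ae leb_itv 0 T, w t = z t) -> forall t, 0 <= t <= T -> w t = z t.
Proof.
move=> T0 cw cz wz t /andP[t0 tT]; apply/eqP; rewrite -subr_eq0 -normr_le0.
apply/ler_addgt0Pr => e e0; rewrite add0r.
have e20 : 0 < e / 2 by rewrite divr_gt0.
have /cvgrPdist_le/(_ _ e20)/nbhs_ballP[d /= d0 Hd] := cw t.
have /cvgrPdist_le/(_ _ e20)/nbhs_ballP[d' /= d'0 Hd'] := cz t.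
(* The interval from a to a + m contains t and lies in [0, T], also when t is
   an end point; having positive measure, it meets the set where w = z. *)
pose m := Num.min (Num.min d d') (T / 2).
have m0 : 0 < m by rewrite !lt_min d0 d'0 divr_gt0.
pose a := if t <= T / 2 then t else t - m.
have at' : a <= t <= a + m.
  by rewrite /a; case: ifP => _; rewrite ?subrK ?lexx ?lerDl ?andbT ?gerBl ltW.
have mT : m <= T / 2 by rewrite ge_min lexx orbT.
have aT : 0 <= a /\ a + m <= T.
  rewrite /a; case: (leP t (T / 2)) => tT2; split => //.
  - by rewrite (le_trans (lerD tT2 mT))// -splitr.
  - by rewrite subr_ge0 (le_trans mT) ?(ltW tT2).
  - by rewrite subrK.
have [s [asm ws]] : exists s, a < s < a + m /\ w s = z s.
  apply: contrapT => Hn; have [N [mN N0 PN]] := wz.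
  have sub : `]a, a + m[ `<=` N.
    move=> s /= sam; apply: PN => /= E; apply: Hn; exists s; split => //.
  pose I : set R := `]a, a + m[; pose J : set R := `[0, T].
  have le0 : (lebesgue_measure (I `&` J) <= 0)%E.
    rewrite -N0; have mI : (leb_itv 0 T I <= leb_itv 0 T N)%E; last exact: mI.
    by apply: le_measure => //; rewrite inE//; exact: measurable_itv.
  move: le0; rewrite setIidl /I /J; last first.
    move=> s; rewrite /= !in_itv/= => /andP[as' sm]; case: aT => a0 amT.
    by rewrite (le_trans a0 (ltW as')) (le_trans (ltW sm) amT).
  rewrite lebesgue_measure_itv/= lte_fin ltrDl m0 -EFinD lee_fin addrC addKr.
  by rewrite leNgt m0.
have tsm : `|t - s| < m.
  case/andP: at' => at1 at2; case/andP: asm => s1 s2.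
  by rewrite ltr_norml; apply/andP; split; lra.
move: tsm; rewrite !lt_min => /andP[/andP[tsd tsd'] _].
rewrite -(subrKA (w s)) {2}ws (le_trans (ler_normD _ _))// [e]splitr lerD//.
  exact: Hd.
by rewrite distrC; exact: Hd'.
Qed.

End clamp.

Section classical_form.
Context (R : realType) (Gamma : R -> R) (H : R * R -> R).
Variables (G0 LG H0 LH : R).
Hypotheses (G0_ge0 : 0 <= G0) (LG_ge0 : 0 <= LG) (H0_ge0 : 0 <= H0) (LH_ge0 : 0 <= LH).
Hypothesis Gamma_bnd : forall x, `|Gamma x| <= G0.
Hypothesis Gamma_lip : forall x y, `|Gamma x - Gamma y| <= LG * `|x - y|.
Hypothesis H_bnd : forall p, `|H p| <= H0.
Hypothesis H_lip : forall p q, `|H p - H q| <= LH * (`|p.1 - q.1| + `|p.2 - q.2|).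
Local Notation field := (truncated_field G0_ge0 Gamma_bnd Gamma_lip H_bnd H_lip).

(** The system in the sense of left derivatives. All levels [A] that the
    solution does not exceed are allowed, as the a priori bound that makes the
    final choice of [A] is proved from the equation itself; the bound [B] gives
    a first level. *)
Definition classical_solution (eps : R) (omega : Xtheta R) (w0 : Xspace R) (T : R)
    (w : R -> Xspace R) : Prop :=
  [/\ continuous w, w 0 = w0, exists B, forall t, `|(w t).2| <= B &
     forall A (A0 : 0 <= A), (forall t, 0 <= t <= T -> `|(w t).2| <= A) ->
     forall t, 0 < t <= T -> left_diff w t (field A0 omega eps (w t))].

Lemma field_eq A (A0 : 0 <= A) eps omega (w w' : Xspace R) : 0 < eps -> `|w.2| <= A ->
  ((w'.1 : Xtheta R) = Fop Gamma omega w.1 w.2 %[ae mu1 R]) ->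
  ((eps *: w'.2 : Xa R) = Gop H w.1 w.2 %[ae mu2 R]) ->
  field A0 omega eps w = w'.
Proof.
move=> eps0 wA w1 w2.
have E1 : omega + drift A0 G0_ge0 Gamma_bnd Gamma_lip w.1 w.2 = w'.1.
  apply: Linf_ae_eq.
  have := Fop_drift A0 G0_ge0 Gamma_bnd Gamma_lip omega w.1 wA.
  by apply: filterS2 w1 => x /(_ I) -> ->.
have E2 : target H_bnd H_lip w.1 - w.2 = eps *: w'.2.
  apply: Linf_ae_eq; have := Gop_target H_bnd H_lip w.1 w.2.
  move: w2; apply: (@filterS2 _ _ (@ae_filter_ringOfSetsType _
    (measurableTypeR R * measurableTypeR R)%type R (mu2 R))) => x /(_ I) -> ->.
  by [].
rewrite /truncated_field E1 truncation_id// E2 scalerA mulVf ?gt_eqF// scale1r.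
by case: (w').
Qed.

(** By the equations the weak derivative is, at almost every time, the
    truncated field along [w], and this is a continuous function of time:
    [weak_derivative_strong] applies. *)
Lemma strong_solution_classical eps omega (w0 : Xspace R) T (z : R -> Xspace R) :
  0 < eps -> 0 < T -> strong_solution Gamma H eps omega w0 T z ->
  exists2 w, classical_solution eps omega w0 T w & \forall t \ae leb_itv 0 T, w t = z t.
Proof.
move=> eps0 T0 [z' [[_ _ zz'] [w1 [cw1 w1z w10]] eqs]].
have T0' := ltW T0.
pose w t := w1 (clamp T t).
have cw : continuous w := clamp_continuous T0' cw1.
have wz : \forall t \ae leb_itv 0 T, w t = z t.
  have itv : \forall t \ae leb_itv 0 T, 0 <= t <= T by exact: ae_leb_itv.
  by apply: filterS2 w1z itv => t <- tT; rewrite /w clamp_id.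
exists w => //; split => //.
- by rewrite /w clamp_le0.
- have [B B0 HB] := continuous_itv_bounded 0 T cw.
  exists B => t; rewrite (le_trans (sum_prod_norm2 (w t)))//.
  have -> : w t = w (clamp T t) by rewrite /w [in RHS]clamp_id// clamp_itv.
  by apply: HB; exact: clamp_itv.
move=> A A0 wA; pose Phi t := field A0 omega eps (w t).
have cPhi : continuous Phi.
  exact: (lipschitz_comp_continuous (fun u v => field_lip G0_ge0 LG_ge0 LH_ge0
    Gamma_bnd Gamma_lip H_bnd H_lip A0 omega u v eps0) cw).
have Phi0 x : x <= 0 -> Phi x = Phi 0.
  by move=> x0; rewrite /Phi /w (clamp_le0 T0' x0) (clamp_le0 T0' (lexx 0)).
have Phiz : \forall t \ae leb_itv 0 T, Phi t = z' t.
  have itv : \forall t \ae leb_itv 0 T, 0 <= t <= T by exact: ae_leb_itv.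
  by apply: filterS3 (wz) eqs itv => t wzt [e1 e2] tT; apply: field_eq => //;
    [exact: wA | rewrite wzt | rewrite wzt].
have NV : norming (Xspace R).
  by apply: sum_prod_norming; apply: Linf_norming; [exact: mu1_fin | exact: mu2_fin].
have key := weak_derivative_strong NV T0' zz' cw cPhi Phi0 wz Phiz.
move=> t /andP[t0 tT] e e0.
have /cvgrPdist_le/(_ _ e0)/nbhs_ballP[d /= d0 Hd] := cPhi t.
apply: (@near0_right _ _ (Num.min d t)); first by rewrite lt_min d0.
move=> h /andP[h0]; rewrite lt_min => /andP[hd ht].
have := key (t - h) t e; rewrite subKr; apply => //.
  by rewrite subr_ge0 (ltW ht) gerBl ltW.
move=> r /andP[r1 r2]; rewrite distrC; apply: Hd; rewrite /ball/= ger0_norm ?subr_ge0//.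
by rewrite (le_lt_trans _ hd)// lerBlDl -lerBlDr.
Qed.

End classical_form.

(** * Stability and uniqueness *)

Section stability.
Context (R : realType) (Gamma : R -> R) (H : R * R -> R).
Variables (G0 LG H0 LH : R).
Hypotheses (G0_ge0 : 0 <= G0) (LG_ge0 : 0 <= LG) (H0_ge0 : 0 <= H0) (LH_ge0 : 0 <= LH).
Hypothesis Gamma_bnd : forall x, `|Gamma x| <= G0.
Hypothesis Gamma_lip : forall x y, `|Gamma x - Gamma y| <= LG * `|x - y|.
Hypothesis H_bnd : forall p, `|H p| <= H0.
Hypothesis H_lip : forall p q, `|H p - H q| <= LH * (`|p.1 - q.1| + `|p.2 - q.2|).
Local Notation field := (truncated_field G0_ge0 Gamma_bnd Gamma_lip H_bnd H_lip).
Local Notation classical_solution :=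
  (classical_solution G0_ge0 Gamma_bnd Gamma_lip H_bnd H_lip).

(** [truncated_barrier] at height [r + H0 + 1], with a level of truncation
    beyond [B]. The resulting bound does not involve [B]. *)
Lemma classical_a_priori eps omega (w0 : Xspace R) T w r : 0 < eps ->
  classical_solution eps omega w0 T w -> `|w0.2| <= r ->
  forall t, 0 <= t <= T -> `|(w t).2| <= r + H0 + 1.
Proof.
move=> eps0 [cw w00 [B HB] wd] w0r t tT.
have r0 : 0 <= r := le_trans (normr_ge0 _) w0r.
pose A := `|B| + (r + H0 + 1).
have A0 : 0 <= A by rewrite !addr_ge0.
apply/ltW; move: t tT.
apply: (truncated_barrier (G0_ge0 := G0_ge0) (Gamma_bnd := Gamma_bnd)
  (Gamma_lip := Gamma_lip) (H_bnd := H_bnd) (H_lip := H_lip) (T := T) (A0 := A0)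
  (omega := omega) (b := r + H0 + 1) H0_ge0 eps0 cw).
- by rewrite /A lerDr.
- by rewrite -addrA ltr_wpDl// ltrDl.
- by rewrite w00 (le_lt_trans w0r)// -addrA ltrDl ltr_wpDl.
- apply: wd => s _; rewrite (le_trans (HB s))// (le_trans (ler_norm B))// /A lerDl.
  by rewrite !addr_ge0.
Qed.

(** The three terms bound the contributions to the rate of the difference of
    the [theta]'s, relative to its barrier: the difference of the [omega]'s,
    that of the [a]'s, and that of the [theta]'s with [a] bounded by [r + H0 +
    1]. *)
Definition growth_rate r : R := 1 + G0 * (2 * LH + 1) + 2 * (r + H0 + 1) * LG.

Definition stability_const r T : R := (2 * LH + 2) * expR (growth_rate r * T).

(** The differences [th] and [al] of the two components stay below the barriers
    [bt = D * exp (la * t)] and [ba = K * bt], where [K = 2 * LH + 1]. At a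
    contact of [th], the choice of [la] makes its rate less than the slope of
    [bt]. At a contact of [al], the targets differ by at most [2 * LH * bt <
    ba], so that [al] relaxes toward a shorter vector. *)
Lemma classical_stability eps T r (omega1 omega2 : Xtheta R) (w01 w02 : Xspace R) w1 w2 :
  0 < eps ->
  classical_solution eps omega1 w01 T w1 -> classical_solution eps omega2 w02 T w2 ->
  `|w01.2| <= r -> `|w02.2| <= r ->
  forall t, 0 <= t <= T -> `|w1 t - w2 t| <= stability_const r T *
    (`|w01.1 - w02.1| + `|w01.2 - w02.2| + `|omega1 - omega2|).
Proof.
move=> eps0 sol1 sol2 w01r w02r.
have ap1 := classical_a_priori eps0 sol1 w01r.
have ap2 := classical_a_priori eps0 sol2 w02r.
have r0 : 0 <= r := le_trans (normr_ge0 _) w01r.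
set A := r + H0 + 1 in ap1 ap2.
have A0 : 0 <= A by rewrite !addr_ge0.
case: sol1 => cw1 w10 _ /(_ A A0 ap1) dw1; case: sol2 => cw2 w20 _ /(_ A A0 ap2) dw2.
set D0 := (X in _ * X); have D00 : 0 <= D0 by rewrite !addr_ge0.
have [n1 n2 n3] : [/\ `|w01.1 - w02.1| <= D0, `|w01.2 - w02.2| <= D0 &
    `|omega1 - omega2| <= D0].
  have sum3 (x y z : R) : 0 <= x -> 0 <= y -> 0 <= z ->
      [/\ x <= x + y + z, y <= x + y + z & z <= x + y + z].
    by move=> *; split; lra.
  exact: sum3.
pose K := 2 * LH + 1; have K1 : 1 <= K by rewrite lerDr mulr_ge0.
pose la := growth_rate r.
have la0 : 0 <= la by rewrite /la /growth_rate !addr_ge0 ?mulr_ge0 ?addr_ge0 ?mulr_ge0.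
pose th t := (w1 t).1 - (w2 t).1; pose al t := (w1 t).2 - (w2 t).2.
have cth : continuous th.
  by move=> t; apply: cvgB; [exact: (continuous_fst cw1) | exact: (continuous_fst cw2)].
have cal : continuous al.
  by move=> t; apply: cvgB; [exact: (continuous_snd cw1) | exact: (continuous_snd cw2)].
have dth t : 0 < t <= T -> left_diff th t
    ((field A0 omega1 eps (w1 t)).1 - (field A0 omega2 eps (w2 t)).1).
  move=> tT; have := left_diffB (left_diff_fst (dw1 _ tT)) (left_diff_fst (dw2 _ tT)).
  exact.
have dal t : 0 < t <= T -> left_diff al t
    ((field A0 omega1 eps (w1 t)).2 - (field A0 omega2 eps (w2 t)).2).
  move=> tT; have := left_diffB (left_diff_snd (dw1 _ tT)) (left_diff_snd (dw2 _ tT)).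
  exact.
have main D : D0 < D -> forall t, 0 <= t <= T ->
    `|th t| < D * expR (la * t) /\ `|al t| < K * D * expR (la * t).
  move=> D0D; have Dpos : 0 < D := le_lt_trans D00 D0D.
  have KD : D <= K * D by rewrite ler_peMl// ltW.
  pose bt t := D * expR (la * t); pose ba t := K * D * expR (la * t).
  have cbt : continuous bt by exact: continuous_expR_scale.
  have cba : continuous ba by exact: continuous_expR_scale.
  pose g t := Num.max (`|th t| - bt t) (`|al t| - ba t).
  have cg : continuous g.
    by move=> t; apply: (@continuous_max _ _ (fun t => `|th t| - bt t)
      (fun t => `|al t| - ba t)); apply: cvgB;
      [apply: cvg_norm; exact: cth | exact: cbt | apply: cvg_norm; exact: cal | exact: cba].
  suff Hg t : 0 <= t <= T -> g t < 0.
    by move=> t /Hg; rewrite /g gt_max !subr_lt0 => /andP[].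
  apply: (@first_contact _ T g) => //.
    rewrite /g /th /al /bt /ba w10 w20 mulr0 expR0 !mulr1 gt_max !subr_lt0.
    apply/andP; split; first exact: le_lt_trans n1 D0D.
    exact: lt_le_trans (le_lt_trans n2 D0D) KD.
  move=> s sT below gs; have /andP[s0 sT'] := sT.
  have E1 : 1 <= expR (la * s) by rewrite -expR0 ler_expR mulr_ge0// ltW.
  have DE : D <= bt s by rewrite /bt ler_peMr// ltW.
  have belowt x : 0 <= x < s -> `|th x| <= bt x.
    by move=> /below; rewrite /g gt_max => /andP[+ _]; rewrite subr_lt0 => /ltW.
  have belowa x : 0 <= x < s -> `|al x| <= ba x.
    by move=> /below; rewrite /g gt_max => /andP[_ +]; rewrite subr_lt0 => /ltW.
  have ths : `|th s| <= bt s.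
    by rewrite -subr_le0 -gs /g le_max lexx.
  have als : `|al s| <= ba s.
    by rewrite -subr_le0 -gs /g le_max lexx orbT.
  have baE : ba s = K * bt s by rewrite /ba /bt mulrA.
  have [ct|ca] : `|th s| = bt s \/ `|al s| = ba s.
    move: gs; rewrite /g; case: leP => _ /eqP; rewrite subr_eq0 => /eqP; by [right|left].
  (* Contact of th: eps does not occur. *)
  - set d := (field A0 omega1 eps (w1 s)).1 - (field A0 omega2 eps (w2 s)).1.
    have dk : `|d| < la * bt s.
      have H1 : `|d| <= `|omega1 - omega2| + (G0 * `|al s| + 2 * A * LG * `|th s|).
        rewrite /d /= opprD addrACA (le_trans (ler_normD _ _))// lerD2l.
        exact: drift_lip.
      rewrite (le_lt_trans H1)//.
      have H2 : `|omega1 - omega2| < bt s.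
        exact: lt_le_trans (le_lt_trans n3 D0D) DE.
      have H3 : G0 * `|al s| <= G0 * (K * bt s) by rewrite ler_wpM2l// -baE.
      have H4 : 2 * A * LG * `|th s| <= 2 * A * LG * bt s by rewrite ler_wpM2l// !mulr_ge0.
      have -> : la * bt s = bt s + (G0 * (K * bt s) + 2 * A * LG * bt s).
        by rewrite /la /growth_rate /K /A; ring.
      by rewrite ltr_leD// lerD.
    apply: (no_contact (dth _ sT) (left_diff_expR D la s) ct (near_lower ct (lexx _)) dk).
    exact: (@nonneg_of_right _ (fun x => `|th x| <= bt x)).
  (* Contact of al: the coefficient of relaxation_lower is negative, and the
     slope of the barrier is nonnegative, for every eps. *)
  - set h := target H_bnd H_lip (w1 s).1 - target H_bnd H_lip (w2 s).1.
    have hk : `|h| <= 2 * LH * bt s.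
      by rewrite (le_trans (target_lip LH_ge0 _ _ _ _))// ler_wpM2l// mulr_ge0.
    have dE : (field A0 omega1 eps (w1 s)).2 - (field A0 omega2 eps (w2 s)).2 =
        eps^-1 *: (h - al s).
      have sT2 : 0 <= s <= T by rewrite ltW.
      rewrite /truncated_field /= !truncation_id ?ap1 ?ap2// -scalerBr; congr (_ *: _).
      by rewrite /h /al !opprB addrACA [RHS]addrACA; congr (_ + _); rewrite addrC.
    have := dal _ sT; rewrite dE => dal'.
    have kneg : (2 * LH * bt s - ba s) / eps < la * ba s.
      apply: (@lt_le_trans _ _ 0).
        rewrite pmulr_llt0 ?invr_gt0// baE /K (_ : _ - _ = - bt s); last by ring.
        by rewrite oppr_lt0 (lt_le_trans Dpos).
      by rewrite mulr_ge0// (le_trans _ als).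
    apply: (no_contact dal' (left_diff_expR (K * D) la s) ca
      (relaxation_lower eps0 ca hk) kneg).
    exact: (@nonneg_of_right _ (fun x => `|al x| <= ba x)).
move=> t tT; apply/ler_addgt0Pr => e e0.
have S0 : 0 < stability_const r T.
  by rewrite /stability_const mulr_gt0 ?expR_gt0// ltr_wpDl ?mulr_ge0.
have Dlt : D0 < D0 + e / stability_const r T by rewrite ltrDl divr_gt0.
have [H1 H2] := main _ Dlt _ tT.
have -> : `|w1 t - w2 t| = `|th t| + `|al t| by [].
rewrite (le_trans (ltW (ltrD H1 H2)))//.
have -> : stability_const r T * D0 + e =
    stability_const r T * (D0 + e / stability_const r T).
  by field; rewrite gt_eqF.
set D := D0 + _.
have -> : D * expR (la * t) + K * D * expR (la * t) = (2 * LH + 2) * expR (la * t) * D.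
  by rewrite /K; ring.
rewrite ler_wpM2r ?addr_ge0 ?divr_ge0 ?(ltW e0) ?(ltW S0)//.
rewrite /stability_const ler_wpM2l ?addr_ge0 ?mulr_ge0// ler_expR ler_wpM2l//.
by case/andP: tT.
Qed.

End stability.

(* Elements of W^{1,oo} being classes of functions of time, uniqueness is up to
   a null set of times; in the second part, the solutions are taken as elements
   of C([0, T]; X), i.e. through their continuous representatives. *)
Theorem theorem2p4 (R : realType) (Gamma : R -> R) (H : R * R -> R)
    (Gamma_C1b : C1b Gamma) (Gamma_per : periodic Gamma (pi *+ 2))
    (H_C1b : C1b2 H)
    (H_per1 : forall y, periodic (fun x => H (x, y)) (pi *+ 2))
    (H_per2 : forall x, periodic (fun y => H (x, y)) (pi *+ 2)) :
  (forall (omega : Xtheta R) (eps : R) (w0 : Xspace R), 0 < eps ->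
     exists w : R -> Xspace R,
       [/\ global_strong_solution Gamma H eps omega w0 w,
           {within [set t | 0 <= t], continuous w} &
           forall z : R -> Xspace R, global_strong_solution Gamma H eps omega w0 z ->
             \forall t \ae @lebesgue_measure R, 0 <= t -> z t = w t]) /\
  (forall T r eps0 : R, 0 < T -> 0 < r -> 0 < eps0 ->
     exists2 L : R, 0 <= L &
       forall eps : R, 0 < eps <= eps0 ->
       forall (theta1 theta2 : Xtheta R) (a1 a2 : Xa R)
         (omega1 omega2 : Xtheta R),
         `|theta1| + `|a1| + `|omega1| <= r ->
         `|theta2| + `|a2| + `|omega2| <= r ->
       forall w1 w2 : R -> Xspace R,
         strong_solution Gamma H eps omega1 (theta1, a1) T w1 ->
         strong_solution Gamma H eps omega2 (theta2, a2) T w2 ->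
         {within `[0, T], continuous w1} -> {within `[0, T], continuous w2} ->
       forall t, 0 <= t <= T ->
         `|w1 t - w2 t| <=
         L * (`|theta1 - theta2| + `|a1 - a2| + `|omega1 - omega2|)).
Proof.
have [G0 [LG [G0_ge0 LG_ge0 Gamma_bnd Gamma_lip]]] := C1b_bounded_lipschitz Gamma_C1b.
have [H0 [LH [H0_ge0 LH_ge0 H_bnd H_lip]]] := C1b2_bounded_lipschitz H_C1b.
have classical eps omega w0 T z := @strong_solution_classical R Gamma H G0 LG H0 LH
  G0_ge0 LG_ge0 LH_ge0 Gamma_bnd Gamma_lip H_bnd H_lip eps omega w0 T z.
split=> [omega eps w0 eps0|T r eps0 T0 r0 _].
  have [w [solw cw w00]] := global_solution_exists G0_ge0 LG_ge0 H0_ge0 LH_ge0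
    Gamma_bnd Gamma_lip H_bnd H_lip omega w0 eps0.
  exists w; split => //; first exact: continuous_subspaceT.
  move=> z solz.
  have zw n : \forall t \ae @lebesgue_measure R, 0 <= t <= n.+1%:R -> z t = w t.
    have n0 : 0 < n.+1%:R :> R by rewrite ltr0n.
    have [v1 c1 v1z] := classical _ _ _ _ _ eps0 n0 (solz _ n0).
    have [v2 c2 v2w] := classical _ _ _ _ _ eps0 n0 (solw _ n0).
    apply: ae_lebesgue_of_leb_itv.
    have itv : \forall t \ae leb_itv 0 n.+1%:R, 0 <= t <= (n.+1%:R : R).
      exact: ae_leb_itv.
    apply: filterS3 v1z v2w itv => t <- <- tn; apply/eqP; rewrite -subr_eq0 -normr_le0.
    have := classical_stability LG_ge0 H0_ge0 LH_ge0 eps0 c1 c2 (lexx _) (lexx _) tn.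
    by rewrite !subrr !normr0 !addr0 mulr0.
  have := ae_foralln zw; apply: filterS => t H' t0; apply: (H' (Num.truncn t)).
  by rewrite t0 ltW// truncnS_gt.
exists (stability_const G0 LG H0 LH r T).
  by rewrite /stability_const mulr_ge0 ?expR_ge0// addr_ge0// mulr_ge0.
move=> eps /andP[eps_gt0 _] theta1 theta2 a1 a2 omega1 omega2 r1 r2.
move=> w1 w2 sol1 sol2 cw1 cw2 t tT.
have [v1 c1 v1w] := classical _ _ _ _ _ eps_gt0 T0 sol1.
have [v2 c2 v2w] := classical _ _ _ _ _ eps_gt0 T0 sol2.
have rep (v w : R -> Xspace R) : continuous v -> {within `[0, T], continuous w} ->
    (\forall t \ae leb_itv 0 T, v t = w t) -> w t = v t.
  move=> cv cw vw; have cw' := clamp_continuous (ltW T0) cw.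
  rewrite -{1}(clamp_id tT); apply/esym.
  apply: (ae_eq_continuous T0 cv cw' _ tT).
  have itv : \forall t \ae leb_itv 0 T, 0 <= t <= T by exact: ae_leb_itv.
  by apply: filterS2 vw itv => s vs sT; rewrite clamp_id.
have [cv1 _ _ _] := c1; have [cv2 _ _ _] := c2.
rewrite (rep _ _ cv1 cw1 v1w) (rep _ _ cv2 cw2 v2w).
have a_le (theta omega : Xtheta R) (a : Xa R) :
    `|theta| + `|a| + `|omega| <= r -> `|a| <= r.
  by apply: le_trans; rewrite addrAC lerDr addr_ge0.
exact: (classical_stability LG_ge0 H0_ge0 LH_ge0 eps_gt0 c1 c2
  (a_le _ _ _ r1) (a_le _ _ _ r2) tT).
Qed.
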